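(* For every dimension $d\ge 1$ there exists a constant $C>0$, depending only on $d$, such that for every $\Lambda>0$ and every periodic function $u:[0,\Lambda]^d\to\mathbb{R}$ with $\int_{[0,\Lambda]^d}u\,dx=0$, $$\|u\|_{\frac43}\;\le\; C\,\|\nabla u\|_{1}^{\frac12}\,\big\||\nabla|^{-1}u\big\|_{2}^{\frac12}.$$
   Context: Periodic means $\Lambda$-periodic in each coordinate, i.e. $u$ is a function on the torus $[0,\Lambda]^d$. $\|f\|_p=\left(\int_{[0,\Lambda]^d}|f|^p\,dx\right)^{1/p}$ (integral, not average). $\|\nabla u\|_1=\int_{[0,\Lambda]^d}|\nabla u|\,dx$, understood as the total variation of the distributional gradient on the torus when $u$ is merely of bounded variation. For periodic $u$ with vanishing average, $\||\nabla|^{-1}u\|_2$ is the homogeneous $\dot H^{-1}$-norm, given by $$\||\nabla|^{-1}u\|_2^2=\inf\left\{\int_{[0,\Lambda]^d}|j|^2\,dx\;:\; j \text{ periodic vector field},\ \nabla\cdot j=u\right\}=\int_{[0,\Lambda]^d}|\nabla\varphi|^2\,dx,$$ where $\varphi$ is the periodic solution of $-\Delta\varphi=u$. The inequality is understood for $u$ such that the right-hand side quantities are finite. *)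

(* Defs.v *)
From HB Require Import structures.
From mathcomp Require Import all_boot all_order all_algebra.
From mathcomp Require Import all_classical all_reals all_analysis.

Set Implicit Arguments.
Unset Strict Implicit.
Unset Printing Implicit Defensive.

Import Order.TTheory GRing.Theory Num.Theory.
Import numFieldNormedType.Exports.

Local Open Scope classical_set_scope.
Local Open Scope ring_scope.

Definition measure_rV_display : measure_display -> measure_display.
Proof. exact. Qed.

Section measurable_rV.
Context {d} {T : sigmaRingType d} {n : nat}.

Let coors : 'I_n -> 'rV[T]_n -> T := fun i x => x ord0 i.

Let rV_set0 : g_sigma_preimage coors set0.
Proof. exact: sigma_algebra0. Qed.

Let rV_setC A : g_sigma_preimage coors A -> g_sigma_preimage coors (~` A).
Proof. exact: sigma_algebraC. Qed.

Let rV_bigcup (F : _^nat) : (forall i, g_sigma_preimage coors (F i)) ->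
  g_sigma_preimage coors (\bigcup_i (F i)).
Proof. exact: sigma_algebra_bigcup. Qed.

(* The product sigma-algebra, as in the library's instance on n.-tuple T; for
   T = R it is the Borel sigma-algebra of R^n. *)
HB.instance Definition _ := @isMeasurable.Build (measure_rV_display d)
  'rV[T]_n (g_sigma_preimage coors) rV_set0 rV_setC rV_bigcup.

End measurable_rV.

Lemma measurable_coord d (T : sigmaRingType d) n (i : 'I_n) :
  measurable_fun [set: 'rV[T]_n] (fun x => x ord0 i).
Proof.
move=> _ Y mY; rewrite setTI; apply: sub_sigma_algebra => /=.
rewrite -bigcup_seq/=; exists i => /=; first by rewrite mem_index_enum.
by exists Y => //; rewrite setTI.
Qed.

Lemma measurable_fun_rV d1 d2 (T1 : measurableType d1)
    (T2 : measurableType d2) n (f : T1 -> 'rV[T2]_n) :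
  (forall i, measurable_fun [set: T1] (fun x => f x ord0 i)) ->
  measurable_fun [set: T1] f.
Proof.
move=> mf; apply: measurability; first by [].
move=> _ [A + <-]; rewrite setTI -bigcup_seq/= => -[i _ [B mB <-]].
by rewrite setTI -[X in measurable X]setTI; exact: (mf i).
Qed.

Section cons_rV.
Context {R : realType} {n : nat}.

Definition cons_rV (p : measurableTypeR R * 'rV[R]_n) : 'rV[R]_n.+1 :=
  \row_i (if unlift ord0 i is Some j then p.2 ord0 j else p.1).

Definition uncons_rV (x : 'rV[R]_n.+1) : measurableTypeR R * 'rV[R]_n :=
  (x ord0 ord0, \row_j x ord0 (lift ord0 j)).

Lemma cons_rVK : cancel cons_rV uncons_rV.
Proof.
move=> [a v]; congr pair; first by rewrite mxE unlift_none.
by apply/rowP => j; rewrite !mxE liftK.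
Qed.

Lemma uncons_rVK : cancel uncons_rV cons_rV.
Proof.
move=> x; apply/rowP => i; rewrite mxE.
by case: unliftP => [j|] -> //=; rewrite mxE.
Qed.

Lemma measurable_cons_rV : measurable_fun setT cons_rV.
Proof.
apply: measurable_fun_rV => i.
under eq_fun do rewrite mxE.
case: unliftP => [j|] _; last exact: measurable_fst.
exact: (measurableT_comp (@measurable_coord _ R n j) measurable_snd).
Qed.

Lemma measurable_uncons_rV : measurable_fun setT uncons_rV.
Proof.
apply: measurable_fun_pair; first exact: (@measurable_coord _ R).
apply: measurable_fun_rV => i.
by under eq_fun do rewrite mxE; exact: measurable_coord.
Qed.

End cons_rV.

Section lebesgue_rV_step.
Context {R : realType} {n : nat}.
Variable mu : {sigma_finite_measure set 'rV[R]_n -> \bar R}.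
Local Open Scope ereal_scope.

Definition lebesgue_rV_step : set 'rV[R]_n.+1 -> \bar R :=
  pushforward (lebesgue_measure \x mu) cons_rV.

Let step0 : lebesgue_rV_step set0 = 0.
Proof. by apply: measure0; exact: measurable_cons_rV. Qed.

Let step_ge0 A : 0 <= lebesgue_rV_step A.
Proof. by apply: measure_ge0; exact: measurable_cons_rV. Qed.

Let step_sigma_additive : semi_sigma_additive lebesgue_rV_step.
Proof. by apply: measure_semi_sigma_additive; exact: measurable_cons_rV. Qed.

HB.instance Definition _ := isMeasure.Build _ _ _ lebesgue_rV_step
  step0 step_ge0 step_sigma_additive.

Let step_sigma_finite : sigma_finite setT lebesgue_rV_step.
Proof.
have /sigma_finiteP[F [TF ndF Foo]] := sigma_finiteT (@lebesgue_measure R).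
have /sigma_finiteP[G [TG ndG Goo]] := sigma_finiteT mu.
exists (fun k => uncons_rV @^-1` (F k `*` G k)).
  rewrite -preimage_bigcup [X in _ @^-1` X](_ : _ = setT)// -subTset => -[x y] _.
  have [k _ Fkx] : (\bigcup_k F k) x by rewrite -TF.
  have [l _ Gly] : (\bigcup_k G k) y by rewrite -TG.
  exists (maxn k l) => //; split.
  - by move: x Fkx; exact/subsetPset/ndF/leq_maxl.
  - by move: y Gly; exact/subsetPset/ndG/leq_maxr.
move=> k; have [? ?] := Foo k; have [? ?] := Goo k; split.
  rewrite -[X in measurable X]setTI.
  by apply: measurable_uncons_rV => //; exact: measurableX.
rewrite /lebesgue_rV_step /pushforward -comp_preimage.
rewrite (_ : uncons_rV \o cons_rV = id); last exact/funext/cons_rVK.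
by rewrite preimage_id product_measure1E// lte_mul_pinfty// ge0_fin_numE.
Qed.

HB.instance Definition _ := Measure_isSigmaFinite.Build _ _ _
  lebesgue_rV_step step_sigma_finite.

End lebesgue_rV_step.

(* Lebesgue measure on R^n, by iterated products; R^0 is a point of mass 1. *)
Fixpoint lebesgue_rV (R : realType) (n : nat) :
    {sigma_finite_measure set 'rV[R]_n -> \bar R} :=
  match n with
  | 0 => \d_(0 : 'rV[R]_0)
  | m.+1 => lebesgue_rV_step (lebesgue_rV R m)
  end.
Arguments lebesgue_rV {R n}.

Section torus.
Context {R : realType} {d : nat}.
Local Open Scope ereal_scope.

Definition cell (L : R) : set 'rV[R]_d :=
  [set x | forall i, x ord0 i \in `[0%R, L]].

Definition torus_periodic (L : R) (V : zmodType) (f : 'rV[R]_d -> V) : Prop :=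
  forall i : 'I_d, periodic f (L *: delta_mx ord0 i)%R.

Definition partial (i : 'I_d) (f : 'rV[R]_d -> R) : 'rV[R]_d -> R :=
  fun x => 'D_(delta_mx ord0 i) f x.

(* C^oo: every iterated partial derivative is everywhere differentiable. *)
Definition smooth (f : 'rV[R]_d -> R) : Prop :=
  forall (s : seq 'I_d) (x : 'rV[R]_d), differentiable (foldr partial f s) x.

Definition grad (f : 'rV[R]_d -> R) (x : 'rV[R]_d) : 'rV[R]_d :=
  \row_i partial i f x.

Definition coordf (F : 'rV[R]_d -> 'rV[R]_d) (i : 'I_d) : 'rV[R]_d -> R :=
  fun x => F x ord0 i.

Definition divergence (F : 'rV[R]_d -> 'rV[R]_d) (x : 'rV[R]_d) : R :=
  (\sum_(i < d) partial i (coordf F i) x)%R.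

Definition dotv (v w : 'rV[R]_d) : R := (\sum_(i < d) v ord0 i * w ord0 i)%R.

(* The Euclidean norm; the norm `|v| of the library is the sup norm. *)
Definition enorm (v : 'rV[R]_d) : R := Num.sqrt (dotv v v).

Definition test_function (L : R) (psi : 'rV[R]_d -> R) : Prop :=
  torus_periodic L psi /\ smooth psi.

Definition test_field (L : R) (phi : 'rV[R]_d -> 'rV[R]_d) : Prop :=
  torus_periodic L phi /\ forall i, smooth (coordf phi i).

Definition cell_integrable (L : R) (f : 'rV[R]_d -> R) : Prop :=
  lebesgue_rV.-integrable (cell L) (EFin \o f).

Definition Lp_norm (L p : R) (f : 'rV[R]_d -> R) : \bar R :=
  'N[lebesgue_rV]_(p%:E)[(EFin \o f) \_ (cell L)].

(* The vector-valued distribution grad u, paired with a test field phi. *)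
Definition distr_grad (L : R) (u : 'rV[R]_d -> R)
    (phi : 'rV[R]_d -> 'rV[R]_d) : R :=
  (- \int[lebesgue_rV]_(x in cell L) (u x * divergence phi x))%R.

(* Total variation on the torus of the distributional gradient of u; it is
   the integral over the cell of |grad u| when u is weakly differentiable,
   and +oo when u is not of bounded variation. *)
Definition grad_variation (L : R) (u : 'rV[R]_d -> R) : \bar R :=
  ereal_sup [set (distr_grad L u phi)%:E | phi in
    [set phi | test_field L phi /\ forall x, (enorm (phi x) <= 1)%R]].

Definition distr_div_eq (L : R) (j : 'rV[R]_d -> 'rV[R]_d)
    (u : 'rV[R]_d -> R) : Prop :=
  forall psi, test_function L psi ->
    (\int[lebesgue_rV]_(x in cell L) dotv (j x) (grad psi x) =
     - \int[lebesgue_rV]_(x in cell L) (u x * psi x))%R.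

(* The integrability condition gives a meaning to div j; it is no restriction
   for the infimum, since square-integrable fields on the cell satisfy it. *)
Definition flux (L : R) (u : 'rV[R]_d -> R) : set ('rV[R]_d -> 'rV[R]_d) :=
  [set j | [/\ torus_periodic L j, forall i, cell_integrable L (coordf j i)
             & distr_div_eq L j u]].

(* The homogeneous H^-1 norm, with value +oo when no admissible j exists. *)
Definition Hm1_norm (L : R) (u : 'rV[R]_d -> R) : \bar R :=
  ereal_inf [set \int[lebesgue_rV]_(x in cell L) (enorm (j x) ^+ 2)%:E
            | j in flux L u] `^ 2^-1.

End torus.

(* Main.v *)
Require Import Defs.
From HB Require Import structures.
From mathcomp Require Import all_boot all_order all_algebra.
From mathcomp Require Import all_classical all_reals all_analysis.
From mathcomp Require Import measurable_realfun.
From mathcomp Require Import ring lra.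

Set Implicit Arguments.
Unset Strict Implicit.
Unset Printing Implicit Defensive.

Import Order.TTheory GRing.Theory Num.Theory.
Import numFieldNormedType.Exports.

Local Open Scope classical_set_scope.
Local Open Scope ring_scope.

(* Let u_n be the slice of u between the heights r_n^3 and r_(n+1)^3, where
   r_n = eta 2^n.  On {r_n^3 <= |u| < r_(n+1)^3} one has
   |u|^(4/3) <= C r_n |u| <= C r_(n-1)^(-2) u u_(n-1), so it is enough to bound
   \sum_n r_n^(-2) \int u u_n.  Replace u_n by its mollification g_n at scale
   lam / r_n and test div j = u against phi = \sum_n r_n^(-2) g_n.

   The pairing \int u phi = - \int j . grad phi is at most
   \int |j|^2 / (2 lam^2) + lam^2 / 2 \int |grad phi|^2, and since
   |r_n^(-2) grad g_n| <= C r_n^2 / lam grows geometrically, |grad phi|^2 is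
   dominated by C / lam \sum_n |grad g_n|, whose integral is controlled by the
   total variation of u because the slices share it: \sum_n TV(u_n) <= TV(u).

   In the error \int u (u_n - g_n), the part of u below r_(n+3)^3 costs
   C r_n^3 (lam / r_n) TV(u_n), while the part above is absorbed by half of the
   term with index n + 2; the two top indices are treated by moving the
   mollification onto u.  Hence
     \int |u|^(4/3) <= \int |j|^2 / lam^2 + C lam TV(u)  for all lam > 0,
   and the theorem follows by optimising lam.

   Total variation is only ever tested on trigonometric polynomials, and the
   mollifiers are tensor products of powers of (1 + cos) / 2: all convolutions
   are then finite sums of products f(x) g(y), which can be differentiated and
   exchanged without Fubini's theorem. *)

(** * Trigonometric polynomials *)

Section trig_poly.
Context {R : realType} {d : nat}.
Implicit Types (f g : 'rV[R]_d -> R) (i j : 'I_d) (x y : 'rV[R]_d).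

(** The exponents are forced. Let slices at height h carry a weight w and be mollified at scale l.
    Recovering |u|^(4/3) from w h |u| requires w = h^(-2/3), and the mollification error, of size w
    h l TV, is uniform in h only for l proportional to h^(-1/3). Writing h = r^3 gives w = r^(-2)
    and l = lam / r.

    The obstacle is that u is a priori only integrable and of bounded variation. Its pairings with
    the slices are finite because slices are bounded, and absorbing half of their sum is legitimate
    because finitely many are used at a time; the resulting bound depends neither on their number
    nor on the lowest height, so monotone convergence recovers the whole integral. Absorption by the
    term of index n + 2 has no partner for the last two indices, hence their separate treatment.

    That slices share the variation is proved without the coarea formula, from difference quotients
    and the pointwise inequality \sum_n |u_n(x) - u_n(y)| <= |u(x) - u(y)|. Testing on trigonometric
    polynomials loses nothing because they still determine the L^1 norm of an integrable periodic
    function by duality. *)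

Definition freq (L : R) : R := 2 * pi / L.

(** Only closure properties of this algebra are ever used: it is stable under products, translations
    and partial derivatives, and for [0 < L] its members are smooth, periodic and bounded, hence
    admissible tests. *)
Inductive trig_poly (L : R) : ('rV[R]_d -> R) -> Prop :=
| trig_cst c : trig_poly L (fun=> c)
| trig_cos i : trig_poly L (fun x => cos (freq L * x ord0 i))
| trig_sin i : trig_poly L (fun x => sin (freq L * x ord0 i))
| trig_add f g : trig_poly L f -> trig_poly L g ->
    trig_poly L (fun x => f x + g x)
| trig_mul f g : trig_poly L f -> trig_poly L g ->
    trig_poly L (fun x => f x * g x).

Lemma is_derive_cosM (c t : R) :
  is_derive t (1 : R) (fun t : R => cos (c * t)) (- c * sin (c * t)).
Proof.
have h : is_derive t (1 : R) (cos \o *%R c) (- sin (c * t) * (c *: 1)).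
  exact: is_derive1_comp.
apply: (is_derive_eq h).
by rewrite /GRing.scale/= mulr1 mulNr mulrC mulNr.
Qed.

Lemma is_derive_sinM (c t : R) :
  is_derive t (1 : R) (fun t : R => sin (c * t)) (c * cos (c * t)).
Proof.
have h : is_derive t (1 : R) (sin \o *%R c) (cos (c * t) * (c *: 1)).
  exact: is_derive1_comp.
by apply: (is_derive_eq h); rewrite /GRing.scale/= mulr1 mulrC.
Qed.

Lemma partial_coord (h : R -> R) j i x :
  partial i (fun x => h (x ord0 j)) x =
  if i == j then 'D_1 h (x ord0 j) else 0.
Proof.
rewrite /partial /derive; case: eqVneq => [<-|ij].
  by under eq_fun => t do rewrite /= !mxE !eqxx.
rewrite (_ : (fun _ => _) = cst 0) ?lim_cst//.
apply/funext => t /=.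
by rewrite !mxE eqxx/= eq_sym (negbTE ij) mulr0 add0r subrr scaler0.
Qed.

Lemma differentiable_coord_comp (h : R -> R) j x :
  derivable h (x ord0 j) 1 -> differentiable (fun x => h (x ord0 j)) x.
Proof.
move=> dh; apply: (differentiable_comp (f := fun x => x ord0 j) (g := h)).
  exact: differentiable_coord.
by apply/derivable1_diffP; exact: dh.
Qed.

Lemma trig_differentiable L f x : trig_poly L f -> differentiable f x.
Proof.
elim=> [c|i|i|{}f g _ df _ dg|{}f g _ df _ dg].
- exact: differentiable_cst.
- have [dc _] := is_derive_cosM (freq L) (x ord0 i).
  exact: (differentiable_coord_comp dc).
- have [dc _] := is_derive_sinM (freq L) (x ord0 i).
  exact: (differentiable_coord_comp dc).
- exact: differentiableD.
- exact: differentiableM.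
Qed.

Lemma partialD i f g x : differentiable f x -> differentiable g x ->
  partial i (fun x => f x + g x) x = partial i f x + partial i g x.
Proof. by move=> df dg; apply: deriveD; exact: diff_derivable. Qed.

Lemma partialM i f g x : differentiable f x -> differentiable g x ->
  partial i (fun x => f x * g x) x = f x * partial i g x + g x * partial i f x.
Proof. by move=> df dg; apply: deriveM; exact: diff_derivable. Qed.

Lemma partial_cst i c x : partial i (fun=> c) x = 0.
Proof. exact: derive_cst. Qed.

Lemma trig_opp L f : trig_poly L f -> trig_poly L (fun x => - f x).
Proof.
move=> tf; rewrite (_ : (fun _ => _) = fun x => (-1) * f x).
  by apply: trig_mul => //; exact: trig_cst.
by apply/funext => x; rewrite mulN1r.
Qed.

Lemma trig_sub L f g : trig_poly L f -> trig_poly L g ->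
  trig_poly L (fun x => f x - g x).
Proof. by move=> tf tg; apply: trig_add => //; exact: trig_opp. Qed.

Lemma trig_exp L f n : trig_poly L f -> trig_poly L (fun x => f x ^+ n).
Proof.
move=> tf; elim: n => [|n ih]; first exact: trig_cst.
by under eq_fun do rewrite exprS; exact: trig_mul.
Qed.

Lemma trig_sum L (I : Type) (s : seq I) (F : I -> 'rV[R]_d -> R) :
  (forall k, trig_poly L (F k)) -> trig_poly L (fun x => \sum_(k <- s) F k x).
Proof.
move=> tF; elim: s => [|k s ih].
  by under eq_fun do rewrite big_nil; exact: trig_cst.
by under eq_fun do rewrite big_cons; exact: trig_add.
Qed.

Lemma partial_sum (I : Type) (s : seq I) (F : I -> 'rV[R]_d -> R) i x :
  (forall k, differentiable (F k) x) ->
  partial i (fun x => \sum_(k <- s) F k x) x = \sum_(k <- s) partial i (F k) x.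
Proof.
move=> dF.
suff [] : differentiable (fun x => \sum_(k <- s) F k x) x /\
  partial i (fun x => \sum_(k <- s) F k x) x = \sum_(k <- s) partial i (F k) x by [].
elim: s => [|k s [ih1 ih2]].
  under eq_fun do rewrite big_nil.
  by rewrite big_nil partial_cst.
under eq_fun do rewrite big_cons.
rewrite big_cons partialD// ih2; split=> //.
exact: differentiableD.
Qed.

Lemma trig_partial L i f : trig_poly L f -> trig_poly L (partial i f).
Proof.
elim=> [c|j|j|{}f g tf df tg dg|{}f g tf df tg dg].
- rewrite (_ : partial i _ = fun=> 0); first exact: trig_cst.
  by apply/funext => x; exact: partial_cst.
- rewrite (_ : partial i _ = fun x => (if i == j then - freq L else 0) *
     sin (freq L * x ord0 j)); last first.
    apply/funext => x; rewrite (partial_coord (fun t => cos (freq L * t))).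
    have [_ ->] := is_derive_cosM (freq L) (x ord0 j).
    by case: ifP => // _; rewrite mul0r.
  by apply: trig_mul; [exact: trig_cst|exact: trig_sin].
- rewrite (_ : partial i _ = fun x => (if i == j then freq L else 0) *
     cos (freq L * x ord0 j)); last first.
    apply/funext => x; rewrite (partial_coord (fun t => sin (freq L * t))).
    have [_ ->] := is_derive_sinM (freq L) (x ord0 j).
    by case: ifP => // _; rewrite mul0r.
  by apply: trig_mul; [exact: trig_cst|exact: trig_cos].
- rewrite (_ : partial i _ = fun x => partial i f x + partial i g x).
    exact: trig_add.
  by apply/funext => x; apply: partialD; exact: (@trig_differentiable L).
- rewrite (_ : partial i _ = fun x => f x * partial i g x + g x * partial i f x).
    by apply: trig_add; exact: trig_mul.
  by apply/funext => x; apply: partialM; exact: (@trig_differentiable L).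
Qed.

Lemma trig_smooth L f : trig_poly L f -> smooth f.
Proof.
move=> tf s x; apply: (@trig_differentiable L).
by elim: s => //= i s ih; exact: trig_partial.
Qed.

Lemma trig_bounded L f : trig_poly L f -> exists2 B, 0 <= B & forall x, `|f x| <= B.
Proof.
elim=> [c|i|i|{}f g _ [B B0 fB] _ [C C0 gC]|{}f g _ [B B0 fB] _ [C C0 gC]].
- by exists `|c|.
- by exists 1 => // x; exact: cos_max.
- by exists 1 => // x; exact: sin_max.
- exists (B + C); first exact: addr_ge0.
  by move=> x; rewrite (le_trans (ler_normD _ _))// lerD.
- exists (B * C); first exact: mulr_ge0.
  by move=> x; rewrite normrM ler_pM.
Qed.

Lemma trig_measurable L f : trig_poly L f -> measurable_fun [set: 'rV[R]_d] f.
Proof.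
have mc i : measurable_fun [set: 'rV[R]_d] (fun x => freq L * x ord0 i).
  by apply: measurable_funM => //; exact: measurable_coord.
elim=> [c|i|i|{}f g _ mf _ mg|{}f g _ mf _ mg].
- exact: measurable_cst.
- apply: (measurableT_comp _ (mc i)).
  exact: (continuous_measurable_fun (@continuous_cos R)).
- apply: (measurableT_comp _ (mc i)).
  exact: (continuous_measurable_fun (@continuous_sin R)).
- exact: measurable_funD.
- exact: measurable_funM.
Qed.

Lemma freqK L : 0 < L -> freq L * L = pi *+ 2.
Proof. by move=> L0; rewrite /freq divfK ?gt_eqF// mulr_natl. Qed.

Lemma trig_periodic L f : 0 < L -> trig_poly L f -> torus_periodic L f.
Proof.
move=> L0; have fL := freqK L0.
elim=> [c|j|j|{}f g _ pf _ pg|{}f g _ pf _ pg] i x //.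
- rewrite !mxE mulrDr; case: (ord0 == _) => /=.
  by case: (j == i); rewrite ?mulr0 ?addr0// mulr1 fL cosD2pi.
  by rewrite !mulr0 addr0.
- rewrite !mxE mulrDr; case: (ord0 == _) => /=.
  by case: (j == i); rewrite ?mulr0 ?addr0// mulr1 fL sinD2pi.
  by rewrite !mulr0 addr0.
- by rewrite pf pg.
- by rewrite pf pg.
Qed.

End trig_poly.

(** * Integration over the cell *)

Section cell_measure.
Context {R : realType}.
Local Open Scope ereal_scope.
Local Notation mu := (@lebesgue_measure R).

Lemma measurable_cell n (L : R) : measurable (@cell R n L).
Proof.
rewrite (_ : cell L = \bigcap_(i in [set: 'I_n])
    ((fun x : 'rV[R]_n => x ord0 i) @^-1` `[0%R, L])); last first.
  by apply/seteqP; split => [x h i _|x h i]; [exact: h|exact: (h i Logic.I)].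
apply: fin_bigcap_measurable => [|i _]; first exact: finite_finset.
by rewrite -[X in measurable X]setTI; exact: measurable_coord.
Qed.
Local Hint Extern 0 (measurable (cell _)) => solve [exact: measurable_cell] : core.

Lemma cell_cons n (L : R) t (v : 'rV[R]_n) :
  cell L (cons_rV (t, v)) <-> t \in `[0%R, L] /\ cell L v.
Proof.
split=> [h|[ht hv] i].
  split; first by have := h ord0; rewrite mxE unlift_none.
  by move=> i; have := h (lift ord0 i); rewrite mxE liftK.
by rewrite mxE; case: unliftP => [j|] _ //; exact: hv.
Qed.

(** [lebesgue_rV] adjoins one coordinate at a time, so Tonelli's theorem peels off the first one;
    the restriction to the cell splits by [cell_cons]. *)
Lemma integral_cellS n (L : R) (f : 'rV[R]_n.+1 -> \bar R) :
  measurable_fun setT f -> (forall x, 0 <= f x) ->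
  \int[lebesgue_rV]_(x in cell L) f x =
  \int[mu]_(t in `[0%R, L]) \int[lebesgue_rV]_(v in cell L) f (cons_rV (t, v)).
Proof.
move=> mf f0; pose g := f \_ (cell L).
have mg : measurable_fun setT g.
  apply/(measurable_restrictT f) => //.
  exact: measurable_funTS.
have g0 x : 0 <= g x by exact: erestrict_ge0.
rewrite [LHS]integral_mkcond -/g.
transitivity (\int[pushforward (mu \x @lebesgue_rV R n) cons_rV]_x g x).
  by apply: eq_measure_integral; first exact: measurable_cons_rV.
rewrite (ge0_integral_pushforward (@measurable_cons_rV R n))//=.
have mgc : measurable_fun setT (g \o cons_rV).
  exact: (measurableT_comp mg (@measurable_cons_rV R n)).
rewrite preimage_setT (@fubini_tonelli1 _ _ _ _ _ mu (@lebesgue_rV R n) _ mgc (fun z => g0 (cons_rV z))).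
rewrite [RHS]integral_mkcond; apply: eq_integral => t _.
rewrite /fubini_F patchE/=; case: ifPn => tL.
  rewrite [RHS]integral_mkcond; apply: eq_integral => v _ /=.
  rewrite /g !patchE; case: ifPn => vL; first by
    rewrite ifT// inE; rewrite inE in vL; have [] := cell_cons L t v => /(_ vL)[].
  rewrite ifF//; apply/negbTE; apply: contra vL; rewrite !inE => vL.
  by apply/cell_cons; split=> //; move: tL; rewrite inE.
rewrite integral0_eq// => v _; rewrite /g patchE ifF//; apply/negbTE.
by apply: contra tL; rewrite !inE => /cell_cons[].
Qed.

Lemma measurable_integral_cell n (L : R) (f : 'rV[R]_n.+1 -> \bar R) :
  measurable_fun setT f -> (forall x, 0 <= f x) ->
  measurable_fun setT (fun t : measurableTypeR R =>
    \int[lebesgue_rV]_(v in cell L) f (cons_rV (t, v))).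
Proof.
move=> mf f0.
pose g (z : measurableTypeR R * 'rV[R]_n) :=
  ((f \o cons_rV) \_ (snd @^-1` cell L)) z.
have mg : measurable_fun setT g.
  apply/(measurable_restrictT (f \o cons_rV)) => //.
    by rewrite -[X in measurable X]setTI; exact: measurable_snd.
  apply: measurable_funTS; apply: measurableT_comp => //.
  exact: measurable_cons_rV.
have g0 x : 0 <= g x by apply: erestrict_ge0 => ? _; exact: f0.
have := @measurable_fun_fubini_tonelli_F _ _ _ _ _ (@lebesgue_rV R n) g mg g0.
rewrite (_ : fubini_F _ g = fun t =>
  \int[lebesgue_rV]_(v in cell L) f (cons_rV (t, v)))//.
apply/funext => t; rewrite /fubini_F [RHS]integral_mkcond.
by apply: eq_integral => v _; rewrite /g !patchE.
Qed.

Lemma integral_cell_prod n (L : R) (h : 'I_n -> R -> R) (c : 'I_n -> R) :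
  (forall i, measurable_fun [set: measurableTypeR R] (h i)) -> (forall i t, (0 <= h i t)%R) ->
  (forall i, \int[mu]_(t in `[0%R, L]) (h i t)%:E = (c i)%:E) ->
  \int[lebesgue_rV]_(x in cell L) (\prod_i h i (x ord0 i))%:E =
  (\prod_i c i)%:E.
Proof.
elim: n h c => [|n ih] h c mh h0 hc.
  rewrite (_ : cell L = setT); last first.
    by apply/seteqP; split => // x _ [].
  under eq_integral do rewrite big_ord0.
  rewrite integral_cst//= diracT.
  by rewrite big_ord0 mule1.
rewrite integral_cellS; first last.
- by move=> x; rewrite lee_fin prodr_ge0.
- apply/measurable_EFinP; apply: measurable_prod => i _.
  exact: (measurableT_comp (mh i) (measurable_coord i)).
under eq_integral => t _.
  under eq_integral => v _.
    rewrite big_ord_recl mxE unlift_none/=.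
    under eq_bigr do rewrite mxE liftK/=.
    rewrite EFinM.
    over.
  rewrite ge0_integralZl//=; first last.
  - by rewrite lee_fin.
  - by move=> v _; rewrite lee_fin prodr_ge0.
  - apply: measurable_funTS; apply/measurable_EFinP.
    apply: measurable_prod => i _.
    exact: (measurableT_comp (mh _) (measurable_coord i)).
  rewrite (ih (fun i => h (lift ord0 i)) (fun i => c (lift ord0 i)))//.
  over.
rewrite ge0_integralZr//=; first last.
- rewrite lee_fin prodr_ge0// => i _; rewrite -lee_fin -hc.
  by apply: integral_ge0 => t _; rewrite lee_fin.
- by move=> t _; rewrite lee_fin.
- by apply: measurable_funTS; apply/measurable_EFinP.
by rewrite hc big_ord_recl EFinM.
Qed.

Lemma lebesgue_rV_cell n (L : R) : (0 <= L)%R ->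
  lebesgue_rV (@cell R n L) = (L ^+ n)%:E.
Proof.
move=> L0; rewrite -[LHS]mul1e -integral_cst//=.
transitivity (\int[@lebesgue_rV R n]_(x in cell L)
    (\prod_(i < n) (fun=> 1%R) (x ord0 i))%:E).
  by apply: eq_integral => x _; rewrite big1.
rewrite (@integral_cell_prod n L (fun _ => cst 1%R) (fun=> L))//.
  by rewrite prodr_const card_ord.
move=> _; transitivity (1 * mu `[0%R, L]); first exact: (integral_cst mu (measurable_itv `[0%R, L]) 1).
rewrite mul1e lebesgue_measure_itv/= lte_fin.
by case: ltgtP L0 => // [_ _|<- _]; rewrite ?sube0// sube0.
Qed.

End cell_measure.
#[global] Hint Extern 0 (measurable (cell _)) => solve [exact: measurable_cell] : core.

(** * Translation invariance of integrals of periodic functions *)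

Section translation.
Context {R : realType}.
Local Open Scope ereal_scope.
Local Notation mu := (@lebesgue_measure R).

Lemma measurable_shift (a : R) :
  measurable_fun [set: measurableTypeR R] (fun t : measurableTypeR R => (t + a)%R : measurableTypeR R).
Proof. exact: measurable_funD. Qed.

Lemma preimage_shift (a x y : R) b1 b2 :
  (fun t : R => (t + a)%R) @^-1` [set` Interval (BSide b1 x) (BSide b2 y)] =
  [set` Interval (BSide b1 (x - a)%R) (BSide b2 (y - a)%R)].
Proof.
apply/seteqP; split => t /=; rewrite !in_itv/=;
  by case: b1; case: b2; rewrite /= ?lerBlDr ?ltrBlDr ?lerBrDr ?ltrBrDr.
Qed.

Lemma lebesgue_measure_shift (a : R) (A : set R) : measurable A ->
  pushforward mu (fun t => (t + a)%R : measurableTypeR R) A = mu A.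
Proof.
move=> mA; apply/esym/lebesgue_measure_unique => //=.
  exact: measurable_shift.
move=> ? _ [[x y]] _ <-.
rewrite /pushforward preimage_shift/= !lebesgue_measure_itv/=.
by rewrite !lte_fin ltrD2r; case: ifP => //= _; rewrite -!EFinB opprB addrA subrK.
Qed.

Lemma ge0_integral_shift (a : R) (D : set R) (f : R -> \bar R) :
  measurable D -> measurable_fun D f -> (forall t, 0 <= f t) ->
  \int[mu]_(t in (fun t => (t + a)%R) @^-1` D) f (t + a)%R =
  \int[mu]_(t in D) f t.
Proof.
move=> mD mf f0.
rewrite -(ge0_integral_pushforward (measurable_shift a) mu)//=.
apply: eq_measure_integral => [|? A mA _]; first exact: measurable_shift.
exact: lebesgue_measure_shift.
Qed.

Lemma periodicz (V : Type) (f : R -> V) (L : R) : (forall t, f (t + L)%R = f t) ->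
  forall (k : int) t, f (t + L *~ k)%R = f t.
Proof.
move=> fL; have fn n t : f (t + L *+ n)%R = f t.
  by elim: n t => [|n ih] t; rewrite ?mulr0n ?addr0// mulrSr addrA fL.
case=> n t; first exact: fn.
by rewrite NegzE mulrNz -(fn n.+1) -addrA addNr addr0.
Qed.

Definition wrap (L t : R) : R := (t - L * (Num.floor (t / L))%:~R)%R.

Lemma wrap_itv L t : (0 < L)%R -> wrap L t \in `[0%R, L[.
Proof.
move=> L0; rewrite in_itv/= /wrap subr_ge0 ltrBlDl.
have -> : (L * (Num.floor (t / L))%:~R + L = L * (Num.floor (t / L) + 1)%:~R)%R.
  by rewrite intrD mulrDr mulr1.
by rewrite mulrC [X in (_ < X)%R]mulrC -ler_pdivlMr// -ltr_pdivrMr// floor_le_tmp floorD1_gt.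
Qed.

Lemma wrapE (V : Type) (f : R -> V) (L : R) : (forall t, f (t + L)%R = f t) ->
  forall t, f (wrap L t) = f t.
Proof.
move=> fL t; rewrite /wrap -mulrN -intrN mulrzr; exact: periodicz.
Qed.

Lemma ge0_integral_periodic (L a : R) (G : R -> \bar R) : (0 < L)%R ->
  measurable_fun [set: measurableTypeR R] G -> (forall t, 0 <= G t) ->
  (forall t, G (t + L)%R = G t) ->
  \int[mu]_(t in `[0%R, L]) G (t + a)%R = \int[mu]_(t in `[0%R, L]) G t.
Proof.
move=> L0 mG G0 GL.
(* By periodicity the shift may be reduced to [b] in [0, L[. Cutting the cell at [L - b], the first
   part is carried onto [b, L[ and the second onto [L, L + b[, which one period brings back to [0,
   b[. *)
pose b := wrap L a.
have /andP[b0 bL] : (0 <= b < L)%R by have := wrap_itv a L0; rewrite in_itv.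
have Gab t : G (t + a)%R = G (t + b)%R.
  by rewrite -(@wrapE _ (fun s => G (t + s)%R) L) // => s; rewrite addrA.
under eq_integral do rewrite Gab.
have mGb : measurable_fun [set: measurableTypeR R] (fun t => G (t + b)%R).
  exact: (measurableT_comp mG (measurable_shift b)).
rewrite -integral_itv_bndo_bndc; last exact: measurable_funTS.
rewrite -[RHS]integral_itv_bndo_bndc; last exact: measurable_funTS.
have hLb : (0 <= L - b <= L)%R by rewrite subr_ge0 ltW//= lerBlDr lerDl.
have itvU (x : R) : (0 <= x <= L)%R -> `[0%R, L[%classic = `[0%R, x[ `|` `[x, L[ :> set R.
  by move=> /andP[x0 xL]; rewrite -itv_bndbnd_setU.
have dis (x : R) : [disjoint `[0%R, x[%classic & `[x, L[%classic].
  apply/disj_set2P; rewrite -subset0 => t [/=]; rewrite !in_itv/= => /andP[_ +] /andP[+ _].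
  by move=> /lt_le_trans /[apply]; rewrite ltxx.
rewrite (itvU (L - b)%R)//.
rewrite ge0_integral_setU//=; last exact: measurable_funTS.
rewrite [RHS](_ : _ = \int[mu]_(x in `[b, L[) G x + \int[mu]_(x in `[0%R, b[) G x); last first.
  rewrite addeC -ge0_integral_setU//=; last exact: measurable_funTS.
  by rewrite -(itvU _ hLb) -(itvU b)// b0 ltW.
congr (_ + _).
  rewrite -[RHS](ge0_integral_shift b)//; last exact: measurable_funTS.
  by rewrite preimage_shift subrr.
transitivity (\int[mu]_(x in `[L, (L + b)%R[) G x).
  rewrite -[RHS](ge0_integral_shift b)//; last exact: measurable_funTS.
  by rewrite preimage_shift addrK.
rewrite -[LHS](ge0_integral_shift L)//; last exact: measurable_funTS.
rewrite preimage_shift subrr addrC addKr.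
by apply: eq_integral => t _; rewrite GL.
Qed.

Lemma measurable_shift_rV n (a : 'rV[R]_n) :
  measurable_fun setT (fun x : 'rV[R]_n => (x + a)%R).
Proof.
apply: measurable_fun_rV => i; under eq_fun do rewrite mxE.
by apply: measurable_funD => //; exact: measurable_coord.
Qed.

(** The codomain is an arbitrary type, so that extended-real integrands are covered as well. *)
Definition cell_periodic n (L : R) (V : Type) (f : 'rV[R]_n -> V) :=
  forall i x, f (x + L *: delta_mx ord0 i)%R = f x.

Lemma cons_rVD n t s (v w : 'rV[R]_n) :
  (cons_rV (t, v) + cons_rV (s, w))%R = cons_rV ((t + s)%R, (v + w)%R).
Proof. by apply/rowP => i; rewrite !mxE; case: unlift => [j|//]; rewrite mxE. Qed.

Lemma ge0_integral_cell_shift n (L : R) (a : 'rV[R]_n) (f : 'rV[R]_n -> \bar R) :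
  (0 < L)%R -> measurable_fun setT f -> (forall x, 0 <= f x) ->
  cell_periodic L f ->
  \int[lebesgue_rV]_(x in cell L) f (x + a)%R =
  \int[lebesgue_rV]_(x in cell L) f x.
Proof.
move=> L0; elim: n a f => [|n ih] a f mf f0 pf.
  by apply: eq_integral => x _; congr f; apply/rowP => -[].
have mfa : measurable_fun setT (fun x : 'rV[R]_n.+1 => f (x + a)%R).
  exact: (measurableT_comp mf (measurable_shift_rV a)).
rewrite (integral_cellS L mfa (fun x => f0 (x + a)%R)) (integral_cellS L mf f0).
have [a0 [a' ->]] : exists a0 a', a = cons_rV (a0, a').
  by exists (uncons_rV a).1, (uncons_rV a).2; rewrite -surjective_pairing uncons_rVK.
under eq_integral => t _.
  under eq_integral do rewrite cons_rVD.
  rewrite (ih a' (fun v => f (cons_rV (t + a0, v)%R))).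
  - over.
  - apply: (measurableT_comp mf); apply: (measurableT_comp (@measurable_cons_rV R n)).
    exact: measurable_pair1.
  - by move=> v; exact: f0.
  - move=> i v; rewrite -[RHS](pf (lift ord0 i)); congr f; apply/rowP => j.
    rewrite !mxE; case: unliftP => [k ->|->]; rewrite ?mxE /=.
      by rewrite (inj_eq lift_inj).
    by rewrite mulr0 addr0.
apply: (@ge0_integral_periodic L a0 (fun t => \int[lebesgue_rV]_(v in cell L) f (cons_rV (t, v)))) => //.
- exact: measurable_integral_cell.
- by move=> t; apply: integral_ge0 => v _; exact: f0.
- move=> t; apply: eq_integral => v _; rewrite -[RHS](pf ord0); congr f.
  apply/rowP => j; rewrite !mxE; case: unliftP => [k ->|->]; rewrite ?mxE /=.
    by rewrite mulr0 addr0.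
  by rewrite mulr1.
Qed.

End translation.

(** * Reduction modulo the period lattice *)

Section wrap_rV.
Context {R : realType} {d : nat}.
Implicit Types (x : 'rV[R]_d) (L : R).

Definition wrap_rV L x : 'rV[R]_d := \row_i wrap L (x ord0 i).

Lemma measurable_wrap L : 0 < L ->
  measurable_fun [set: measurableTypeR R] (wrap L : measurableTypeR R -> measurableTypeR R).
Proof.
move=> L0; apply: measurable_funB => //; apply: measurable_funM => //.
apply: nondecreasing_measurable => // s t st.
by rewrite ler_int le_floor// ler_pM2r// invr_gt0.
Qed.

Lemma measurable_wrap_rV L : 0 < L -> measurable_fun setT (wrap_rV L).
Proof.
move=> L0; apply: measurable_fun_rV => i; under eq_fun do rewrite mxE.
exact: (measurableT_comp (measurable_wrap L0) (measurable_coord i)).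
Qed.

Lemma wrap_rV_cell L x : 0 < L -> cell L (wrap_rV L x).
Proof.
move=> L0 i; rewrite mxE; have := wrap_itv (x ord0 i) L0.
by rewrite !in_itv/= => /andP[-> /ltW].
Qed.

Lemma cell_periodicz (V : Type) L (f : 'rV[R]_d -> V) (k : 'I_d -> int) x :
  cell_periodic L f -> f (x + \row_i (L *~ k i)) = f x.
Proof.
move=> pf.
have pk (s : seq 'I_d) y : f (y + \sum_(i <- s) (L *~ k i) *: delta_mx ord0 i) = f y.
  elim: s y => [|i s ih] y; first by rewrite big_nil addr0.
  rewrite big_cons addrA ih.
  have := @periodicz _ _ (fun t => f (y + t *: delta_mx ord0 i)) L.
  move=> /(_ _ (k i) 0); rewrite add0r scale0r addr0; apply => t.
  by rewrite scalerDl addrA pf.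
rewrite -(pk (index_enum 'I_d) x) (row_sum_delta (\row_i (L *~ k i))).
by under eq_bigr do rewrite mxE.
Qed.

Lemma wrap_rVE (V : Type) L (f : 'rV[R]_d -> V) x : cell_periodic L f ->
  f (wrap_rV L x) = f x.
Proof.
move=> pf; rewrite -(cell_periodicz (fun i => Num.floor (x ord0 i / L)) (wrap_rV L x) pf).
by congr f; apply/rowP => i; rewrite !mxE /wrap mulrzr subrK.
Qed.

(** Integrability gives measurability on the cell only; composing with the measurable reduction
    [wrap_rV L], which leaves [f] unchanged, carries it to the whole space. *)
Lemma periodic_measurable L (f : 'rV[R]_d -> R) : 0 < L ->
  torus_periodic L f -> cell_integrable L f -> measurable_fun setT f.
Proof.
move=> L0 pf /measurable_int/measurable_EFinP mf.
rewrite (_ : f = f \o wrap_rV L); last by apply/funext => x /=; rewrite wrap_rVE.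
apply: (measurable_comp (measurable_cell L) _ mf (measurable_wrap_rV L0)).
by move=> _ [x _ <-]; exact: wrap_rV_cell.
Qed.

End wrap_rV.

(** * Calculus of integrable functions on the cell *)

Section cell_integral.
Context {R : realType} {d : nat}.
Variable L : R.
Hypothesis L_gt0 : 0 < L.
Implicit Types (f g u v : 'rV[R]_d -> R) (a x y : 'rV[R]_d).
Local Notation integ := (@cell_integrable R d L).
Local Notation "'\I_' x f" := (\int[@lebesgue_rV R d]_(x in cell L) f)
  (at level 36, x name, f at level 36).

Definition cell_bounded_measurable f :=
  measurable_fun (cell L) f /\ exists B, forall x, `|f x| <= B.

Lemma mu_cell_lty : (lebesgue_rV (@cell R d L) < +oo)%E.
Proof. by rewrite lebesgue_rV_cell ?ltry// ltW. Qed.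

Lemma eq_integ f g : (forall x, cell L x -> f x = g x) -> integ f -> integ g.
Proof.
by move=> fg; apply: eq_integrable => // x; rewrite inE => /fg /= ->.
Qed.

Lemma integ_cst c : integ (fun=> c).
Proof.
apply: (@measurable_bounded_integrable _ _ _ _ _ (cell L)) => //.
- exact: mu_cell_lty.
- by exists `|c|; split => // y cy x _; exact: ltW.
Qed.

Lemma integD f g : integ f -> integ g -> integ (fun x => f x + g x).
Proof.
move=> mf mg; apply: (eq_integrable _ (fun x => (f x)%:E + (g x)%:E)%E) => //.
exact: integrableD.
Qed.

Lemma integZ c f : integ f -> integ (fun x => c * f x).
Proof.
move=> mf; apply: (eq_integrable _ (fun x => c%:E * (f x)%:E)%E) => //.
exact: integrableZl.
Qed.

Lemma integB f g : integ f -> integ g -> integ (fun x => f x - g x).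
Proof.
move=> mf mg; apply: (eq_integrable _ (fun x => (f x)%:E - (g x)%:E)%E) => //.
exact: integrableB.
Qed.

Lemma integ_abs f : integ f -> integ (fun x => `|f x|).
Proof. exact: integrable_norm. Qed.

Lemma integ_le f g : measurable_fun (cell L) f -> (forall x, `|f x| <= g x) ->
  integ g -> integ f.
Proof.
move=> mf fg; apply: le_integrable => //; first exact/measurable_EFinP.
by move=> x _ /=; rewrite lee_fin (le_trans (fg x))// ler_norm.
Qed.

Lemma integ_measurable f : integ f -> measurable_fun (cell L) f.
Proof. by move=> /measurable_int/measurable_EFinP. Qed.

Lemma integM f g : integ f -> cell_bounded_measurable g -> integ (fun x => f x * g x).
Proof.
move=> mf [mg [B gB]]; apply: (@integ_le _ (fun x => B * `|f x|)).
- by apply: measurable_funM => //; exact: integ_measurable.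
- by move=> x; rewrite normrM mulrC ler_wpM2r.
- exact/integZ/integ_abs.
Qed.

Lemma integ_bounded f : cell_bounded_measurable f -> integ f.
Proof.
move=> bf; apply: (eq_integ _ (integM (integ_cst 1) bf)) => x _; exact: mul1r.
Qed.

Lemma integ_sum (I : Type) (s : seq I) (F : I -> 'rV[R]_d -> R) :
  (forall k, integ (F k)) -> integ (fun x => \sum_(k <- s) F k x).
Proof.
move=> iF; elim: s => [|k s ih].
  by under eq_fun do rewrite big_nil; exact: integ_cst.
by under eq_fun do rewrite big_cons; exact: integD.
Qed.

Lemma trig_bmeas f : trig_poly L f -> cell_bounded_measurable f.
Proof.
move=> tf; split; first by apply: measurable_funTS; exact: (trig_measurable tf).
by have [B _ ?] := trig_bounded tf; exists B.
Qed.

Lemma integ_trig f : trig_poly L f -> integ f.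
Proof. by move=> /trig_bmeas; exact: integ_bounded. Qed.

Lemma intD f g : integ f -> integ g -> \I_x (f x + g x) = \I_x (f x) + \I_x (g x).
Proof. by move=> mf mg; rewrite RintegralD. Qed.

Lemma intB f g : integ f -> integ g -> \I_x (f x - g x) = \I_x (f x) - \I_x (g x).
Proof. by move=> mf mg; rewrite RintegralB. Qed.

Lemma intZ c f : integ f -> \I_x (c * f x) = c * \I_x (f x).
Proof. by move=> mf; rewrite RintegralZl. Qed.

Lemma intZr c f : integ f -> \I_x (f x * c) = \I_x (f x) * c.
Proof. by move=> mf; rewrite RintegralZr. Qed.

Lemma int_sum (I : Type) (s : seq I) (F : I -> 'rV[R]_d -> R) :
  (forall k, integ (F k)) -> \I_x (\sum_(k <- s) F k x) = \sum_(k <- s) \I_x (F k x).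
Proof.
move=> iF; elim: s => [|k s ih].
  under eq_Rintegral do rewrite big_nil.
  by rewrite big_nil Rintegral_cst// mul0r.
under eq_Rintegral do rewrite big_cons.
by rewrite big_cons intD ?ih//; exact: integ_sum.
Qed.

Lemma le_int f g : integ f -> integ g -> (forall x, cell L x -> f x <= g x) ->
  \I_x (f x) <= \I_x (g x).
Proof. by move=> mf mg; exact: le_Rintegral. Qed.

Lemma int_abs f : integ f -> `|\I_x (f x)| <= \I_x `|f x|.
Proof. by move=> mf; exact: le_normr_Rintegral. Qed.

Lemma int_ge0 f : (forall x, cell L x -> 0 <= f x) -> 0 <= \I_x (f x).
Proof. exact: Rintegral_ge0. Qed.

Lemma int_EFin f : integ f ->
  (\int[lebesgue_rV]_(x in cell L) (f x)%:E)%E = (\I_x (f x))%:E.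
Proof. by move=> mf; rewrite fineK//; exact: integrable_fin_num. Qed.

Lemma integ_ge0P f M : measurable_fun (cell L) f -> (forall x, 0 <= f x) ->
  (\int[lebesgue_rV]_(x in cell L) (f x)%:E <= M%:E)%E -> integ f.
Proof.
move=> mf f0 fM; apply/integrableP; split; first exact/measurable_EFinP.
under eq_integral => x _ do rewrite /= ger0_norm//.
exact: (le_lt_trans fM (ltry _)).
Qed.

Lemma integ_shift f a : torus_periodic L f -> integ f -> integ (fun x => f (x + a)).
Proof.
move=> pf mf; have mf' := periodic_measurable L_gt0 pf mf.
apply/integrableP; split.
  apply/measurable_EFinP; apply: measurable_funTS.
  exact: (measurableT_comp mf' (measurable_shift_rV a)).
rewrite (@ge0_integral_cell_shift _ d L a (fun x => `|(f x)%:E|%E))//.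
- by case/integrableP : mf.
- by apply: measurableT_comp => //; exact/measurable_EFinP.
- by move=> i x; rewrite pf.
Qed.

Lemma int_shift f a : torus_periodic L f -> integ f ->
  \I_x (f (x + a)) = \I_x (f x).
Proof.
move=> pf mf; have mf' := periodic_measurable L_gt0 pf mf.
rewrite /Rintegral integralE [in RHS]integralE; congr (fine (_ - _)%E).
- apply: etrans (@ge0_integral_cell_shift _ d L a (EFin \o f)^\+%E L_gt0 _ _ _) => //.
  + by apply: eq_integral => x _; rewrite !funeposE.
  + by apply: measurable_funepos; exact/measurable_EFinP.
  + by move=> i x; rewrite !funeposE/= pf.
- apply: etrans (@ge0_integral_cell_shift _ d L a (EFin \o f)^\-%E L_gt0 _ _ _) => //.
  + by apply: eq_integral => x _; rewrite !funenegE.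
  + by apply: measurable_funeneg; exact/measurable_EFinP.
  + by move=> i x; rewrite !funenegE/= pf.
Qed.

End cell_integral.

(** * Separable kernels *)

Section separable_theory.
Context {R : realType} {d : nat}.
Implicit Types (f g v u : 'rV[R]_d -> R) (x y a : 'rV[R]_d) (k : 'rV[R]_d -> 'rV[R]_d -> R).

Inductive separable (L : R) : ('rV[R]_d -> 'rV[R]_d -> R) -> Prop :=
| separable_prod f g : trig_poly L f -> trig_poly L g ->
    separable L (fun x y => f x * g y)
| separable_add k l : separable L k -> separable L l ->
    separable L (fun x y => k x y + l x y).

Lemma eq_separable L k l : (forall x y, k x y = l x y) -> separable L k -> separable L l.
Proof. by move=> kl; rewrite (_ : k = l)//; apply/funext => x; apply/funext => y. Qed.

Lemma separable_l L f : trig_poly L f -> separable L (fun x _ => f x).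
Proof.
move=> tf; apply: (eq_separable _ (separable_prod tf (trig_cst L 1))) => x y.
by rewrite mulr1.
Qed.

Lemma separable_mul L k l : separable L k -> separable L l ->
  separable L (fun x y => k x y * l x y).
Proof.
move=> sk sl; elim: sk => [f g tf tg|k1 k2 _ s1 _ s2]; last first.
  by under eq_fun do under eq_fun do rewrite mulrDl; exact: separable_add.
elim: sl => [f' g' tf' tg'|k1 k2 _ s1 _ s2]; last first.
  by under eq_fun do under eq_fun do rewrite mulrDr; exact: separable_add.
apply: (eq_separable _ (separable_prod (trig_mul tf tf') (trig_mul tg tg'))) => x y.
by rewrite mulrACA.
Qed.

Lemma separable_exp L k n : separable L k -> separable L (fun x y => k x y ^+ n).
Proof.
move=> sk; elim: n => [|n ih]; first exact/separable_l/trig_cst.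
by under eq_fun do under eq_fun do rewrite exprS; exact: separable_mul.
Qed.

Lemma separable_bigprod L (I : Type) (s : seq I) (K : I -> 'rV[R]_d -> 'rV[R]_d -> R) :
  (forall i, separable L (K i)) -> separable L (fun x y => \prod_(i <- s) K i x y).
Proof.
move=> sK; elim: s => [|i s ih].
  by under eq_fun do under eq_fun do rewrite big_nil; exact/separable_l/trig_cst.
by under eq_fun do under eq_fun do rewrite big_cons; exact: separable_mul.
Qed.

Lemma separable_trig_l L k y : separable L k -> trig_poly L (k^~ y).
Proof.
by elim=> [f g tf tg|k1 k2 _ t1 _ t2];
  [apply: trig_mul => //; exact: trig_cst|exact: trig_add].
Qed.

Lemma separable_trig_r L k x : separable L k -> trig_poly L (k x).
Proof.
by elim=> [f g tf tg|k1 k2 _ t1 _ t2];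
  [apply: trig_mul => //; exact: trig_cst|exact: trig_add].
Qed.

(** The addition formulas split the cosine and sine of a sum, and sums and products preserve
    separability. Thus translation of a test function is itself a separable kernel. *)
Lemma separable_addition L f : trig_poly L f -> separable L (fun x y => f (x + y)).
Proof.
elim=> [c|i|i|{}f g _ sf _ sg|{}f g _ sf _ sg].
- exact/separable_l/trig_cst.
- apply: (eq_separable _ (separable_add
    (separable_prod (trig_cos L i) (trig_cos L i))
    (separable_prod (trig_opp (trig_sin L i)) (trig_sin L i)))) => x y.
  by rewrite mxE mulrDr cosD mulNr.
- apply: (eq_separable _ (separable_add
    (separable_prod (trig_sin L i) (trig_cos L i))
    (separable_prod (trig_cos L i) (trig_sin L i)))) => x y.
  by rewrite mxE mulrDr sinD.
- exact: separable_add.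
- exact: separable_mul.
Qed.

Lemma trig_shift L f a : trig_poly L f -> trig_poly L (fun x => f (x + a)).
Proof. by move=> /separable_addition /(separable_trig_l a). Qed.

Lemma partial_shift i f a x : partial i (fun x => f (x + a)) x = partial i f (x + a).
Proof.
rewrite /partial /derive.
by under eq_fun do rewrite /= -addrA.
Qed.

Lemma is_derive_line f i (t : R) : differentiable f (t *: delta_mx ord0 i) ->
  is_derive t (1 : R) (fun s => f (s *: delta_mx ord0 i))
    (partial i f (t *: delta_mx ord0 i)).
Proof.
move=> df; have := diff_derivable (v := delta_mx ord0 i : 'rV[R]_d) df; rewrite /derivable.
set F := (X in cvg (X @ _) -> _) => dF.
have E : (fun h : R => h^-1 *: (((fun s => f (s *: delta_mx ord0 i)) \o shift t) (h *: 1)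
    - f (t *: delta_mx ord0 i))) = F.
  by apply/funext => h; rewrite /F /= scalerDl /GRing.scale/= mulr1.
apply: DeriveDef; first by rewrite /derivable E.
by rewrite /derive E.
Qed.

Section integration.
Variable L : R.
Hypothesis L_gt0 : 0 < L.
Local Notation integ := (@cell_integrable R d L).
Local Notation "'\I_' x f" := (\int[@lebesgue_rV R d]_(x in cell L) f)
  (at level 36, x name, f at level 36).

Lemma integ_trigM v f : integ v -> trig_poly L f -> integ (fun x => v x * f x).
Proof. by move=> iv tf; apply: integM => //; exact: trig_bmeas. Qed.

Lemma separable_integral v k : integ v -> separable L k ->
  trig_poly L (fun x => \I_y (v y * k x y)).
Proof.
move=> iv; elim=> [f g tf tg|k1 k2 s1 t1 s2 t2].
  rewrite (_ : (fun _ => _) = fun x => f x * \I_y (v y * g y)).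
    by apply: trig_mul => //; exact: trig_cst.
  apply/funext => x; rewrite -intZ//; last exact: integ_trigM.
  by under eq_Rintegral do rewrite mulrCA.
rewrite (_ : (fun _ => _) = fun x => \I_y (v y * k1 x y) + \I_y (v y * k2 x y)).
  exact: trig_add.
apply/funext => x; rewrite -intD//.
- by under eq_Rintegral do rewrite mulrDr.
- by apply: integ_trigM => //; exact: separable_trig_r.
- by apply: integ_trigM => //; exact: separable_trig_r.
Qed.

Lemma separable_partial k i : separable L k -> separable L (fun x y => partial i (k^~ y) x).
Proof.
elim=> [f g tf tg|k1 k2 s1 t1 s2 t2].
  apply: (eq_separable _ (separable_prod (trig_partial i tf) tg)) => x y.
  rewrite partialM; [|exact: (trig_differentiable x tf)|exact: differentiable_cst].
  by rewrite partial_cst mulr0 add0r mulrC.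
apply: (eq_separable _ (separable_add t1 t2)) => x y.
by rewrite partialD//; apply: (@trig_differentiable _ _ L); exact: separable_trig_l.
Qed.

Lemma separable_sym k : separable L k -> separable L (fun x y => k y x).
Proof.
elim=> [f g tf tg|? ? ? ? ? ?]; last exact: separable_add.
by apply: (eq_separable _ (separable_prod tg tf)) => ? ?; rewrite mulrC.
Qed.

Lemma separable_partial_r k i : separable L k -> separable L (fun x y => partial i (k x) y).
Proof. by move=> /separable_sym /(separable_partial i) /separable_sym. Qed.

Lemma partial_separable_integral v k i x : integ v -> separable L k ->
  partial i (fun x => \I_y (v y * k x y)) x = \I_y (v y * partial i (k^~ y) x).
Proof.
move=> iv; elim=> [f g tf tg|k1 k2 s1 t1 s2 t2].
  rewrite (_ : (fun _ => _) = fun x => f x * \I_y (v y * g y)); last first.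
    apply/funext => z; rewrite -intZ//; last exact: integ_trigM.
    by under eq_Rintegral do rewrite mulrCA.
  have df := trig_differentiable x tf.
  have partialMc c : partial i (fun x => f x * c) x = partial i f x * c.
    by rewrite partialM// partial_cst mulr0 add0r mulrC.
  have itg := integ_trigM iv tg.
  rewrite partialMc [LHS]mulrC -(intZr (partial i f x) itg).
  by apply: eq_Rintegral => y _; rewrite partialMc mulrA mulrAC.
rewrite (_ : (fun _ => _) = fun x => \I_y (v y * k1 x y) + \I_y (v y * k2 x y)); last first.
  apply/funext => z; rewrite -intD//.
  - by under eq_Rintegral do rewrite mulrDr.
  - by apply: integ_trigM => //; exact: separable_trig_r.
  - by apply: integ_trigM => //; exact: separable_trig_r.
rewrite partialD; try exact: (trig_differentiable _ (separable_integral iv _)).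
rewrite t1 t2 -intD.
- apply: eq_Rintegral => y _; rewrite -mulrDr partialD//.
    exact: (trig_differentiable _ (separable_trig_l _ s1)).
  exact: (trig_differentiable _ (separable_trig_l _ s2)).
- exact: (integ_trigM iv (separable_trig_r _ (separable_partial i s1))).
- exact: (integ_trigM iv (separable_trig_r _ (separable_partial i s2))).
Qed.

Lemma separable_swap u v k : integ u -> integ v -> separable L k ->
  \I_x (u x * \I_y (v y * k x y)) = \I_y (v y * \I_x (u x * k x y)).
Proof.
move=> iu iv; elim=> [f g tf tg|k1 k2 s1 t1 s2 t2].
  transitivity (\I_x (u x * f x) * \I_y (v y * g y)).
    rewrite -intZr; last exact: integ_trigM.
    apply: eq_Rintegral => x _; rewrite -mulrA; congr (_ * _).
    by rewrite -intZ; [apply: eq_Rintegral => y _; rewrite mulrCA|exact: integ_trigM].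
  rewrite mulrC -intZr; last exact: integ_trigM.
  apply: eq_Rintegral => x _; rewrite -mulrA; congr (_ * _).
  rewrite -intZ; last exact: integ_trigM.
  by apply: eq_Rintegral => y _; rewrite mulrCA [g x * _]mulrC.
have Dl x : \I_y (v y * (k1 x y + k2 x y)) = \I_y (v y * k1 x y) + \I_y (v y * k2 x y).
  rewrite -(intD (integ_trigM iv (separable_trig_r x s1)) (integ_trigM iv (separable_trig_r x s2))).
  by under eq_Rintegral do rewrite mulrDr.
have Dr y : \I_x (u x * (k1 x y + k2 x y)) = \I_x (u x * k1 x y) + \I_x (u x * k2 x y).
  rewrite -(intD (integ_trigM iu (separable_trig_l y s1)) (integ_trigM iu (separable_trig_l y s2))).
  by under eq_Rintegral do rewrite mulrDr.
under eq_Rintegral do rewrite Dl mulrDr.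
under [RHS]eq_Rintegral do rewrite Dr mulrDr.
have il l : separable L l -> integ (fun x => u x * \I_y (v y * l x y)).
  by move=> sk; exact: (integ_trigM iu (separable_integral iv sk)).
have ir l : separable L l -> integ (fun y => v y * \I_x (u x * l x y)).
  by move=> /separable_sym /(separable_integral iu); exact: integ_trigM.
by rewrite (intD (il k1 s1) (il k2 s2)) (intD (ir k1 s1) (ir k2 s2)) t1 t2.
Qed.

Lemma is_derive_separable v k i (t : R) : integ v -> separable L k ->
  is_derive t (1 : R) (fun s => \I_x (v x * k x (s *: delta_mx ord0 i)))
    (\I_x (v x * partial i (k x) (t *: delta_mx ord0 i))).
Proof.
move=> iv; elim=> [f g tf tg|k1 k2 s1 t1 s2 t2].
  rewrite (_ : (fun _ => _) = fun s => \I_x (v x * f x) * g (s *: delta_mx ord0 i)); last first.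
    apply/funext => s; rewrite -intZr; last exact: integ_trigM.
    by under eq_Rintegral do rewrite mulrA.
  have dg : is_derive t (1 : R) (fun s => g (s *: delta_mx ord0 i))
    (partial i g (t *: delta_mx ord0 i)).
    exact/is_derive_line/(trig_differentiable _ tg).
  have := @is_deriveZ _ _ _ _ (\I_x (v x * f x)) _ _ _ dg.
  move=> /is_derive_eq; apply; rewrite /GRing.scale/= -intZr; last exact: integ_trigM.
  apply: eq_Rintegral => x _.
  rewrite partialM; [|exact: differentiable_cst|exact: (trig_differentiable _ tg)].
  by rewrite partial_cst mulr0 addr0 mulrA.
rewrite (_ : (fun _ => _) = fun s => \I_x (v x * k1 x (s *: delta_mx ord0 i)) +
    \I_x (v x * k2 x (s *: delta_mx ord0 i))); last first.
  apply/funext => s; rewrite -intD; try by apply: integ_trigM => //; exact: separable_trig_l.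
  by under eq_Rintegral do rewrite mulrDr.
have := @is_deriveD _ _ _ _ _ _ _ _ _ t1 t2.
move=> /is_derive_eq; apply; rewrite -intD.
- apply: eq_Rintegral => x _; rewrite -mulrDr partialD//.
    exact: (trig_differentiable _ (separable_trig_r _ s1)).
  exact: (trig_differentiable _ (separable_trig_r _ s2)).
- exact: (integ_trigM iv (separable_trig_l _ (separable_partial_r i s1))).
- exact: (integ_trigM iv (separable_trig_l _ (separable_partial_r i s2))).
Qed.

End integration.
End separable_theory.

(** * Variation tested on trigonometric polynomials *)

Section directional_variation.
Context {R : realType} {d : nat}.
Variable L : R.
Hypothesis L_gt0 : 0 < L.
Implicit Types (f v u : 'rV[R]_d -> R) (x y z : 'rV[R]_d).
Local Notation integ := (@cell_integrable R d L).
Local Notation "'\I_' x f" := (\int[@lebesgue_rV R d]_(x in cell L) f)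
  (at level 36, x name, f at level 36).

Definition trig_unit f := trig_poly L f /\ forall x, `|f x| <= 1.

(** A one-sided bound suffices since [- f] is a test together with [f]. Restricting to trigonometric
    tests asks no more of [v] than a bound on its distributional derivative, and [trig_density]
    later recovers L^1 norms from it. *)
Definition variation_le i v (c : R) :=
  forall f, trig_unit f -> \I_x (v x * partial i f x) <= c.

Lemma trig_unit_opp f : trig_unit f -> trig_unit (fun x => - f x).
Proof. by move=> [tf f1]; split=> [|x]; [exact: trig_opp|rewrite normrN]. Qed.

Lemma trig_unit_shift f y : trig_unit f -> trig_unit (fun x => f (x + y)).
Proof. by move=> [tf f1]; split=> [|x]; [exact: trig_shift|]. Qed.

Lemma trig_unit0 : trig_unit (fun=> 0).
Proof. by split=> [|x]; [exact: trig_cst|rewrite normr0]. Qed.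

Lemma variation_le_norm i v c f : integ v -> variation_le i v c -> trig_unit f ->
  `|\I_x (v x * partial i f x)| <= c.
Proof.
move=> iv vc tf; rewrite ler_norml vc// andbT lerNl.
have := vc _ (trig_unit_opp tf).
suff -> : \I_x (v x * partial i (fun x => - f x) x) = - \I_x (v x * partial i f x) by [].
rewrite -mulN1r -intZ; last by apply: integ_trigM => //; apply: trig_partial; case: tf.
apply: eq_Rintegral => x _; rewrite mulN1r -mulrN; congr (_ * _).
have df := trig_differentiable x tf.1.
by rewrite /partial deriveN//; exact: diff_derivable.
Qed.

Lemma is_derive_shift_integral i v f z (t : R) : integ v -> trig_poly L f ->
  is_derive t (1 : R) (fun s => \I_x (v x * f (x + z + s *: delta_mx ord0 i)))
    (\I_x (v x * partial i f (x + z + t *: delta_mx ord0 i))).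
Proof.
move=> iv /(trig_shift z)/separable_addition sf.
have := is_derive_separable i t iv sf.
have addE x y : x + y + z = x + z + y by rewrite addrAC.
under eq_fun do under eq_Rintegral do rewrite addE.
move=> /is_derive_eq; apply; apply: eq_Rintegral => x _; congr (_ * _).
have := partial_shift i f (x + z) (t *: delta_mx ord0 i).
rewrite [X in partial i f X]addrC => <-.
rewrite (_ : (fun y => f (x + y + z)) = fun y => f (y + (x + z)))//.
by apply/funext => y; rewrite [x + y]addrC addrA.
Qed.

(** Translates of [f] are again admissible tests, so the derivative in [t] of the pairing is bounded
    by [c], and the mean value theorem applies. *)
Lemma variation_shift i v c f z (t : R) : integ v -> variation_le i v c ->
  trig_unit f ->
  `|\I_x (v x * f (x + z + t *: delta_mx ord0 i)) - \I_x (v x * f (x + z))|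
    <= c * `|t|.
Proof.
move=> iv vc tf.
pose J s := \I_x (v x * f (x + z + s *: delta_mx ord0 i)).
pose J' s := \I_x (v x * partial i f (x + z + s *: delta_mx ord0 i)).
have dJ s : is_derive s (1 : R) J (J' s).
  by apply: is_derive_shift_integral => //; case: tf.
have J'c s : `|J' s| <= c.
  have := variation_le_norm iv vc (trig_unit_shift (z + s *: delta_mx ord0 i) tf).
  by under eq_Rintegral do rewrite partial_shift addrA.
have JB a b : a <= b -> `|J b - J a| <= c * (b - a).
  move=> ab.
  have cJ : {within `[a, b], continuous J}.
    by apply: derivable_within_continuous => s _; have [] := dJ s.
  have [s _ ->] := MVT_segment ab (fun s _ => dJ s) cJ.
  by rewrite normrM [X in _ * X]ger0_norm ?subr_ge0// ler_wpM2r ?subr_ge0.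
have -> : \I_x (v x * f (x + z)) = J 0.
  by rewrite /J; under [RHS]eq_Rintegral do rewrite scale0r addr0.
rewrite -/(J t); have [t0|t0] := leP 0 t.
  by have := JB 0 t t0; rewrite subr0 (ger0_norm t0).
by have := JB t 0 (ltW t0); rewrite distrC sub0r (ltr0_norm t0).
Qed.

Lemma variation_shift1 i v c f (t : R) : integ v -> variation_le i v c ->
  trig_unit f ->
  `|\I_x (v x * f (x + t *: delta_mx ord0 i)) - \I_x (v x * f x)| <= c * `|t|.
Proof.
move=> iv vc tf; have := variation_shift 0 t iv vc tf.
by under eq_Rintegral do rewrite addr0; under [X in _ - X]eq_Rintegral do rewrite addr0.
Qed.

Lemma variation_le_ge0 i v c : variation_le i v c -> 0 <= c.
Proof.
move=> /(_ _ trig_unit0); under eq_Rintegral do rewrite partial_cst mulr0.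
by rewrite Rintegral_cst// mul0r.
Qed.

(** On [0, L] this is the distance of [t] to the multiples of [L]. A periodic bump centred at 0 has
    its mass at both ends of the cell, so this distance, and not [t], has a small mean. *)
Definition circ_norm (t : R) : R := Num.min t (L - t).

Lemma variation_shift_cell v (c : 'I_d -> R) f z : integ v ->
  (forall i, variation_le i v (c i)) -> trig_unit f -> cell L z ->
  `|\I_x (v x * f (x + z)) - \I_x (v x * f x)| <=
  \sum_i c i * circ_norm (z ord0 i).
Proof.
move=> iv vc tf cz.
(* Coordinates beyond half a period are lowered by [L], which periodicity of [f] hides; the shift is
   then performed along the axes, one coordinate at a time. *)
pose k (i : 'I_d) : int := if z ord0 i <= L - z ord0 i then 0 else -1.
pose z' := z + \row_i (L *~ k i).
have z'E i : `|z' ord0 i| = circ_norm (z ord0 i).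
  have := cz i; rewrite in_itv/= => /andP[z0 zL].
  rewrite /z' /k !mxE /circ_norm; case: leP => h; first by rewrite mulr0z addr0 ger0_norm.
  by rewrite mulrN1z distrC ger0_norm// subr_ge0.
have -> : \I_x (v x * f (x + z)) = \I_x (v x * f (x + z')).
  apply: eq_Rintegral => x _; rewrite /z' addrA cell_periodicz//.
  by apply: trig_periodic => //; case: tf.
have step (s : seq 'I_d) y :
    `|\I_x (v x * f (x + (y + \sum_(i <- s) z' ord0 i *: delta_mx ord0 i)))
      - \I_x (v x * f (x + y))| <= \sum_(i <- s) c i * `|z' ord0 i|.
  elim: s y => [|i s ih] y.
    by rewrite !big_nil; under eq_Rintegral do rewrite addr0; rewrite subrr normr0.
  rewrite !big_cons addrA.
  apply: (le_trans (ler_distD (\I_x (v x * f (x + (y + z' ord0 i *: delta_mx ord0 i)))) _ _)).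
  rewrite [leRHS]addrC lerD//.
  have := variation_shift y (z' ord0 i) iv (vc i) tf.
  by under eq_Rintegral do rewrite -addrA.
have := step (index_enum 'I_d) 0.
rewrite add0r -row_sum_delta.
under [X in _ - X]eq_Rintegral do rewrite addr0.
by move=> /le_trans; apply; apply: ler_sum => i _; rewrite z'E.
Qed.

End directional_variation.

(** * Density of trigonometric polynomials *)

Section sharp_powers.
Context {R : realType}.
Implicit Types (r x q : R) (n m : nat).

Lemma bernoulli x m : -1 <= x -> 1 + m%:R * x <= (1 + x) ^+ m.
Proof.
move=> x1; elim: m => [|m ih]; first by rewrite mul0r addr0 expr0.
have x10 : 0 <= 1 + x by rewrite -lerBlDl sub0r.
rewrite exprS; apply: le_trans (ler_wpM2l x10 ih).
have := mulr_ge0 (ler0n R m) (sqr_ge0 x).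
by rewrite -natr1; nra.
Qed.

(** [n q^n] is at most the sum of the [q^k] for [k < n], a partial sum of the geometric series. *)
Lemma natM_exp_le q n : 0 <= q < 1 -> n%:R * q ^+ n <= (1 - q)^-1.
Proof.
move=> /andP[q0 q1].
have q1' : 0 < 1 - q by rewrite subr_gt0.
rewrite -[leRHS]mul1r ler_pdivlMr//.
have H k : k%:R * q ^+ k * (1 - q) <= 1 - q ^+ k.
  elim: k => [|k ih]; first by rewrite !mul0r expr0 subrr.
  have qk1 : k%:R * q ^+ k * (1 - q) * q <= (1 - q ^+ k) * q by rewrite ler_wpM2r.
  have : 0 <= (1 - q ^+ k.+1) * (1 - q).
    by rewrite mulr_ge0 ?subr_ge0 ?(ltW q1)// exprn_ile1// ltW.
  rewrite exprS -natr1.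
  by move: (q ^+ k) qk1 => Q; move: (k%:R : R) => K; nra.
by apply: (le_trans (H n)); rewrite lerBlDr lerDl exprn_ge0.
Qed.

(* The two regimes of the exponent: [n 2^n r^n] tends to 0 for [r < 1/2] and
   is at least [n] for [r >= 1/2]. *)
Lemma cvg_sharp_powers r : 0 <= r <= 1 ->
  (fun n => (1 - r ^+ n) ^+ (n * 2 ^ n)%N) @ \oo --> ((r < 2^-1)%R%:R : R).
Proof.
move=> /andP[r0 r1].
have rn01 n : 0 <= r ^+ n <= 1 by rewrite exprn_ge0//= exprn_ile1.
have p01 n : 0 <= (1 - r ^+ n) ^+ (n * 2 ^ n)%N <= 1.
  have /andP[? ?] := rn01 n.
  by rewrite exprn_ge0 ?subr_ge0//= exprn_ile1 ?subr_ge0// gerBl.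
have [r2|r2] := ltP r 2^-1.
(* The root is taken so that [n (2 r)^n] reads [(n q^n) q^n]: the first factor is bounded and the
   second tends to 0. *)
- pose q := Num.sqrt (2 * r).
  have q0 : 0 <= q by exact: sqrtr_ge0.
  have qq : q ^+ 2 = 2 * r by rewrite sqr_sqrtr// mulr_ge0.
  have q1 : q < 1.
    rewrite -(@ltr_pXn2r _ 2)// ?nnegrE// expr1n qq.
    by rewrite -ltr_pdivlMl// mulr1.
  apply: (@squeeze_cvgr _ _ _ _ (fun n => 1 - (1 - q)^-1 * q ^+ n) (fun=> 1)).
  + near=> n; have /andP[_ ->] := p01 n; rewrite andbT.
    have /andP[rn0 rn1] := rn01 n.
    apply: le_trans (@bernoulli (- r ^+ n) (n * 2 ^ n)%N _); last by rewrite lerN2.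
    rewrite mulrN lerD2l lerN2 natrM natrX -mulrA -exprMn -qq -exprM mulnC exprM.
    rewrite expr2 mulrA ler_wpM2r ?exprn_ge0//.
    by apply: natM_exp_le; rewrite q0.
  + rewrite -[X in _ --> X]subr0; apply: cvgB; first exact: cvg_cst.
    rewrite -(mulr0 (1 - q)^-1); apply: cvgMr.
    by apply: cvg_expr; rewrite ger0_norm.
  + exact: cvg_cst.
(* Multiplied by the same power of [1 + r^n], the sequence stays below 1, while by Bernoulli that
   power is at least [n + 1]. The factor [n] in the exponent is what settles [r = 1/2]. *)
- apply: (@squeeze_cvgr _ _ _ _ (fun=> 0) (fun n => n.+1%:R^-1)).
  + near=> n; have /andP[-> _] := p01 n => /=.
    have /andP[rn0 rn1] := rn01 n.
    rewrite -[leRHS]mul1r ler_pdivlMr//.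
    have h : n.+1%:R <= (1 + r ^+ n) ^+ (n * 2 ^ n)%N :> R.
      apply: le_trans (@bernoulli (r ^+ n) (n * 2 ^ n)%N _); last exact: le_trans rn0.
      rewrite -add1n natrD lerD2l natrM natrX -mulrA -exprMn ler_peMr//.
      by rewrite exprn_ege1// -ler_pdivrMl// mulr1.
    apply: (le_trans (ler_wpM2l _ h)); first by have /andP[] := p01 n.
    rewrite -exprMn -subr_sqr expr1n exprn_ile1//.
      by rewrite subr_ge0 exprn_ile1.
    by rewrite gerBl sqr_ge0.
  + exact: cvg_cst.
  + exact: cvg_harmonic.
Unshelve. all: by end_near. Qed.

End sharp_powers.

(** * Sets whose indicator is a limit of trigonometric polynomials *)

Section trig_density.
Context {R : realType} {d : nat}.
Variable L : R.
Hypothesis L_gt0 : 0 < L.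
Implicit Types (f g v : 'rV[R]_d -> R) (x : 'rV[R]_d) (A B : set 'rV[R]_d).
Local Notation integ := (@cell_integrable R d L).
Local Notation "'\I_' x f" := (\int[@lebesgue_rV R d]_(x in cell L) f)
  (at level 36, x name, f at level 36).

Lemma int_dominated v (F : nat -> 'rV[R]_d -> R) g : integ v ->
  (forall n, measurable_fun setT (F n)) -> measurable_fun setT g ->
  (forall n x, `|F n x| <= 1) -> (forall x, F ^~ x @ \oo --> g x) ->
  forall e, 0 < e -> exists n, \I_x (`|v x| * `|F n x - g x|) <= e.
Proof.
move=> iv mF mg F1 Fg e e0.
have g1 x : `|g x| <= 1.
  apply: (cvgr_to_le (cvg_norm (Fg x))).
  by near=> n; exact: F1.
pose h n x := (`|v x| * `|F n x - g x|)%:E.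
have mv := integ_measurable iv.
have mh n : measurable_fun (cell L) (h n).
  apply/measurable_EFinP; apply: measurable_funM; first exact: measurableT_comp.
  apply: measurableT_comp => //; apply: measurable_funTS.
  exact: measurable_funB.
have h0 : {ae (@lebesgue_rV R d), forall x, cell L x -> h ^~ x @ \oo --> 0%:E}.
  apply/aeW => x _; rewrite /h.
  apply: cvg_EFin; first by near=> n.
  rewrite (_ : fine \o _ = fun n => `|v x| * `|F n x - g x|)//.
  rewrite -(mulr0 `|v x|); apply: cvgMr.
  rewrite -[X in _ --> X](@normr0 _ R); apply: cvg_norm.
  by rewrite -(subrr (g x)); apply: cvgB; [exact: Fg|exact: cvg_cst].
have hv : {ae (@lebesgue_rV R d), forall x n, cell L x ->
    (`|h n x| <= (EFin \o (fun x => 2 * `|v x|)%R) x)%E}.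
  apply/aeW => x n _; rewrite /h /= lee_fin ger0_norm ?mulr_ge0//.
  rewrite mulrC ler_wpM2r//; apply: (le_trans (ler_normB _ _)).
  by rewrite -[2]/(1 + 1) lerD.
have [_ _] := dominated_convergence (measurable_cell L) mh (measurable_cst _) h0
  (integZ 2 (integ_abs iv)) hv.
rewrite integral0 => /fine_cvg/cvgrPdist_le/(_ e e0)[N _ /(_ N (leqnn N))].
rewrite /= sub0r normrN => h1; exists N.
exact: (le_trans (ler_norm _) h1).
Unshelve. all: by end_near. Qed.

Definition trig_approximable v A := measurable A /\
  forall e, 0 < e -> exists2 f, trig_poly L f /\ (forall x, 0 <= f x <= 1) &
    \I_x (`|v x| * `|f x - \1_A x|) <= e.

Section approximable.
Variable v : 'rV[R]_d -> R.
Hypothesis iv : integ v.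

Lemma integ_error f A : trig_poly L f -> measurable A ->
  integ (fun x => `|v x| * `|f x - \1_A x|).
Proof.
move=> tf mA; apply: integM; first exact: integ_abs.
have [B B0 fB] := trig_bounded tf; split.
  apply: measurable_funTS; apply: measurableT_comp => //.
  by apply: measurable_funB => //; exact: (trig_measurable tf).
exists (B + 1) => x; rewrite normr_id (le_trans (ler_normB _ _))// lerD//.
by rewrite indicE; case: (_ \in _); rewrite ?normr1// normr0.
Qed.

Lemma approximable_limit (F : nat -> 'rV[R]_d -> R) A : measurable A ->
  (forall n, trig_poly L (F n)) -> (forall n x, 0 <= F n x <= 1) ->
  (forall x, F ^~ x @ \oo --> (\1_A x : R)) -> trig_approximable v A.
Proof.
move=> mA tF F01 FA; split=> // e e0.
have [] := int_dominated iv (fun n => trig_measurable (tF n)) _ _ FA e0.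
- exact: measurable_indic.
- by move=> n x; have /andP[? ?] := F01 n x; rewrite ger0_norm.
- by move=> n hn; exists (F n).
Qed.

Lemma approximableC A : trig_approximable v A -> trig_approximable v (~` A).
Proof.
move=> [mA hA]; split=> [|e e0]; first exact: measurableC.
have [f [tf f01] fe] := hA e e0; exists (fun x => 1 - f x).
  split=> [|x]; first by apply: trig_sub => //; exact: trig_cst.
  by have /andP[? ?] := f01 x; rewrite subr_ge0 gerBl; apply/andP.
apply: le_trans fe; rewrite le_eqVlt; apply/orP; left; apply/eqP.
apply: eq_Rintegral => x _; congr (_ * _); rewrite distrC.
by rewrite !indicE in_setC; case: (_ \in _) => /=; congr `|_|; ring.
Qed.

Lemma approximable0 : trig_approximable v set0.
Proof.
split=> // e e0; exists (fun=> 0); first by split=> [|x]; [exact: trig_cst|rewrite lexx ler01].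
under eq_Rintegral do rewrite indic0 subrr normr0 mulr0.
by rewrite Rintegral_cst// mul0r ltW.
Qed.

(** The combination [1 - (1 - f) (1 - g)] stays in [0, 1], and its error is pointwise at most the
    sum of the two errors. *)
Lemma approximableU A B : trig_approximable v A -> trig_approximable v B ->
  trig_approximable v (A `|` B).
Proof.
move=> [mA hA] [mB hB]; split=> [|e e0]; first exact: measurableU.
have e20 : 0 < e / 2 by rewrite divr_gt0.
have [f [tf f01] fe] := hA _ e20; have [g [tg g01] ge] := hB _ e20.
have th : trig_poly L (fun x => 1 - (1 - f x) * (1 - g x)).
  by apply: trig_sub; [exact: trig_cst|apply: trig_mul; apply: trig_sub => //; exact: trig_cst].
exists (fun x => 1 - (1 - f x) * (1 - g x)).
  split=> // x; have /andP[? ?] := f01 x; have /andP[? ?] := g01 x.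
  have h0 : 0 <= 1 - f x by rewrite subr_ge0.
  have h1 : 0 <= 1 - g x by rewrite subr_ge0.
  by rewrite subr_ge0 mulr_ile1 ?gerBl//= mulr_ge0.
rewrite [e]splitr; apply: le_trans (lerD fe ge).
have mAB : measurable (A `|` B) by exact: measurableU.
rewrite -intD; [|exact: integ_error..].
apply: le_int => [||x _]; first exact: integ_error.
  by apply: integD; exact: integ_error.
rewrite -mulrDr ler_wpM2l//.
have /andP[f0 f1] := f01 x; have /andP[g0 g1] := g01 x.
rewrite !indicE in_setU; case: (x \in A); case: (x \in B) => /=;
  rewrite ?subr0; move: (f x) (g x) f0 f1 g0 g1 => a b a0 a1 b0 b1;
  rewrite ler_norml;
  rewrite ?(ler0_norm (_ : a - 1 <= 0)) ?(ler0_norm (_ : b - 1 <= 0)) ?subr_le0//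
    ?(ger0_norm a0) ?(ger0_norm b0); apply/andP; split; nra.
Qed.

(** Finite unions increase to the whole union; by dominated convergence in the weight |v|, one of
    them already replaces it up to a small error. *)
Lemma approximable_bigcup (F : nat -> set 'rV[R]_d) :
  (forall n, trig_approximable v (F n)) -> trig_approximable v (\bigcup_n F n).
Proof.
move=> hF.
have mF : measurable (\bigcup_n F n) by apply: bigcupT_measurable => n; case: (hF n).
split=> // e e0; have e20 : 0 < e / 2 by rewrite divr_gt0.
pose G n := \big[setU/set0]_(i < n) F i.
have hG n : trig_approximable v (G n).
  rewrite /G; elim: n => [|n ih]; first by rewrite big_ord0; exact: approximable0.
  by rewrite big_ord_recr; exact: approximableU.
have [] := @int_dominated v (fun n => \1_(G n)) (\1_(\bigcup_n F n)) iv _ _ _ _ _ e20.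
- by move=> n; apply: measurable_indic; case: (hG n).
- exact: measurable_indic.
- by move=> n x; rewrite indicE; case: (_ \in _); rewrite ?normr1// normr0.
- move=> x; apply: cvg_near_cst.
  have [[n _ Fnx]|nF] := pselect ((\bigcup_n F n) x).
    near=> m; rewrite !indicE !mem_set//; first by exists n.
    rewrite /G -bigcup_mkord; exists n => //=.
    by near: m; exists n.+1.
  near=> m; rewrite !indicE !memNset//.
  by rewrite /G -bigcup_mkord => -[k _ Fkx]; apply: nF; exists k.
move=> n hn; have [mG /(_ _ e20)[f [tf f01] fe]] := hG n.
exists f => //; rewrite [e]splitr; apply: le_trans (lerD fe hn).
rewrite -intD; [|exact: integ_error|]; last first.
  apply: integM; first exact: integ_abs; split.
    apply: measurable_funTS; apply: measurableT_comp => //.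
    by apply: measurable_funB; exact: measurable_indic.
  exists (1 + 1) => x; rewrite normr_id (le_trans (ler_normB _ _))// lerD//;
    by rewrite indicE; case: (_ \in _); rewrite ?normr1// normr0.
apply: le_int => [||x _]; first exact: integ_error.
  apply: integD; first exact: integ_error.
  apply: integM; first exact: integ_abs; split.
    apply: measurable_funTS; apply: measurableT_comp => //.
    by apply: measurable_funB; exact: measurable_indic.
  exists (1 + 1) => x; rewrite normr_id (le_trans (ler_normB _ _))// lerD//;
    by rewrite indicE; case: (_ \in _); rewrite ?normr1// normr0.
by rewrite -mulrDr ler_wpM2l// ler_distD.
Unshelve. all: by end_near. Qed.

Lemma approximable_sigma : sigma_algebra setT (trig_approximable v).
Proof.
split=> [|A|F hF]; first exact: approximable0.
  by rewrite setTD; exact: approximableC.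
exact: approximable_bigcup.
Qed.

(** The affine change [r = (1 - g) / 2] takes values in [0, 1] and turns [0 < g] into [r < 1/2], the
    set singled out by [cvg_sharp_powers]. *)
Lemma approximable_pos g : trig_poly L g -> (forall x, `|g x| <= 1) ->
  trig_approximable v [set x | 0 < g x].
Proof.
move=> tg g1; pose r x := (1 - g x) / 2.
have tr : trig_poly L r.
  by apply: trig_mul; [apply: trig_sub => //; exact: trig_cst|exact: trig_cst].
have r01 x : 0 <= r x <= 1.
  by have := g1 x; rewrite ler_norml => /andP[? ?]; apply/andP; split; rewrite /r; lra.
have rn01 n x : 0 <= r x ^+ n <= 1.
  by have /andP[? ?] := r01 x; rewrite exprn_ge0//= exprn_ile1.
apply: (@approximable_limit (fun n x => (1 - r x ^+ n) ^+ (n * 2 ^ n)%N)).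
- have -> : [set x | 0 < g x] = setT `&` g @^-1` `]0, +oo[.
    by rewrite setTI; apply/seteqP; split => x /=; rewrite in_itv/= andbT.
  exact: (trig_measurable tg).
- move=> n; apply: trig_exp; apply: trig_sub; first exact: trig_cst.
  exact: trig_exp.
- move=> n x; have /andP[? ?] := rn01 n x.
  by rewrite exprn_ge0 ?subr_ge0//= exprn_ile1 ?subr_ge0// gerBl.
- move=> x; rewrite (_ : \1__ x = (r x < 2^-1)%R%:R); first exact: cvg_sharp_powers.
  rewrite indicE; congr (_%:R); congr nat_of_bool.
  have -> : (r x < 2^-1) = (0 < g x) by rewrite /r; apply/idP/idP => ?; lra.
  by apply/idP/idP; rewrite inE.
Qed.

End approximable.
End trig_density.

(** * The L^1 norm as a supremum over trigonometric polynomials *)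

Section total_mass.
Context {R : realType} {d : nat}.
Variable L : R.
Hypothesis L_gt0 : 0 < L.
Implicit Types (f g v : 'rV[R]_d -> R) (x : 'rV[R]_d) (A B : set 'rV[R]_d).
Local Notation integ := (@cell_integrable R d L).
Local Notation "'\I_' x f" := (\int[@lebesgue_rV R d]_(x in cell L) f)
  (at level 36, x name, f at level 36).

Lemma cosB_half (a b : R) : (cos a - cos b) / 2 = sin ((a + b) / 2) * sin ((b - a) / 2).
Proof.
have [p [q [-> ->]]] : exists p q, a = p - q /\ b = p + q.
  by exists ((a + b) / 2), ((b - a) / 2); split; lra.
have -> : (p - q + (p + q)) / 2 = p by lra.
have -> : (p + q - (p - q)) / 2 = q by lra.
by rewrite cosB (cosD p q); lra.
Qed.

Lemma cos_wrap (t : R) : cos (freq L * wrap L t) = cos (freq L * t).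
Proof.
apply: (@wrapE _ _ (fun t => cos (freq L * t))) => s.
by rewrite mulrDr freqK// cosD2pi.
Qed.

Lemma sin_wrap (t : R) : sin (freq L * wrap L t) = sin (freq L * t).
Proof.
apply: (@wrapE _ _ (fun t => sin (freq L * t))) => s.
by rewrite mulrDr freqK// sinD2pi.
Qed.

(* The arc [0 < t < a] of the circle is where
   [sin (pi t / L) * sin (pi (a - t) / L)] is positive. *)
Lemma wrap_lt (a t : R) : 0 < a < L ->
  (wrap L t < a) = (0 < (cos (freq L * t - freq L * a / 2) - cos (freq L * a / 2)) / 2)
    || ~~ (0 < (cos 0 - cos (freq L * t)) / 2).
Proof.
move=> /andP[a0 aL].
have E : cos (freq L * t - freq L * a / 2) =
    cos (freq L * wrap L t - freq L * a / 2).
  by rewrite !cosB cos_wrap sin_wrap.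
rewrite E -cos_wrap {E}; have := wrap_itv t L_gt0; rewrite in_itv/=.
move: (wrap L t) => {}t /andP[t0 tL].
have fE (x : R) : freq L * x / 2 = pi * (x / L) by rewrite /freq; field; rewrite gt_eqF.
have s0 (x : R) : 0 < x < L -> 0 < sin (freq L * x / 2).
  move=> /andP[x0 xL]; rewrite fE sin_gt0_pi// mulr_gt0 ?pi_gt0 ?divr_gt0//=.
  by rewrite gtr_pMr ?pi_gt0// ltr_pdivrMr// mul1r.
rewrite !cosB_half.
have -> : (freq L * t - freq L * a / 2 + freq L * a / 2) / 2 = freq L * t / 2 by lra.
have -> : (freq L * a / 2 - (freq L * t - freq L * a / 2)) / 2 = freq L * (a - t) / 2 by lra.
rewrite add0r subr0 -expr2.
(* At [t = 0] the arc function vanishes. This endpoint comes from the second disjunct: the function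
   there is the square of a sine which, on [0, L[, is zero at 0 only. *)
move: t0; rewrite le_eqVlt => /predU1P[<-|t0].
  by rewrite mulr0 mul0r sin0 expr0n/= ltxx orbT a0.
have st : 0 < sin (freq L * t / 2) by apply: s0; rewrite t0.
rewrite exprn_gt0//= orbF pmulr_rgt0//.
have [ta|at_] := ltP t a.
  by rewrite s0// subr_gt0 ta/= (le_lt_trans _ aL)// gerBl ltW.
apply/esym/negbTE; rewrite -leNgt; move: at_; rewrite le_eqVlt => /predU1P[<-|at_].
  by rewrite subrr mulr0 mul0r sin0.
rewrite -opprB mulrN mulNr sinN oppr_le0 ltW// s0// subr_gt0 at_/=.
by rewrite (le_lt_trans _ tL)// gerBl ltW.
Qed.

Section fixed_weight.
Variable v : 'rV[R]_d -> R.
Hypothesis iv : integ v.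

Lemma trig_arc (a : R) i : trig_poly L (fun x => (cos (freq L * x ord0 i - a) - cos a) / 2).
Proof.
apply: trig_mul; last exact: trig_cst.
apply: trig_sub; last exact: trig_cst.
rewrite (_ : (fun _ => _) = fun x : 'rV[R]_d => cos (freq L * x ord0 i) * cos a +
    sin (freq L * x ord0 i) * sin a); last by apply/funext => x; rewrite cosB.
by apply: trig_add; apply: trig_mul; [exact: trig_cos|exact: trig_cst|exact: trig_sin|exact: trig_cst].
Qed.

Lemma half_diff_cos_le1 (a b : R) : `|(cos a - cos b) / 2| <= 1.
Proof.
rewrite normrM [X in _ * X]ger0_norm// ler_pdivrMr// mul1r.
by rewrite (le_trans (ler_normB _ _))// -[2]/(1 + 1) lerD// cos_max.
Qed.

Lemma approximable_wrap_lt i (a : R) :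
  trig_approximable L v [set x | wrap L (x ord0 i) < a].
Proof.
have [a0|a0] := leP a 0.
  rewrite (_ : [set _ | _] = set0); first exact: approximable0.
  rewrite -subset0 => x /=; have := wrap_itv (x ord0 i) L_gt0; rewrite in_itv/= => /andP[w0 _].
  by move=> /lt_le_trans/(_ a0); rewrite ltNge w0.
have [aL|aL] := leP L a.
  rewrite (_ : [set _ | _] = ~` set0); first exact/approximableC/approximable0.
  rewrite setC0 -subTset => x _ /=; have := wrap_itv (x ord0 i) L_gt0.
  by rewrite in_itv/= => /andP[_ /lt_le_trans]; apply.
rewrite (_ : [set _ | _] =
   [set x | 0 < (cos (freq L * x ord0 i - freq L * a / 2) - cos (freq L * a / 2)) / 2] `|`
   ~` [set x | 0 < (cos 0 - cos (freq L * x ord0 i)) / 2]); last first.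
  apply/seteqP; split => x /=; rewrite wrap_lt ?a0//.
    by move=> /orP[h|/negP h]; [left|right].
  by move=> [->//|/negP ->]; rewrite orbT.
apply: approximableU => //.
  apply: approximable_pos => // [|x]; first exact: trig_arc.
  exact: half_diff_cos_le1.
apply: approximableC => //; apply: approximable_pos => // [|x].
  apply: trig_mul; last exact: trig_cst.
  by apply: trig_sub; [exact: trig_cst|exact: trig_cos].
exact: half_diff_cos_le1.
Qed.

Lemma approximable_wrap A : measurable A ->
  trig_approximable L v (wrap_rV L @^-1` A).
Proof.
move=> mA.
(* On [T'] the measurable sets are the approximable ones, so the claim becomes measurability of
   [wrap_rV L], which can be checked on half-lines coordinate by coordinate. *)
pose T' := g_sigma_algebraType (trig_approximable L v).
have : measurable_fun [set: T'] (wrap_rV L : T' -> 'rV[R]_d).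
  apply: measurable_fun_rV => i; apply: (measurability (@RGenInftyO.G R)).
    exact: RGenInftyO.measurableE.
  move=> _ [_ [a ->] <-]; rewrite setTI; apply: sub_sigma_algebra.
  have := approximable_wrap_lt i a; congr (trig_approximable L v _).
  by apply/seteqP; split => x /=; rewrite in_itv/= mxE.
move=> /(_ measurableT A mA); rewrite setTI.
rewrite /measurable/=.
by rewrite sigma_algebra_id//; exact: approximable_sigma.
Qed.

End fixed_weight.

(* The sets whose indicator is a limit of trigonometric polynomials in the
   weight |v| form a sigma-algebra containing the wrapped half-spaces, hence the
   sets {v > 0} and {v < 0}. *)
Lemma trig_density v c : torus_periodic L v -> integ v ->
  (forall f, trig_unit L f -> \I_x (v x * f x) <= c) -> \I_x `|v x| <= c.
Proof.
move=> pv iv vc; have mv := periodic_measurable L_gt0 pv iv.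
have hA (P : set R) : measurable P -> trig_approximable L v (v @^-1` P).
  move=> mP; rewrite (_ : v @^-1` P = wrap_rV L @^-1` (v @^-1` P)).
    by apply: approximable_wrap => //; rewrite -[X in measurable X]setTI; exact: mv.
  by apply/seteqP; split => x /=; rewrite wrap_rVE.
apply/ler_addgt0Pr => e e0; have e20 : 0 < e / 2 by rewrite divr_gt0.
have [mp /(_ _ e20)[p [tp p01] pe]] := hA `]0, +oo[%classic (measurable_itv _).
have [mn /(_ _ e20)[q [tq q01] qe]] := hA `]-oo, 0[%classic (measurable_itv _).
(* [p - q] imitates the sign of [v]: pointwise, |v| is v (p - q) plus the two weighted errors. *)
have tu : trig_unit L (fun x => p x - q x).
  split=> [|x]; first exact: trig_sub.
  have /andP[? ?] := p01 x; have /andP[? ?] := q01 x.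
  by rewrite ler_norml; apply/andP; split; lra.
rewrite [e]splitr addrA; apply: le_trans (lerD (lerD (vc _ tu) pe) qe).
have i1 := integ_trigM iv tu.1.
have i2 := integ_error iv tp mp; have i3 := integ_error iv tq mn.
rewrite -intD// -intD//; last exact: integD.
apply: le_int => [||x _]; [exact: integ_abs|by apply: integD => //; exact: integD|].
rewrite -addrA -mulrDr !indicE.
have -> : (x \in v @^-1` `]0, +oo[) = (0 < v x).
  by apply/idP/idP; rewrite inE /= in_itv/= andbT.
have -> : (x \in v @^-1` `]-oo, 0[) = (v x < 0).
  by apply/idP/idP; rewrite inE /= in_itv/=.
have /andP[p0 p1] := p01 x; have /andP[q0 q1] := q01 x.
have [vx|vx|->] := ltgtP (v x) 0 => /=; last by rewrite normr0 !mul0r addr0.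
- rewrite subr0 (ger0_norm p0) (ltr0_norm vx) (ler0_norm (_ : q x - 1 <= 0)) ?subr_le0//; nra.
- rewrite subr0 (ger0_norm q0) (gtr0_norm vx) (ler0_norm (_ : p x - 1 <= 0)) ?subr_le0//; nra.
Qed.

End total_mass.

(** * Mollification *)

Section bump.
Context {R : realType}.
Local Notation mu := (@lebesgue_measure R).
Variable L : R.
Hypothesis L_gt0 : 0 < L.
Implicit Types (t x rho : R) (n : nat).

(** This is cos (pi t / L) to the power 2 n, the de la Vallee Poussin kernel up to normalisation:
    nonnegative and, for large [n], concentrated near the multiples of [L] in width of order L /
    sqrt n. *)
Definition bump n t : R := ((1 + cos (freq L * t)) / 2) ^+ n.

Definition dbump n t : R :=
  - (n%:R * ((1 + cos (freq L * t)) / 2) ^+ n.-1 * (freq L / 2 * sin (freq L * t))).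

Lemma freq_gt0 : 0 < freq L.
Proof. by rewrite divr_gt0// mulr_gt0// pi_gt0. Qed.

Lemma half1cos_itv t : 0 <= (1 + cos (freq L * t)) / 2 <= 1.
Proof.
have := cos_geN1 (freq L * t); have := cos_le1 (freq L * t).
by move=> ? ?; apply/andP; split; lra.
Qed.

Lemma is_derive_bump n t : is_derive t (1 : R) (bump n) (dbump n t).
Proof.
have h : is_derive t (1 : R) (fun t => (1 + cos (freq L * t)) / 2)
    (2^-1 * (- freq L * sin (freq L * t))).
  have dc := is_derive_cosM (freq L) t.
  rewrite (_ : (fun _ => _) = fun t => 2^-1 *: (cst 1 t + cos (freq L * t))); last first.
    by apply/funext => s; rewrite /GRing.scale/= mulrC.
  apply: is_deriveZ; rewrite -[X in is_derive _ _ _ X]add0r.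
  exact: is_deriveD.
have := @is_deriveX R R _ n _ _ _ h.
move=> hX; rewrite (_ : bump n = (fun t => (1 + cos (freq L * t)) / 2) ^+ n); last first.
  by apply/funext => s; rewrite fctE.
apply: (is_derive_eq hX).
by rewrite /dbump /GRing.scale/=; ring.
Qed.

Lemma continuous_dbump n : continuous (dbump n).
Proof.
move=> t; apply: cvgN; apply: cvgM.
  apply: cvgMr; apply: (@differentiable_continuous _ _ _ t (bump n.-1)).
  by apply/derivable1_diffP; have [] := is_derive_bump n.-1 t.
apply: cvgMr; apply: (@differentiable_continuous _ _ _ t (fun t => sin (freq L * t))).
by apply/derivable1_diffP; have [] := is_derive_sinM (freq L) t.
Qed.

Lemma bump_ge0 n t : 0 <= bump n t.
Proof. by apply: exprn_ge0; have /andP[] := half1cos_itv t. Qed.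

Lemma bump_le1 n t : bump n t <= 1.
Proof. by have /andP[? ?] := half1cos_itv t; apply: exprn_ile1. Qed.

Lemma sin_le_id x : 0 <= x -> sin x <= x.
Proof.
move=> x0.
have c : {within `[0, x], continuous sin} by apply: continuous_subspaceT; exact: continuous_sin.
have [y _ e] := MVT_segment x0 (fun y _ => is_derive_sin y) c.
move: e; rewrite sin0 !subr0 => ->.
by rewrite ler_piMl// cos_le1.
Qed.

(** The difference of the two sides vanishes at 0 and has derivative [y * sin y], nonnegative on
    [0, pi]. *)
Lemma mulcos_le_sin x : 0 <= x <= pi -> x * cos x <= sin x.
Proof.
move=> /andP[x0 xpi]; rewrite -subr_ge0.
have d (y : R) : is_derive y (1 : R) (fun y => sin y - y * cos y) (y * sin y).
  have h : is_derive y (1 : R) (sin - id * cos) (cos y - (id y *: - sin y + cos y *: 1)).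
    exact: is_deriveB.
  apply: (is_derive_eq h); rewrite /GRing.scale/=; ring.
have c : {within `[0, x], continuous (fun y => sin y - y * cos y)}.
  by apply: derivable_within_continuous => y _; have [] := d y.
have [y yI] := MVT_segment x0 (fun y _ => d y) c.
rewrite sin0 mul0r !subr0 => ->; move: yI; rewrite in_itv/= => /andP[y0 yx].
by rewrite !mulr_ge0// sin_ge0_pi// y0 (le_trans yx).
Qed.

Lemma ge0_integral_derive (F f : R -> R) (a b : R) : a < b ->
  (forall t, is_derive t (1 : R) F (f t)) -> continuous f ->
  (\int[mu]_(t in `[a, b]) (f t)%:E = (F b - F a)%:E)%E.
Proof.
move=> ab dF cf; have cF : continuous F.
  move=> t; apply: differentiable_continuous; apply/derivable1_diffP.
  by have [] := dF t.
rewrite (continuous_FTC2 ab _ _ _ (F := F)) ?EFinB//.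
- exact: continuous_subspaceT.
- split=> [t _||]; first by have [] := dF t.
  + by apply: cvg_at_right_filter; exact: cF.
  + by apply: cvg_at_left_filter; exact: cF.
- by move=> t _; rewrite derive1E; have [_ ->] := dF t.
Qed.

Lemma freq_half : freq L * (L / 2) = pi.
Proof. by rewrite mulrA freqK// -[pi *+ 2]mulr_natr mulfK. Qed.

Lemma sin_freq_ge0 t : 0 <= t <= L / 2 -> 0 <= sin (freq L * t).
Proof.
move=> /andP[t0 tL]; apply: sin_ge0_pi; rewrite mulr_ge0 ?(ltW freq_gt0)//=.
by rewrite -freq_half ler_wpM2l// ltW// freq_gt0.
Qed.

Lemma freq_reflect t : freq L * (L - t) = pi *+ 2 - freq L * t.
Proof. by rewrite mulrBr freqK. Qed.

Lemma cos_freq_reflect t : cos (freq L * (L - t)) = cos (freq L * t).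
Proof. by rewrite freq_reflect addrC cosD2pi cosN. Qed.

Lemma sin_freq_reflect t : sin (freq L * (L - t)) = - sin (freq L * t).
Proof. by rewrite freq_reflect addrC sinD2pi sinN. Qed.

Lemma dbump_le0 n t : 0 <= t <= L / 2 -> dbump n t <= 0.
Proof.
move=> /sin_freq_ge0 h; rewrite oppr_le0; apply: mulr_ge0.
  by apply: mulr_ge0 => //; exact: (bump_ge0 n.-1 t).
by rewrite mulr_ge0// divr_ge0// ltW// freq_gt0.
Qed.

Lemma dbump_reflect n t : dbump n (L - t) = - dbump n t.
Proof. by rewrite /dbump cos_freq_reflect sin_freq_reflect; ring. Qed.

Lemma bump_reflect n t : bump n (L - t) = bump n t.
Proof. by rewrite /bump cos_freq_reflect. Qed.

(** The bump decreases on the first half-period and increases on the second, so each half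
    contributes its oscillation, at most 1. *)
Lemma integral_norm_dbump n : (\int[mu]_(t in `[0%R, L]) `|dbump n t|%:E <= 2%:E)%E.
Proof.
have L2 : 0 < L / 2 by rewrite divr_gt0.
have L2L : L / 2 < L by rewrite ltr_pdivrMr// mulr_natr mulr2n ltrDl.
have mn : measurable_fun setT (fun t : measurableTypeR R => `|dbump n t|%:E).
  apply/measurable_EFinP; apply: measurableT_comp => //.
  exact: (continuous_measurable_fun (@continuous_dbump n)).
have -> : `[0, L]%classic = `[0, L / 2[ `|` `[L / 2, L] :> set R.
  by rewrite -itv_bndbnd_setU// bnd_simp ltW.
rewrite ge0_integral_setU//=; last first.
- apply/disj_set2P; rewrite -subset0 => t [/=]; rewrite !in_itv/= => /andP[_ +] /andP[+ _].
  by move=> /lt_le_trans /[apply]; rewrite ltxx.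
- exact: measurable_funTS.
rewrite integral_itv_bndo_bndc; last exact: measurable_funTS.
have -> : (2%:E = 1%:E + 1%:E :> \bar R)%E by [].
apply: leeD.
- under eq_integral => t tI.
    rewrite ler0_norm; last first.
      by apply: dbump_le0; move: tI; rewrite inE /= in_itv.
    over.
  have dN t : is_derive t (1 : R) (fun t => - bump n t) (- dbump n t).
    by apply: is_deriveN; exact: is_derive_bump.
  rewrite (ge0_integral_derive L2 dN).
  + rewrite lee_fin opprK addrC; apply: (le_trans _ (bump_le1 n 0)).
    by rewrite gerBl bump_ge0.
  + by move=> t; apply: cvgN; exact: continuous_dbump.
- under eq_integral => t tI.
    rewrite ger0_norm; last first.
      rewrite -oppr_le0 -dbump_reflect; apply: dbump_le0.
      move: tI; rewrite inE /= in_itv/= => /andP[h1 h2].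
      by rewrite subr_ge0 h2/=; move: (t : R) h1 h2 => s; lra.
    over.
  rewrite (ge0_integral_derive L2L (is_derive_bump n)).
  + rewrite lee_fin; apply: (le_trans _ (bump_le1 n L)).
    by rewrite gerBl bump_ge0.
  + exact: continuous_dbump.
Qed.

(** The first moment is thus bounded through the derivative, whose integral is at most 2 for every
    [n]; the factor gained is of the order of the squared width. With [h = freq L * t / 2] the claim
    is [h cos h <= sin h]. *)
Lemma mul_bump_le n t : 0 <= t <= L / 2 ->
  t * bump n.+1 t <= 2 / (n.+1%:R * freq L ^+ 2) * `|dbump n.+1 t|.
Proof.
move=> tI; rewrite ler0_norm ?dbump_le0// opprK /bump /=.
have /andP[t0 tL] := tI; have w0 := freq_gt0.
set c := (1 + cos _) / 2; set s := sin _.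
have key : t * c <= s / freq L.
  rewrite ler_pdivlMr// /c /s.
  pose h := freq L * t / 2.
  have -> : freq L * t = h *+ 2 by rewrite /h -mulr_natr divfK.
  have -> : t = h *+ 2 / freq L.
    by rewrite /h -mulr_natr divfK// mulrAC divff ?mul1r// gt_eqF.
  rewrite sin_mulr2n cos_mulr2n.
  have h00 : 0 <= h by rewrite divr_ge0// mulr_ge0// ltW.
  have hpi : 0 <= h <= pi / 2.
    by rewrite h00/= /h ler_pM2r// -freq_half ler_wpM2l// ltW.
  have c0 : 0 <= cos h.
    apply: cos_ge0_pihalf; have /andP[h0 ->] := hpi; rewrite andbT (le_trans _ h0)//.
    by rewrite oppr_le0 divr_ge0 ?pi_ge0.
  have := mulcos_le_sin (_ : 0 <= h <= pi).
  have /andP[h0 h1] := hpi; rewrite h0/= (le_trans h1); last first.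
    by have := pi_ge0 R; lra.
  move=> /(_ isT) hc.
  have -> : h *+ 2 / freq L * ((1 + (cos h ^+ 2 *+ 2 - 1)) / 2) * freq L =
     2 * (h * cos h) * cos h by field; rewrite gt_eqF.
  have -> : (cos h * sin h) *+ 2 = 2 * sin h * cos h by ring.
  by rewrite ler_wpM2r// ler_wpM2l.
have cn0 : 0 <= c ^+ n by exact: (bump_ge0 n t).
rewrite exprS mulrA.
have -> : 2 / (n.+1%:R * freq L ^+ 2) * (n.+1%:R * c ^+ n * (freq L / 2 * s)) =
   s / freq L * c ^+ n.
  by field; rewrite gt_eqF//= -natr1 addrC ?pnatr_eq0 // gt_eqF.
by rewrite ler_wpM2r.
Qed.

Lemma circ_norm_bump_le n t : t \in `[0, L] ->
  circ_norm L t * bump n.+1 t <= 2 / (n.+1%:R * freq L ^+ 2) * `|dbump n.+1 t|.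
Proof.
rewrite in_itv/= => /andP[t0 tL]; rewrite /circ_norm.
have [h|h] := leP t (L - t).
  by apply: mul_bump_le; rewrite t0/=; lra.
rewrite -bump_reflect -[dbump _ t]opprK -dbump_reflect normrN.
by apply: mul_bump_le; apply/andP; split; lra.
Qed.

Lemma pi_lt4 : pi < 4 :> R.
Proof. by have := @pihalf_lt2 R; rewrite ltr_pdivrMr// -natrM. Qed.

(** The bump is (1 - sin^2 h)^n with [h = pi t / L], and Bernoulli bounds it below by 1 - n h^2;
    since pi < 4, n h^2 is at most (pi / 8)^2 <= 1/4. *)
Lemma bump_ge_half n t rho : 0 < rho -> n%:R <= (L / rho) ^+ 2 ->
  0 <= t <= rho / 8 -> 2^-1 <= bump n t.
Proof.
move=> r0 nL /andP[t0 tr]; rewrite /bump.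
pose h := freq L * t / 2.
have h0 : 0 <= h by rewrite divr_ge0// mulr_ge0// ltW// freq_gt0.
have -> : freq L * t = h *+ 2 by rewrite /h -mulr_natr divfK.
have -> : (1 + cos (h *+ 2)) / 2 = 1 - sin h ^+ 2.
  by rewrite cos_mulr2n cos2sin2; field.
have hs : sin h ^+ 2 <= h ^+ 2.
  rewrite -[leLHS]real_normK ?num_real// -[leRHS]real_normK ?num_real//.
  rewrite lerXn2r ?nnegrE//.
  have [p|p] := leP h pi.
    by rewrite !ger0_norm ?sin_le_id// sin_ge0_pi// h0.
  rewrite (le_trans (sin_max h))// ger0_norm//.
  by have := pi_ge2 R; move: p; lra.
have s1 : 0 <= 1 - sin h ^+ 2 by rewrite -cos2sin2 sqr_ge0.
have := @bernoulli R (- sin h ^+ 2) n; rewrite lerN2.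
have -> : sin h ^+ 2 <= 1 by rewrite -subr_ge0.
move=> /(_ isT); apply: le_trans.
have hE : h = pi * t / L by rewrite /h /freq; field; rewrite gt_eqF.
have nh : n%:R * sin h ^+ 2 <= 4^-1.
  apply: (le_trans (ler_pM _ _ nL hs)) => //; first exact: sqr_ge0.
  have -> : (L / rho) ^+ 2 * h ^+ 2 = (pi * (t / rho)) ^+ 2.
    by rewrite hE; field; rewrite !gt_eqF.
  have -> : 4^-1 = (2^-1) ^+ 2 :> R by field.
  have tr0 : 0 <= t / rho by rewrite divr_ge0// ltW.
  rewrite lerXn2r ?nnegrE//; first by apply: mulr_ge0 => //; exact: pi_ge0.
  have : t / rho <= 8^-1 by rewrite ler_pdivrMr// mulrC.
  move: (t / rho) tr0 => q q0 q8. apply: (le_trans (ler_wpM2r q0 (ltW pi_lt4))).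
  by lra.
by rewrite mulrN; lra.
Qed.

Lemma measurable_bump n : measurable_fun [set: measurableTypeR R] (bump n).
Proof.
apply: (continuous_measurable_fun (f := bump n)) => t.
apply: (@differentiable_continuous _ _ _ t (bump n)).
by apply/derivable1_diffP; have [] := is_derive_bump n t.
Qed.

Lemma measurable_dbump n : measurable_fun [set: measurableTypeR R] (dbump n).
Proof. exact: (continuous_measurable_fun (@continuous_dbump n)). Qed.

Lemma measurable_circ_norm : measurable_fun [set: measurableTypeR R] (circ_norm L).
Proof. by apply: measurable_minr => //; exact: measurable_funB. Qed.

Lemma circ_norm_ge0 t : t \in `[0, L] -> 0 <= circ_norm L t.
Proof. by rewrite in_itv/= le_min => /andP[-> ?]; rewrite subr_ge0. Qed.

Lemma integral_cst_itv (a b c : R) : a <= b ->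
  (\int[mu]_(t in `[a, b]) c%:E = (c * (b - a))%:E)%E.
Proof.
move=> ab; transitivity (c%:E * mu `[a, b])%E.
  exact: (integral_cst mu (measurable_itv `[a, b]) c%:E).
rewrite lebesgue_measure_itv/= lte_fin EFinM; congr (_ * _)%E.
by move: ab; rewrite le_eqVlt => /predU1P[->|->]; rewrite ?ltxx ?subrr.
Qed.

Lemma ge0_integral_fine (h : R -> R) (c : R) : (forall t, 0 <= h t) ->
  (\int[mu]_(t in `[0%R, L]) (h t)%:E <= c%:E)%E ->
  exists2 r, (\int[mu]_(t in `[0%R, L]) (h t)%:E = r%:E)%E & 0 <= r <= c.
Proof.
move=> h0 hc; have i0 : (0 <= \int[mu]_(t in `[0%R, L]) (h t)%:E)%E.
  by apply: integral_ge0 => t _; rewrite lee_fin.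
have fi : (\int[mu]_(t in `[0%R, L]) (h t)%:E)%E \is a fin_num.
  by rewrite ge0_fin_numE// (le_lt_trans hc)// ltry.
exists (fine (\int[mu]_(t in `[0%R, L]) (h t)%:E)%E); first by rewrite fineK.
by rewrite -!lee_fin fineK// i0 hc.
Qed.

(* The width [rho] is realised by [n] of order [(L / rho)^2]; for [rho > L]
   this is [n = 0], the constant bump. *)
Lemma bump_scale rho : 0 < rho -> exists n I A M, [/\ 0 < I,
  (\int[mu]_(t in `[0%R, L]) (bump n t)%:E = I%:E)%E,
  (\int[mu]_(t in `[0%R, L]) `|dbump n t|%:E = A%:E)%E,
  (\int[mu]_(t in `[0%R, L]) (`|circ_norm L t| * bump n t)%:E = M%:E)%E &
  A <= 32 / rho * I /\ M <= 32 * rho * I].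
Proof.
move=> r0; pose n := Num.truncn ((L / rho) ^+ 2).
have /andP[nL Ln] : n%:R <= (L / rho) ^+ 2 < n.+1%:R.
  by apply: truncn_itv; exact: sqr_ge0.
have mb k : measurable_fun setT (fun t : measurableTypeR R => (bump k t)%:E).
  by apply/measurable_EFinP; exact: measurable_bump.
have mcb k : measurable_fun setT
    (fun t : measurableTypeR R => (`|circ_norm L t| * bump k t)%:E).
  apply/measurable_EFinP; apply: measurable_funM; last exact: measurable_bump.
  by apply: measurableT_comp => //; exact: measurable_circ_norm.
have iL : (\int[mu]_(t in `[0%R, L]) (bump n t)%:E <= L%:E)%E.
  have := integral_cst_itv 1 (ltW L_gt0); rewrite subr0 mul1r => <-.
  apply: ge0_le_integral => //.
  - by move=> t _; rewrite lee_fin bump_ge0.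
  - exact: measurable_funTS.
  - by move=> t _; rewrite lee_fin bump_le1.
have [I hI /andP[I0 _]] := ge0_integral_fine (bump_ge0 n) iL.
have [A hA /andP[A0 A2]] := ge0_integral_fine (fun t => normr_ge0 (dbump n t))
  (integral_norm_dbump n).
have cb0 t : 0 <= `|circ_norm L t| * bump n t by rewrite mulr_ge0// bump_ge0.
have w0 := freq_gt0.
have [rL|Lr] := leP rho L; last first.
  have n0 : n = 0%N.
    apply/eqP; rewrite -leqn0 -ltnS -(ltr_nat R); apply: (le_lt_trans nL).
    rewrite exprn_ilt1// ?divr_ge0 ?(ltW L_gt0) ?(ltW r0)//.
    by rewrite ltr_pdivrMr// mul1r.
  have IL : I = L.
    apply: EFin_inj; rewrite -hI n0 /bump.
    under eq_integral do rewrite expr0.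
    by have := integral_cst_itv 1 (ltW L_gt0); rewrite subr0 mul1r.
  have AE : A = 0.
    apply: EFin_inj; rewrite -hA n0 /dbump.
    under eq_integral do rewrite mul0r mul0r oppr0 normr0.
    exact: integral0.
  have mL : (\int[mu]_(t in `[0%R, L]) (`|circ_norm L t| * bump n t)%:E <= (L * L)%:E)%E.
    have := integral_cst_itv L (ltW L_gt0); rewrite subr0 => <-.
    apply: ge0_le_integral => //.
    - by move=> t _; rewrite lee_fin.
    - exact: measurable_funTS.
    - move=> t /= tI; rewrite lee_fin ger0_norm ?circ_norm_ge0//.
      rewrite -[leRHS]mulr1 ler_pM ?circ_norm_ge0 ?bump_ge0 ?bump_le1//.
      by move: tI; rewrite /circ_norm in_itv/= ge_min => /andP[_ ->].
  have [M hM /andP[M0 ML]] := ge0_integral_fine cb0 mL.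
  exists n, I, A, M; split=> //; first by rewrite IL.
  rewrite AE IL; split; first by rewrite mulr_ge0 ?divr_ge0 ?(ltW L_gt0) ?(ltW r0).
  apply: (le_trans ML); rewrite ler_wpM2r ?(ltW L_gt0)//.
  by move: Lr r0; lra.
have q1 : 1 <= L / rho by rewrite ler_pdivlMr// mul1r.
have n1 : 1 <= (L / rho) ^+ 2 by rewrite exprn_ege1.
have [m nm] : exists m, n = m.+1.
  exists n.-1; rewrite prednK// -ltnS -(ltr_nat R); exact: le_lt_trans n1 Ln.
(* The bump is at least 1/2 on [0, rho / 8]. Compared with the bound 2 for the integral of |dbump|,
   this yields the constant 32. *)
have Ir : rho / 16 <= I.
  rewrite -lee_fin -hI.
  have r8 : 0 <= rho / 8 by rewrite divr_ge0// ltW.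
  have r8L : rho / 8 <= L by move: rL r0; lra.
  apply: (@le_trans _ _ (\int[mu]_(t in `[0%R, (rho / 8)%R]) (2^-1)%:E)%E).
    by rewrite integral_cst_itv// lee_fin subr0; move: r0; lra.
  apply: (@le_trans _ _ (\int[mu]_(t in `[0%R, (rho / 8)%R]) (bump n t)%:E)%E).
    apply: ge0_le_integral => //.
    - exact: measurable_funTS.
    - by move=> t /=; rewrite in_itv/= lee_fin => tI; exact: (@bump_ge_half n t rho).
  apply: ge0_subset_integral => //.
  - exact: measurable_funTS.
  - by move=> t _; rewrite lee_fin bump_ge0.
  - by move=> t /=; rewrite !in_itv/= => /andP[-> /le_trans]; apply.
pose c := 2 / (m.+1%:R * freq L ^+ 2).
have c0 : 0 <= c by rewrite divr_ge0// mulr_ge0// sqr_ge0.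
have mM : (\int[mu]_(t in `[0%R, L]) (`|circ_norm L t| * bump n t)%:E <= (c * 2)%:E)%E.
  apply: (@le_trans _ _ (\int[mu]_(t in `[0%R, L]) (c%:E * `|dbump n t|%:E))%E).
    apply: ge0_le_integral => //.
    - by move=> t _; rewrite lee_fin.
    - exact: measurable_funTS.
    - apply: measurable_funTS; apply/measurable_EFinP; apply: measurable_funM => //.
      by apply: measurableT_comp => //; exact: measurable_dbump.
    - move=> t /= tI; rewrite -EFinM lee_fin ger0_norm ?circ_norm_ge0// nm.
      exact: circ_norm_bump_le.
  rewrite ge0_integralZl//.
  - by rewrite (EFinM c 2); apply: lee_wpmul2l; [rewrite lee_fin|exact: integral_norm_dbump].
  - apply: measurable_funTS; apply/measurable_EFinP.
    by apply: measurableT_comp => //; exact: measurable_dbump.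
have [M hM /andP[M0 ML]] := ge0_integral_fine cb0 mM.
exists n, I, A, M; split=> //; first by apply: lt_le_trans Ir; rewrite divr_gt0.
split.
  apply: (le_trans A2); rewrite -mulrA.
  have : 16^-1 <= rho^-1 * I by rewrite ler_pdivlMl.
  by lra.
apply: (le_trans ML).
(* Since [n >= 1], truncation loses at most a factor 2: (L / rho)^2 < n + 1 <= 2 n. The moment, at
   most L^2 / (n pi^2), is then at most 2 rho^2, hence at most 32 rho I. *)
have L2 : L ^+ 2 <= 2 * n%:R * rho ^+ 2.
  have : (L / rho) ^+ 2 <= 2 * n%:R.
    apply: (le_trans (ltW Ln)); rewrite -natr1 mulr_natl mulr2n lerD2l.
    by rewrite ler1n nm.
  by rewrite expr_div_n ler_pdivrMr// exprn_gt0.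
have cE : c * 2 = L ^+ 2 / (m.+1%:R * pi ^+ 2).
  rewrite /c /freq; move: (pi : R) (pi_gt0 R) => p p0.
  by field; rewrite !gt_eqF.
rewrite cE ler_pdivrMr; last by rewrite mulr_gt0// exprn_gt0// pi_gt0.
apply: (le_trans L2); rewrite nm.
have p1 : 1 <= pi ^+ 2 :> R by rewrite exprn_ege1// (le_trans _ (pi_ge2 R))// ler1n.
have rI : rho ^+ 2 <= 16 * rho * I.
  rewrite expr2 mulrAC -[leRHS]mulrC ler_wpM2l ?(ltW r0)//.
  by move: Ir; lra.
have m0 : 0 <= m.+1%:R :> R by [].
have Q0 : 0 <= 32 * rho * I by rewrite !mulr_ge0 ?(ltW r0).
have := ler_wpM2l m0 rI; have := ler_peMr (mulr_ge0 m0 Q0) p1.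
by lra.
Qed.

End bump.

(** * Tensor-product mollifiers *)

Section mollifier.
Context {R : realType} {d : nat}.
Variable L : R.
Hypothesis L_gt0 : 0 < L.
Implicit Types (f u v : 'rV[R]_d -> R) (x y z : 'rV[R]_d).
Local Notation mu := (@lebesgue_measure R).
Local Notation integ := (@cell_integrable R d L).
Local Notation "'\I_' x f" := (\int[@lebesgue_rV R d]_(x in cell L) f)
  (at level 36, x name, f at level 36).

Lemma int_cell_prod (h : 'I_d -> R -> R) (c : 'I_d -> R) :
  (forall i, measurable_fun [set: measurableTypeR R] (h i)) ->
  (forall i t, 0 <= h i t) ->
  (forall i, (\int[mu]_(t in `[0%R, L]) (h i t)%:E = (c i)%:E)%E) ->
  integ (fun x => \prod_i h i (x ord0 i)) /\
  \I_x (\prod_i h i (x ord0 i)) = \prod_i c i.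
Proof.
move=> mh h0 hc; have E := integral_cell_prod mh h0 hc; split.
  apply: (@integ_ge0P _ _ _ _ (\prod_i c i)) => [|x|]; last by rewrite E.
    apply: measurable_funTS; apply: measurable_prod => i _.
    exact: (measurableT_comp (mh i) (measurable_coord i)).
  by rewrite prodr_ge0.
by rewrite /Rintegral E.
Qed.

Lemma partial_line_eq i f g x :
  (forall t : R, f (t *: delta_mx ord0 i + x) = g (t *: delta_mx ord0 i + x)) ->
  partial i f x = partial i g x.
Proof.
move=> fg; rewrite /partial /derive.
under eq_fun => t do rewrite /= fg.
by have := fg 0; rewrite scale0r add0r => ->.
Qed.

Section kernel.
Variables (n : nat) (I A M : R).
Hypothesis I_gt0 : 0 < I.
Hypothesis intI : (\int[mu]_(t in `[0%R, L]) (bump L n t)%:E = I%:E)%E.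
Hypothesis intA : (\int[mu]_(t in `[0%R, L]) `|dbump L n t|%:E = A%:E)%E.
Hypothesis intM : (\int[mu]_(t in `[0%R, L]) (`|circ_norm L t| * bump L n t)%:E = M%:E)%E.

Definition kappa t := bump L n t / I.
Definition dkappa t := dbump L n t / I.
Definition kernel x y := \prod_i kappa (y ord0 i - x ord0 i).
Definition mollify v x := \I_y (v y * kernel x y).

Lemma kappa_ge0 t : 0 <= kappa t.
Proof. by rewrite divr_ge0 ?bump_ge0 ?ltW. Qed.

Lemma kappaN t : kappa (- t) = kappa t.
Proof. by rewrite /kappa /bump mulrN cosN. Qed.

Lemma dkappaN t : dkappa (- t) = - dkappa t.
Proof. by rewrite /dkappa /dbump mulrN cosN sinN; ring. Qed.

Lemma kappaDL t : kappa (t + L) = kappa t.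
Proof. by rewrite /kappa /bump mulrDr freqK// cosD2pi. Qed.

Lemma dkappaDL t : dkappa (t + L) = dkappa t.
Proof. by rewrite /dkappa /dbump mulrDr freqK// cosD2pi sinD2pi. Qed.

Lemma measurable_kappa : measurable_fun [set: measurableTypeR R] kappa.
Proof. by apply: measurable_funM => //; exact: measurable_bump. Qed.

Lemma measurable_dkappa : measurable_fun [set: measurableTypeR R] dkappa.
Proof. by apply: measurable_funM => //; exact: measurable_dbump. Qed.

Lemma integral_scale (h : R -> R) (B : R) : (forall t, 0 <= h t) ->
  measurable_fun [set: measurableTypeR R] h ->
  (\int[mu]_(t in `[0%R, L]) (h t)%:E = B%:E ->
  \int[mu]_(t in `[0%R, L]) (h t / I)%:E = (B / I)%:E)%E.
Proof.
move=> h0 mh hB; under eq_integral do rewrite EFinM.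
rewrite ge0_integralZr//; first by rewrite hB.
- by apply: measurable_funTS; exact/measurable_EFinP.
- by move=> t _; rewrite lee_fin.
- by rewrite lee_fin invr_ge0 ltW.
Qed.

Lemma integral_kappa : (\int[mu]_(t in `[0%R, L]) (kappa t)%:E = 1%:E)%E.
Proof.
rewrite (integral_scale _ _ intI); [|exact: bump_ge0|exact: measurable_bump].
by rewrite divff ?gt_eqF.
Qed.

Lemma integral_dkappa : (\int[mu]_(t in `[0%R, L]) `|dkappa t|%:E = (A / I)%:E)%E.
Proof.
rewrite -(integral_scale _ _ intA)//; last first.
  by apply: measurableT_comp => //; exact: measurable_dbump.
apply: eq_integral => t _; rewrite /dkappa normrM [X in _ * X]ger0_norm//.
by rewrite invr_ge0 ltW.
Qed.

Lemma integral_circ_kappa :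
  (\int[mu]_(t in `[0%R, L]) (`|circ_norm L t| * kappa t)%:E = (M / I)%:E)%E.
Proof.
rewrite -(integral_scale _ _ intM).
- by apply: eq_integral => t _; rewrite /kappa mulrA.
- by move=> t; rewrite mulr_ge0 ?bump_ge0.
- apply: measurable_funM; last exact: measurable_bump.
  by apply: measurableT_comp => //; exact: measurable_circ_norm.
Qed.

Lemma integral_kappa_shift a :
  (\int[mu]_(t in `[0%R, L]) (kappa (t - a))%:E = 1%:E)%E.
Proof.
rewrite (@ge0_integral_periodic _ L (- a) (EFin \o kappa))//= ?integral_kappa//.
- by apply/measurable_EFinP; exact: measurable_kappa.
- by move=> t; rewrite lee_fin kappa_ge0.
- by move=> t; rewrite kappaDL.
Qed.

Lemma integral_dkappa_shift a :
  (\int[mu]_(t in `[0%R, L]) `|dkappa (t - a)|%:E = (A / I)%:E)%E.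
Proof.
rewrite (@ge0_integral_periodic _ L (- a) (fun t => `|dkappa t|%:E))//= ?integral_dkappa//.
- apply/measurable_EFinP; apply: measurableT_comp => //.
  exact: measurable_dkappa.
- by move=> t; rewrite dkappaDL.
Qed.

Lemma separable_kernel : separable L kernel.
Proof.
apply: separable_bigprod => i; rewrite /kappa /bump.
apply: separable_mul; last exact/separable_l/trig_cst.
apply: separable_exp; apply: separable_mul; last exact/separable_l/trig_cst.
apply: separable_add; first exact/separable_l/trig_cst.
under eq_fun do under eq_fun do
  rewrite mulrBr cosB [X in X + _]mulrC [X in _ + X]mulrC.
apply: separable_add; apply: separable_prod;
  [exact: trig_cos|exact: trig_cos|exact: trig_sin|exact: trig_sin].
Qed.

Lemma kernel_sym x y : kernel x y = kernel y x.
Proof. by apply: eq_bigr => i _; rewrite -kappaN opprB. Qed.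

Lemma kernel_ge0 x y : 0 <= kernel x y.
Proof. by apply: prodr_ge0 => i _; exact: kappa_ge0. Qed.

Lemma int_kernel x : \I_y (kernel x y) = 1.
Proof.
have [] := @int_cell_prod (fun i t => kappa (t - x ord0 i)) (fun=> 1).
- by move=> i; apply: (measurableT_comp measurable_kappa); exact: measurable_funB.
- by move=> i t; exact: kappa_ge0.
- by move=> i; exact: integral_kappa_shift.
- by move=> _; rewrite big1.
Qed.

Definition dkernel i x y :=
  - (dkappa (y ord0 i - x ord0 i) * \prod_(j | j != i) kappa (y ord0 j - x ord0 j)).

Lemma partial_kernel i x y : partial i (kernel^~ y) x = dkernel i x y.
Proof.
pose c := \prod_(j | j != i) kappa (y ord0 j - x ord0 j).
rewrite (@partial_line_eq _ _ (fun z => kappa (y ord0 i - z ord0 i) * c)); last first.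
  move=> t; rewrite /kernel (bigD1 i)//=; congr (_ * _).
  apply: eq_bigr => j ji; rewrite !mxE eqxx/= (negbTE ji) mulr0 add0r //.
rewrite (partial_coord (fun s => kappa (y ord0 i - s) * c)) eqxx.
have db : is_derive (x ord0 i) (1 : R) (fun s => kappa (y ord0 i - s) * c)
    (dkernel i x y).
  have h : is_derive (x ord0 i) (1 : R) (bump L n \o (fun s => y ord0 i - s))
     (dbump L n (y ord0 i - x ord0 i) * (0 - 1)).
    have h1 := is_derive_bump L n (y ord0 i - x ord0 i).
    have h2 : is_derive (x ord0 i) (1 : R) (fun s => y ord0 i - s) (0 - 1).
      exact: is_deriveB.
    exact: is_derive1_comp.
  rewrite (_ : (fun _ => _) = (c / I) *: (bump L n \o (fun s => y ord0 i - s))); last first.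
    apply/funext => s; transitivity (c / I * bump L n (y ord0 i - s)) => //.
    by rewrite /kappa; ring.
  apply: (is_derive_eq (is_deriveZ _ h)).
  by rewrite /GRing.scale/= /dkernel -/c /dkappa; ring.
by have [_ ->] := db.
Qed.

Lemma separable_dkernel i : separable L (dkernel i).
Proof.
apply: (eq_separable _ (separable_partial i separable_kernel)) => x y.
exact: partial_kernel.
Qed.

(** The kernel is an even function of [y - x], so derivatives in [x] and in [y] differ by a sign;
    this takes the place of integration by parts. *)
Lemma dkernel_antisym i x y : dkernel i x y = - dkernel i y x.
Proof.
rewrite /dkernel -[y ord0 i - _]opprB dkappaN mulNr; congr (- - (_ * _)).
by apply: eq_bigr => j _; rewrite -kappaN opprB.
Qed.

Lemma int_norm_dkernel i x : \I_y `|dkernel i x y| = A / I.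
Proof.
have [] := @int_cell_prod
  (fun j t => if j == i then `|dkappa (t - x ord0 j)| else kappa (t - x ord0 j))
  (fun j => if j == i then A / I else 1).
- move=> j; have ms : measurable_fun [set: measurableTypeR R]
    (fun t : measurableTypeR R => t - x ord0 j) by exact: measurable_funB.
  case: eqP => _; last exact: (measurableT_comp measurable_kappa ms).
  apply: measurableT_comp => //; exact: (measurableT_comp measurable_dkappa ms).
- by move=> j t; case: eqP => _ //; exact: kappa_ge0.
- move=> j; case: eqP => [_|_]; first exact: integral_dkappa_shift.
  exact: integral_kappa_shift.
- rewrite (bigD1 i)//= eqxx big1 ?mulr1; last by move=> j /negbTE ->.
  move=> _ <-; apply: eq_Rintegral => y _.
  rewrite [RHS](bigD1 i)//= eqxx normrN normrM; congr (_ * _).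
  rewrite ger0_norm; last by apply: prodr_ge0 => j _; exact: kappa_ge0.
  by apply: eq_bigr => j /negbTE ->.
Qed.

Lemma mollify_trig v : integ v -> trig_poly L (mollify v).
Proof. by move=> iv; exact: (separable_integral iv separable_kernel). Qed.

Lemma partial_mollify v i x : integ v ->
  partial i (mollify v) x = \I_y (v y * dkernel i x y).
Proof.
move=> iv; rewrite /mollify (partial_separable_integral i x iv separable_kernel).
by apply: eq_Rintegral => y _; rewrite partial_kernel.
Qed.

Lemma mollify_bound (k : 'rV[R]_d -> 'rV[R]_d -> R) v B x : separable L k ->
  integ v -> (forall y, `|v y| <= B) ->
  `|\I_y (v y * k x y)| <= B * \I_y `|k x y|.
Proof.
move=> sk iv vB; have tk := separable_trig_r x sk.
have ik := integ_trig L_gt0 tk.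
apply: le_trans (int_abs (integ_trigM iv tk)) _.
rewrite -intZ//; last exact: integ_abs.
apply: le_int => [||y _]; first exact/integ_abs/integ_trigM.
  exact/integZ/integ_abs.
by rewrite normrM ler_wpM2r.
Qed.

Lemma mollify_le v B x : integ v -> (forall y, `|v y| <= B) -> `|mollify v x| <= B.
Proof.
move=> iv vB; apply: le_trans (mollify_bound x separable_kernel iv vB) _.
under eq_Rintegral do rewrite ger0_norm ?kernel_ge0//.
by rewrite int_kernel mulr1.
Qed.

Lemma partial_mollify_le v B i x : integ v -> (forall y, `|v y| <= B) ->
  `|partial i (mollify v) x| <= A / I * B.
Proof.
move=> iv vB; rewrite partial_mollify// mulrC -(int_norm_dkernel i x).
exact: mollify_bound (separable_dkernel i) iv vB.
Qed.

Lemma mollify_adjoint u v : integ u -> integ v ->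
  \I_x (u x * mollify v x) = \I_x (v x * mollify u x).
Proof.
move=> iu iv; rewrite /mollify (separable_swap iu iv separable_kernel).
apply: eq_Rintegral => y _; congr (_ * _); apply: eq_Rintegral => x _.
by rewrite kernel_sym.
Qed.

Lemma mollify_unit f : trig_unit L f -> trig_unit L (mollify f).
Proof.
move=> [tf f1]; split; first exact/mollify_trig/integ_trig.
by move=> x; apply: mollify_le => //; exact: integ_trig.
Qed.

(** By duality: against a test [f], antisymmetry of [dkernel] moves derivative and mollification
    onto [f], and [mollify f] is again an admissible test for the variation of [v]. *)
Lemma int_partial_mollify v c i : integ v -> variation_le L i v c ->
  \I_x `|partial i (mollify v) x| <= c.
Proof.
move=> iv vc; have tm : trig_poly L (partial i (mollify v)).
  exact/trig_partial/mollify_trig.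
apply: (trig_density L_gt0 (trig_periodic L_gt0 tm) (integ_trig L_gt0 tm)) => f uf.
have itf := integ_trig L_gt0 uf.1.
under eq_Rintegral do rewrite partial_mollify// mulrC.
rewrite (separable_swap itf iv (separable_dkernel i)).
have -> : \I_y (v y * \I_x (f x * dkernel i x y)) =
    - \I_y (v y * partial i (mollify f) y).
  rewrite -mulN1r -intZ; last first.
    by apply: integ_trigM => //; exact/trig_partial/mollify_trig.
  apply: eq_Rintegral => y _; rewrite partial_mollify// mulN1r -mulrN; congr (_ * _).
  rewrite -mulN1r -intZ; last first.
    by apply: integ_trigM => //; exact: (separable_trig_r _ (separable_dkernel i)).
  by apply: eq_Rintegral => x _; rewrite dkernel_antisym mulN1r mulrN.
have := variation_le_norm iv vc (mollify_unit uf).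
by rewrite -normrN; apply: le_trans; exact: ler_norm.
Qed.

Definition kernel0 z := \prod_i kappa (z ord0 i).

Lemma kernel0E z : kernel0 z = kernel 0 z.
Proof. by apply: eq_bigr => i _; rewrite mxE subr0. Qed.

Lemma kernel0_trig : trig_poly L kernel0.
Proof.
rewrite (_ : kernel0 = kernel 0); first exact: (separable_trig_r _ separable_kernel).
by apply/funext => z; exact: kernel0E.
Qed.

Lemma mollify_shiftE f x : trig_poly L f -> mollify f x = \I_z (kernel0 z * f (x + z)).
Proof.
move=> tf; have tk := separable_trig_r x separable_kernel.
rewrite /mollify -(int_shift L_gt0 x); last 2 first.
- by apply: trig_periodic => //; exact: trig_mul.
- by apply: integ_trig => //; exact: trig_mul.
apply: eq_Rintegral => z _; rewrite mulrC addrC; congr (_ * _).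
by apply: eq_bigr => i _; rewrite !mxE addrAC subrr add0r.
Qed.

(** [circ_norm] is negative outside [0, L]; the absolute value keeps each factor nonnegative
    everywhere, as product integration requires, and changes nothing on the cell. *)
Lemma int_kernel0_circ i : integ (fun z => kernel0 z * `|circ_norm L (z ord0 i)|) /\
  \I_z (kernel0 z * `|circ_norm L (z ord0 i)|) = M / I.
Proof.
have E z : \prod_j (if j == i then `|circ_norm L (z ord0 j)| * kappa (z ord0 j)
    else kappa (z ord0 j)) = kernel0 z * `|circ_norm L (z ord0 i)|.
  rewrite (bigD1 i)//= eqxx /kernel0 [in RHS](bigD1 i)//=.
  rewrite [RHS]mulrC [RHS]mulrA; congr (_ * _).
  by apply: eq_bigr => j /negbTE ->.
have [] := @int_cell_prod
  (fun j t => if j == i then `|circ_norm L t| * kappa t else kappa t)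
  (fun j => if j == i then M / I else 1).
- move=> j; case: eqP => _; last exact: measurable_kappa.
  apply: measurable_funM; last exact: measurable_kappa.
  by apply: measurableT_comp => //; exact: measurable_circ_norm.
- by move=> j t; case: eqP => _; [apply: mulr_ge0 => //|]; exact: kappa_ge0.
- by move=> j; case: eqP => _; [exact: integral_circ_kappa|exact: integral_kappa].
- rewrite (bigD1 i)//= eqxx big1 ?mulr1; last by move=> j /negbTE ->.
  move=> i1 i2; split.
    by apply: eq_integ i1 => x _; rewrite /= E.
  by rewrite -i2; apply: eq_Rintegral => x _; rewrite E.
Qed.

(** Paired with a test [f], the difference is the [kernel0]-average over [z] of [J 0 - J z], where
    [J z] pairs [v] with a translate of [f]. [variation_shift_cell] bounds this by circular
    distances, whose average is the first moment [M / I]. *)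
Lemma int_sub_mollify v (c : 'I_d -> R) : torus_periodic L v -> integ v ->
  (forall i, variation_le L i v (c i)) ->
  \I_x `|v x - mollify v x| <= M / I * \sum_i c i.
Proof.
move=> pv iv vc; have tm := mollify_trig iv.
have im := integ_trig L_gt0 tm.
apply: trig_density => //.
- by move=> i x; rewrite pv (trig_periodic L_gt0 tm).
- exact: integB.
move=> f uf; have [tf f1] := uf; have itf := integ_trig L_gt0 tf.
have ik := integ_trig L_gt0 kernel0_trig.
pose J z := \I_x (v x * f (x + z)).
have sf := separable_addition tf.
have tJ : trig_poly L J.
  exact: (separable_integral (k := fun z x => f (x + z)) iv (separable_sym sf)).
under eq_Rintegral do rewrite mulrBl [mollify v _ * _]mulrC.
rewrite intB; [|exact: integ_trigM..].
rewrite mollify_adjoint//.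
have -> : \I_x (v x * mollify f x) = \I_z (kernel0 z * J z).
  rewrite /J -(separable_swap iv ik sf).
  by apply: eq_Rintegral => x _; rewrite mollify_shiftE.
have -> : \I_x (v x * f x) = \I_z (kernel0 z * \I_x (v x * f x)).
  rewrite intZr//; under [X in _ = X * _]eq_Rintegral do rewrite kernel0E.
  by rewrite int_kernel mul1r.
rewrite -intB; [|apply: integ_trigM => //; exact: trig_cst|exact: integ_trigM].
rewrite mulrC mulr_suml.
have iS : integ (fun z => \sum_i c i * (kernel0 z * `|circ_norm L (z ord0 i)|)).
  by apply: integ_sum => // i; apply: integZ; case: (int_kernel0_circ i).
apply: (@le_trans _ _ (\I_z (\sum_i c i * (kernel0 z * `|circ_norm L (z ord0 i)|)))).
  apply: le_int => [||z cz] //.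
    by apply: integB; apply: integ_trigM => //; exact: trig_cst.
  rewrite -mulrBr; apply: (@le_trans _ _ (kernel0 z * \sum_i c i * circ_norm L (z ord0 i))).
    rewrite ler_wpM2l ?kernel0E ?kernel_ge0//.
    have := variation_shift_cell L_gt0 iv vc uf cz; rewrite distrC.
    by apply: le_trans; exact: ler_norm.
  rewrite mulr_sumr; apply: ler_sum => i _; rewrite mulrCA.
  by rewrite ger0_norm// circ_norm_ge0.
rewrite int_sum//; last by move=> i; apply: integZ; case: (int_kernel0_circ i).
apply: ler_sum => i _; have [i1 i2] := int_kernel0_circ i.
by rewrite intZ// i2.
Qed.

End kernel.
End mollifier.

(** * Truncation *)

Section clamp.
Context {R : realType}.
Implicit Types a b c s t : R.

Definition clamp c s := Num.max (- c) (Num.min c s).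

(** For [0 <= b <= c] this is the sign of [s] times the length of the part of [0, |s|] lying in
    [b, c]. *)
Definition slice b c s := clamp c s - clamp b s.

Lemma clampE c s : 0 <= c ->
  clamp c s = if s < - c then - c else if c < s then c else s.
Proof.
move=> c0; rewrite /clamp /Order.max /Order.min.
by case: (ltP c s) => cs; case: (ltP s (- c)) => sc; case: ltP => h //; lra.
Qed.

Lemma norm_clamp_le c s : 0 <= c -> `|clamp c s| <= c.
Proof.
move=> c0; rewrite clampE// ler_norml.
by case: (ltP s (- c)) => ?; [|case: (ltP c s) => ?]; apply/andP; split; lra.
Qed.

Lemma norm_sub_clamp_le c s : 0 <= c -> `|s - clamp c s| <= if c <= `|s| then `|s| else 0.
Proof.
move=> c0; rewrite clampE//; case: (leP c `|s|) => h; last first.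
  have [h1 h2] : - c < s /\ s < c by move: h; rewrite ltr_norml => /andP[].
  by rewrite ifF ?ifF ?subrr ?normr0//; apply/negbTE; rewrite -leNgt ltW.
case: (ltP s (- c)) => h1.
  by rewrite (ltr0_norm (_ : s < 0)) ?ler0_norm; lra.
case: (ltP c s) => h2; last by rewrite subrr normr0.
by rewrite (gtr0_norm (_ : 0 < s)) ?ger0_norm; lra.
Qed.

Lemma norm_slice_le b c s : 0 <= b <= c -> `|slice b c s| <= c - b.
Proof.
move=> /andP[b0 bc]; have c0 := le_trans b0 bc.
rewrite /slice !clampE// ler_norml.
case: (ltP s (- c)) => ?; [|case: (ltP c s) => ?];
  (case: (ltP s (- b)) => ?; [|case: (ltP b s) => ?]);
  apply/andP; split; lra.
Qed.

Lemma mul_slice_ge0 b c s : 0 <= b <= c -> 0 <= s * slice b c s.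
Proof.
move=> /andP[b0 bc]; have c0 := le_trans b0 bc.
rewrite /slice !clampE//.
case: (ltP s (- c)) => ?; [|case: (ltP c s) => ?];
  (case: (ltP s (- b)) => ?; [|case: (ltP b s) => ?]);
  nra.
Qed.

Lemma clamp_ge c s : 0 <= c -> c <= s -> clamp c s = c.
Proof.
move=> c0 cs; rewrite clampE//.
by case: (ltP s (- c)) => ?; [|case: (ltP c s) => ?]; lra.
Qed.

Lemma clampN c s : 0 <= c -> clamp c (- s) = - clamp c s.
Proof.
move=> c0; rewrite !clampE//.
case: (ltP s (- c)) => ?; [|case: (ltP c s) => ?];
  (case: (ltP (- s) (- c)) => ?; [|case: (ltP c (- s)) => ?]);
  lra.
Qed.

Lemma mul_slice b c s : 0 <= b <= c -> c <= `|s| -> s * slice b c s = `|s| * (c - b).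
Proof.
move=> /andP[b0 bc]; have c0 := le_trans b0 bc.
wlog s0 : s / 0 <= s => [H|].
  have [/H//|/ltW s0] := leP 0 s; have := H (- s); rewrite oppr_ge0 normrN => /(_ s0).
  by rewrite /slice !clampN// -opprD mulrNN.
by rewrite ger0_norm// => cs; rewrite /slice !clamp_ge// (le_trans bc).
Qed.

Lemma clamp_sub_le c s t : 0 <= c -> s <= t -> 0 <= clamp c t - clamp c s <= t - s.
Proof.
move=> c0 st; rewrite !clampE//.
case: (ltP s (- c)) => ?; [|case: (ltP c s) => ?];
  (case: (ltP t (- c)) => ?; [|case: (ltP c t) => ?]);
  apply/andP; split; lra.
Qed.

Lemma slice_le b c s t : 0 <= b <= c -> s <= t -> slice b c s <= slice b c t.
Proof.
move=> /andP[b0 bc] st; have c0 := le_trans b0 bc.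
rewrite /slice !clampE//.
case: (ltP s (- c)) => ?; [|case: (ltP c s) => ?];
  (case: (ltP s (- b)) => ?; [|case: (ltP b s) => ?]);
  (case: (ltP t (- c)) => ?; [|case: (ltP c t) => ?]);
  (case: (ltP t (- b)) => ?; [|case: (ltP b t) => ?]);
  lra.
Qed.

Lemma measurable_clamp c : measurable_fun [set: measurableTypeR R] (clamp c).
Proof. by apply: measurable_maxr => //; exact: measurable_minr. Qed.

Lemma measurable_slice b c : measurable_fun [set: measurableTypeR R] (slice b c).
Proof. by apply: measurable_funB; exact: measurable_clamp. Qed.

(** Slices are monotone, so for [t <= s] the absolute values drop out; the sum telescopes to
    increments of clamps, which are monotone and 1-Lipschitz. *)
Lemma sum_slice_le (r : nat -> R) N s t : (forall n, 0 <= r n <= r n.+1) ->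
  \sum_(n < N) `|slice (r n) (r n.+1) s - slice (r n) (r n.+1) t| <= `|s - t|.
Proof.
move=> r_le; wlog st : s t / t <= s.
  move=> H; have [/H//|/ltW/H] := leP t s.
  by rewrite distrC; under eq_bigr do rewrite distrC.
rewrite (@ger0_norm _ (s - t)) ?subr_ge0//.
under eq_bigr => n _ do rewrite ger0_norm ?subr_ge0 ?slice_le//.
have -> : \sum_(n < N) (slice (r n) (r n.+1) s - slice (r n) (r n.+1) t) =
    (clamp (r N) s - clamp (r N) t) - (clamp (r 0%N) s - clamp (r 0%N) t).
  elim: N => [|N ih]; first by rewrite big_ord0 subrr.
  by rewrite big_ord_recr /= ih /slice; ring.
have r0 n : 0 <= r n by have /andP[] := r_le n.
have /andP[_ h1] := clamp_sub_le (r0 N) st.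
have /andP[h2 _] := clamp_sub_le (r0 0%N) st.
lra.
Qed.

End clamp.

(** * Sharing the total variation among slices *)

Section variation_slices.
Context {R : realType} {d : nat}.
Variable L : R.
Hypothesis L_gt0 : 0 < L.
Implicit Types (f u v : 'rV[R]_d -> R) (x y z : 'rV[R]_d).
Local Notation integ := (@cell_integrable R d L).
Local Notation "'\I_' x f" := (\int[@lebesgue_rV R d]_(x in cell L) f)
  (at level 36, x name, f at level 36).

(** This is the interface of the mollifier at scale [rho]; nothing else about the kernel is used
    afterwards. *)
Lemma mollifier_exists rho : 0 < rho -> exists T : ('rV[R]_d -> R) -> 'rV[R]_d -> R,
  forall v, integ v ->
  [/\ trig_poly L (T v),
      forall B, (forall y, `|v y| <= B) -> (forall x, `|T v x| <= B) /\
        forall i x, `|partial i (T v) x| <= 32 / rho * B,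
      forall i c, variation_le L i v c -> \I_x `|partial i (T v) x| <= c,
      forall c, torus_periodic L v -> (forall i, variation_le L i v (c i)) ->
        \I_x `|v x - T v x| <= 32 * rho * \sum_i c i &
      forall u, integ u -> \I_x (u x * T v x) = \I_x (v x * T u x)].
Proof.
move=> r0; have [n [I [A [M [I0 hI hA hM [AI MI]]]]]] := bump_scale L_gt0 r0.
exists (mollify L n I) => v iv; split.
- exact: mollify_trig.
- move=> B vB; split=> [x|i x]; first exact: mollify_le.
  have B0 : 0 <= B := le_trans (normr_ge0 _) (vB 0).
  apply: le_trans (partial_mollify_le L_gt0 I0 hI hA i x iv vB) _.
  by rewrite ler_wpM2r// ler_pdivrMr.
- by move=> i c; exact: int_partial_mollify.
- move=> c pv vc; apply: le_trans (int_sub_mollify L_gt0 I0 hI hM pv iv vc) _.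
  rewrite ler_wpM2r ?ler_pdivrMr//; apply: sumr_ge0 => i _.
  exact: variation_le_ge0 (vc i).
- by move=> u iu; exact: mollify_adjoint.
Qed.

(** A change of variables lets the translation act on the test, where [variation_shift1] applies;
    [trig_density] then yields the L^1 norm. *)
Lemma int_norm_shift_le i u T (t : R) : torus_periodic L u -> integ u ->
  variation_le L i u T -> \I_x `|u (x + t *: delta_mx ord0 i) - u x| <= T * `|t|.
Proof.
move=> pu iu uT; set e := t *: delta_mx ord0 i.
have ius := integ_shift L_gt0 e pu iu.
apply: trig_density => //.
- by move=> j x; rewrite pu addrAC pu.
- exact: integB.
move=> f uf; have [tf _] := uf.
under eq_Rintegral do rewrite mulrBl.
rewrite intB; [|exact: integ_trigM..].
have -> : \I_x (u (x + e) * f x) = \I_x (u x * f (x - e)).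
  rewrite -[RHS](int_shift L_gt0 e).
  - by under [RHS]eq_Rintegral do rewrite addrK.
  - move=> j x; rewrite pu addrAC; congr (_ * _).
    exact: (trig_periodic L_gt0 tf).
  - by apply: integ_trigM => //; exact: trig_shift.
have := variation_shift1 (- t) iu uT uf; rewrite normrN.
under eq_Rintegral do rewrite scaleNr.
by apply: le_trans; exact: ler_norm.
Qed.

Lemma derive_le_slope (G : R -> R) (l T : R) : is_derive (0 : R) (1 : R) G l ->
  (forall h, 0 < h -> G h - G 0 <= T * h) -> l <= T.
Proof.
move=> [dG <-] GT; have := cvg_dnbhs_at_right dG => H.
apply: (cvgr_to_le H); near=> h.
have h0 : 0 < h by near: h; exact: nbhs_right_gt.
by rewrite /= addr0 /GRing.scale/= mulr1 ler_pdivrMl// mulrC; exact: GT.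
Unshelve. all: by end_near. Qed.

(** The left side is the derivative at 0 of [G]. Changes of variables move the increments onto the
    [v n], where they add up to at most the increment of [u], and [int_norm_shift_le] bounds the
    difference quotients by [T]. Each [v n] has its own test, which is what [variation_split]
    needs. *)
Lemma sum_int_partial_le i u T N (v f : nat -> 'rV[R]_d -> R) :
  torus_periodic L u -> integ u -> variation_le L i u T ->
  (forall n, torus_periodic L (v n)) -> (forall n, integ (v n)) ->
  (forall x y, \sum_(n < N) `|v n x - v n y| <= `|u x - u y|) ->
  (forall n, trig_unit L (f n)) ->
  \sum_(n < N) \I_x (v n x * partial i (f n) x) <= T.
Proof.
move=> pu iu uT pv iv vu uf.
pose G h := \sum_(n < N) \I_x (v n x * f n (x + h *: delta_mx ord0 i)).
apply: (@derive_le_slope G).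
  rewrite /G.
  have dG n : is_derive (0 : R) (1 : R)
      (fun h => \I_x (v n x * f n (x + h *: delta_mx ord0 i)))
      (\I_x (v n x * partial i (f n) x)).
    have := is_derive_shift_integral i 0 0 (iv n) (uf n).1.
    under eq_fun do under eq_Rintegral do rewrite addr0.
    move=> /is_derive_eq; apply; apply: eq_Rintegral => x _.
    by rewrite addr0 scale0r addr0.
  pose F (n : 'I_N) (h : R) : R := \I_x (v n x * f n (x + h *: delta_mx ord0 i)).
  have := @is_derive_sum _ _ _ N F 0 1 _ (fun n => dG n).
  rewrite (_ : \sum_(n < N) F n = G)//.
  by apply/funext => h; rewrite fct_sumE.
move=> h h0; rewrite /G -sumrB.
under eq_bigr => n _.
  under [X in _ - X]eq_Rintegral do rewrite scale0r addr0.
  have -> : \I_x (v n x * f n (x + h *: delta_mx ord0 i)) =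
      \I_x (v n (x + (- h) *: delta_mx ord0 i) * f n x).
    rewrite -[LHS](int_shift L_gt0 ((- h) *: delta_mx ord0 i)).
    - by apply: eq_Rintegral => x _; congr (_ * f n _); rewrite scaleNr subrK.
    - move=> j x; rewrite pv addrAC; congr (_ * _).
      exact: (trig_periodic L_gt0 (uf n).1).
    - by apply: integ_trigM => //; apply: trig_shift; case: (uf n).
  rewrite -intB; last 2 first.
  - by apply: integ_trigM; [exact: integ_shift|case: (uf n)].
  - by apply: integ_trigM => //; case: (uf n).
  over.
rewrite -int_sum//; last first.
  move=> n; apply: integB; apply: integ_trigM => //; try by case: (uf n).
  exact: integ_shift.
have := int_norm_shift_le (- h) pu iu uT; rewrite normrN (gtr0_norm h0).
apply: le_trans; apply: le_int => [||x _].
- apply: integ_sum => // n; apply: integB; apply: integ_trigM => //; try by case: (uf n).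
  exact: integ_shift.
- by apply/integ_abs/integB => //; exact: integ_shift.
apply: le_trans (vu _ _); apply: ler_sum => n _.
rewrite -mulrBl; apply: (le_trans (ler_norm _)); rewrite normrM.
by rewrite ler_piMr//; case: (uf n).
Qed.

(** [a n] is the supremum of the pairings of [v n]. As the tests are independent of each other, the
    sum of suprema is approached by nearly optimal tests, to which [sum_int_partial_le] applies. *)
Lemma variation_split i u T N (v : nat -> 'rV[R]_d -> R) :
  torus_periodic L u -> integ u -> variation_le L i u T ->
  (forall n, torus_periodic L (v n)) -> (forall n, integ (v n)) ->
  (forall x y, \sum_(n < N) `|v n x - v n y| <= `|u x - u y|) ->
  exists a : nat -> R, (forall n, (n < N)%N -> variation_le L i (v n) (a n)) /\
    \sum_(n < N) a n <= T.
Proof.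
move=> pu iu uT pv iv vu.
pose S n := [set \I_x (v n x * partial i f x) | f in trig_unit L].
have S0 n : S n !=set0 by exists (\I_x (v n x * partial i (fun=> 0) x)); exists (fun=> 0) => //; exact: trig_unit0.
(* The zero test at every other index isolates a single slice, so that its supremum is finite. *)
have ST n : (n < N)%N -> ubound (S n) T.
  move=> nN _ [f uf <-].
  have := @sum_int_partial_le i u T N v (fun m => if m == n then f else fun=> 0)
    pu iu uT pv iv vu.
  rewrite (bigD1 (Ordinal nN))//= eqxx big1 ?addr0; last first.
    move=> m mn; rewrite (_ : (val m == n) = false).
      under eq_Rintegral do rewrite partial_cst mulr0.
      by rewrite Rintegral_cst// mul0r.
    by apply/negbTE; apply: contra mn => /eqP mn; apply/eqP/val_inj.
  by apply => m; case: eqP => // _; exact: trig_unit0.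
exists (fun n => sup (S n)); split=> [n nN f uf|].
  by apply: ub_le_sup; [exists T; exact: ST|exists f].
apply/ler_addgt0Pr => e e0.
have eN : 0 < e / N.+1%:R by rewrite divr_gt0.
have /choice[f hf] : forall n, exists f, trig_unit L f /\
    ((n < N)%N -> sup (S n) - e / N.+1%:R < \I_x (v n x * partial i f x)).
  move=> n; have [nN|_] := boolP (n < N)%N; last by exists (fun=> 0); split => //; exact: trig_unit0.
  have [_ [f uf <-] hlt] := sup_adherent eN (conj (S0 n) (ex_intro _ T (ST n nN))).
  by exists f.
have := @sum_int_partial_le i u T N v f pu iu uT pv iv vu (fun n => (hf n).1).
rewrite -(lerD2r e); apply: le_trans.
apply: (@le_trans _ _ (\sum_(n < N) (\I_x (v n x * partial i (f n) x) + e / N.+1%:R))).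
  by apply: ler_sum => n _; rewrite -lerBlDr ltW// (hf n).2.
rewrite big_split/= lerD2l sumr_const card_ord -[_ *+ N]mulr_natr mulrAC ler_pdivrMr//.
by rewrite ler_wpM2l ?ler_nat// ltW.
Qed.

End variation_slices.

(** * The main estimate *)

Section dyadic_sum.
Context {R : realType}.
Implicit Types (r b : nat -> R).

(** The bounds [K r_n^2] grow by a factor 4, so each partial sum is at most a third of the next
    bound. Adding [b n] therefore changes the square by b_n (2 S + b_n), at most 2 K r_n^2 |b_n|,
    and no cross terms survive. *)
Lemma sqr_dyadic_sum_le r b (K : R) N : 0 <= K -> (forall n, r n.+1 = 2 * r n) ->
  (forall n, `|b n| <= K * r n ^+ 2) ->
  (\sum_(n < N) b n) ^+ 2 <= 2 * K * \sum_(n < N) r n ^+ 2 * `|b n|.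
Proof.
move=> K0 r2 bK.
have S_le M : `|\sum_(n < M) b n| <= K * r M ^+ 2 / 3.
  elim: M => [|M ih]; first by rewrite big_ord0 normr0 divr_ge0// mulr_ge0// sqr_ge0.
  rewrite big_ord_recr/=; apply: (le_trans (ler_normD _ _)).
  apply: (le_trans (lerD ih (bK M))); rewrite r2 exprMn; lra.
elim: N => [|N ih]; first by rewrite !big_ord0 expr0n/= mulr0.
rewrite !big_ord_recr/= mulrDr.
set S := \sum_(n < N) b n in ih *; set Q := \sum_(n < N) _ in ih *.
have hS := S_le N; rewrite -/S in hS.
have -> : (S + b N) ^+ 2 = S ^+ 2 + b N * (2 * S + b N) by ring.
apply: lerD => //; apply: (le_trans (ler_norm _)); rewrite normrM.
have h : `|2 * S + b N| <= 2 * K * r N ^+ 2.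
  apply: (le_trans (ler_normD _ _)); rewrite normrM ger0_norm//.
  have := bK N; have := mulr_ge0 K0 (sqr_ge0 (r N)); lra.
by rewrite mulrC [leRHS]mulrA ler_wpM2r.
Qed.

End dyadic_sum.

Section main_estimate.
Context {R : realType} {d : nat}.
Variable L : R.
Hypothesis L_gt0 : 0 < L.
Implicit Types (f u v : 'rV[R]_d -> R) (x y z : 'rV[R]_d).
Local Notation integ := (@cell_integrable R d L).
Local Notation "'\I_' x f" := (\int[@lebesgue_rV R d]_(x in cell L) f)
  (at level 36, x name, f at level 36).

Lemma flux_pairing_le u j f (s : R) : flux L u j ->
  integ (fun x => dotv (j x) (j x)) -> trig_poly L f -> 0 < s ->
  \I_x (u x * f x) <=
  \I_x (dotv (j x) (j x)) / (2 * s) + s / 2 * \I_x (\sum_i partial i f x ^+ 2).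
Proof.
move=> [pj ij ju] iJ tf s0.
have tp i : trig_poly L (partial i f) by exact: trig_partial.
have iP : integ (fun x => \sum_i partial i f x ^+ 2).
  by apply: integ_sum => // i; apply: integ_trig => //; exact: trig_exp.
have idot : integ (fun x => dotv (j x) (grad f x)).
  apply: integ_sum => // i; under eq_fun do rewrite [grad _ _ _ _]mxE.
  exact: (integ_trigM (ij i) (tp i)).
have E := ju f (conj (trig_periodic L_gt0 tf) (trig_smooth tf)).
have -> : \I_x (u x * f x) = - \I_x (dotv (j x) (grad f x)) by rewrite E opprK.
apply: (le_trans (ler_norm _)); rewrite normrN.
apply: (le_trans (int_abs idot)).
rewrite -intZr// -intZ// -intD; [|by under eq_fun do rewrite mulrC; exact: integZ|exact: integZ].
apply: le_int => [||x _]; first exact: integ_abs.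
  apply: integD; last exact: integZ.
  by under eq_fun do rewrite mulrC; exact: integZ.
rewrite /dotv; apply: (le_trans (ler_norm_sum _ _ _)).
rewrite mulr_suml mulr_sumr -big_split/=; apply: ler_sum => i _.
rewrite [grad _ _ _ _]mxE; set p := partial i f x; set q := j x ord0 i.
rewrite -subr_ge0.
have -> : q * q / (2 * s) + s / 2 * p ^+ 2 - `|q * p| =
    (`|q| - s * `|p|) ^+ 2 / (2 * s).
  have -> : q * q = `|q| ^+ 2 by rewrite -expr2 real_normK ?num_real.
  have -> : p ^+ 2 = `|p| ^+ 2 by rewrite real_normK ?num_real.
  by rewrite normrM; field; rewrite gt_eqF.
by rewrite divr_ge0 ?sqr_ge0// mulr_ge0// ltW.
Qed.

Section levels.
Variables (u : 'rV[R]_d -> R) (T : R).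
Hypothesis pu : torus_periodic L u.
Hypothesis iu : integ u.
Hypothesis uT : forall i, variation_le L i u T.
Variables (lam eta : R).
Hypotheses (lam_gt0 : 0 < lam) (eta_gt0 : 0 < eta).

(** [eta] sets the bottom of the dyadic ladder; it is finally sent to 0, so that the slices reach
    down to every positive height. *)
Definition level n : R := eta * 2 ^+ n.
Definition usl n x := slice (level n ^+ 3) (level n.+1 ^+ 3) (u x).

Lemma level_gt0 n : 0 < level n.
Proof. by rewrite mulr_gt0// exprn_gt0. Qed.

Lemma levelS n : level n.+1 = 2 * level n.
Proof. by rewrite /level exprS mulrCA. Qed.

Lemma level3_le n : 0 <= level n ^+ 3 <= level n.+1 ^+ 3.
Proof.
have := exprn_ge0 3 (ltW (level_gt0 n)) => h; rewrite h/= levelS [(2 * _) ^+ 3]exprMn.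
by lra.
Qed.

Lemma usl_periodic n : torus_periodic L (usl n).
Proof. by move=> i x; rewrite /usl pu. Qed.

Lemma usl_bound n x : `|usl n x| <= 7 * level n ^+ 3.
Proof.
apply: le_trans (norm_slice_le _ (level3_le n)) _.
by rewrite levelS [(2 * _) ^+ 3]exprMn; lra.
Qed.

Lemma usl_bmeas n : cell_bounded_measurable L (usl n).
Proof.
split; last by exists (7 * level n ^+ 3); exact: usl_bound.
apply: (measurableT_comp (measurable_slice _ _)).
exact: integ_measurable.
Qed.

Lemma integ_usl n : integ (usl n).
Proof. by apply: integ_bounded => //; exact: usl_bmeas. Qed.

Lemma usl_lip N x y : \sum_(n < N) `|usl n x - usl n y| <= `|u x - u y|.
Proof. exact: (sum_slice_le N (u x) (u y) level3_le). Qed.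

Definition pairing n := level n ^- 2 * \I_x (u x * usl n x).

Lemma integ_pairing n : integ (fun x => u x * usl n x).
Proof. by apply: integM => //; exact: usl_bmeas. Qed.

Lemma mul_usl_ge0 n x : 0 <= u x * usl n x.
Proof. exact: mul_slice_ge0 (level3_le n). Qed.

Lemma pairing_ge0 n : 0 <= pairing n.
Proof.
by rewrite mulr_ge0 ?invr_ge0 ?sqr_ge0//; apply: int_ge0 => x _; exact: mul_usl_ge0.
Qed.

(* For [|u| >= level (n + 3) ^ 3] the slice [n + 2] of [u] is full, and then
   [u * usl (n + 2)] is large enough to absorb the excess of [u]. *)
Lemma excess_le n x : 14 * level n ^+ 3 * `|u x - clamp (level n.+3 ^+ 3) (u x)| <=
  level n ^+ 2 * (2^-1 * (level n.+2 ^- 2 * (u x * usl n.+2 x))).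
Proof.
have l0 := level_gt0 n; have c0 : 0 <= level n.+3 ^+ 3 by have /andP[] := level3_le n.+3.
have X0 := mul_usl_ge0 n.+2 x.
have := norm_sub_clamp_le (u x) c0; case: ifP => h hle; last first.
  have -> : `|u x - clamp (level n.+3 ^+ 3) (u x)| = 0.
    by apply/eqP; rewrite eq_le hle normr_ge0.
  rewrite mulr0; apply: mulr_ge0; first exact: sqr_ge0.
  by apply: mulr_ge0 => //; apply: mulr_ge0 => //; rewrite invr_ge0 sqr_ge0.
rewrite /usl (mul_slice (level3_le n.+2) h).
rewrite !levelS.
(* Here (8^3 - 4^3) / 4^2 = 28 is twice 14, which allows the factor 1/2. Index [n + 1] would give
   (4^3 - 2^3) / 2^2 = 14, with nothing to spare. *)
have -> : level n ^+ 2 * (2^-1 * ((2 * (2 * level n)) ^- 2 * (`|u x| *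
    ((2 * (2 * (2 * level n))) ^+ 3 - (2 * (2 * level n)) ^+ 3)))) =
    14 * level n ^+ 3 * `|u x| by field; rewrite gt_eqF.
by rewrite -levelS -levelS -levelS ler_wpM2l// mulr_ge0// exprn_ge0// ltW.
Qed.

Lemma slice_error_absorb n g (A : R) : trig_poly L g ->
  (forall x, `|g x| <= 7 * level n ^+ 3) -> \I_x `|usl n x - g x| <= 32 * (lam / level n) * A ->
  level n ^- 2 * \I_x (u x * (usl n x - g x)) <= 128 * 128 * lam * A + 2^-1 * pairing n.+2.
Proof.
move=> tg gB hA; have l0 := level_gt0 n.
have ig : integ (fun x => usl n x - g x) by apply: integB; [exact: integ_usl|exact: integ_trig].
have iug : integ (fun x => u x * (usl n x - g x)).
  under eq_fun do rewrite mulrBr; apply: integB; first exact: integ_pairing.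
  exact: integ_trigM.
have l3 : 0 <= level n.+3 ^+ 3 by have /andP[] := level3_le n.+3.
apply: (@le_trans _ _ (level n ^- 2 * \I_x (level n.+3 ^+ 3 * `|usl n x - g x| +
    level n ^+ 2 * (2^-1 * (level n.+2 ^- 2 * (u x * usl n.+2 x)))))).
  rewrite ler_wpM2l ?invr_ge0 ?sqr_ge0//; apply: le_int => // [|x _].
    by apply: integD; [exact/integZ/integ_abs|exact/integZ/integZ/integZ/integ_pairing].
  apply: le_trans (lerD (lexx _) (excess_le n x)).
  (* The clamped part of [u] is bounded and meets the L^1 error; the excess meets the sup bound of
     [usl n - g], with 14 = 7 + 7. *)
  set w := clamp _ _; rewrite -[X in X * _](subrK w) mulrDl addrC; apply: lerD.
    apply: (le_trans (ler_norm _)); rewrite normrM ler_wpM2r//.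
    exact: norm_clamp_le.
  apply: (le_trans (ler_norm _)); rewrite normrM mulrC ler_wpM2r//.
  apply: (le_trans (ler_normB _ _)); apply: (le_trans (lerD (usl_bound n x) (gB x))).
  by lra.
rewrite intD; [|exact/integZ/integ_abs|exact/integZ/integZ/integZ/integ_pairing].
have iag := integ_abs ig.
rewrite !intZ//; try by do ?apply: integZ; exact: integ_pairing.
rewrite mulrDr; apply: lerD; last first.
  by rewrite mulKf// expf_neq0// gt_eqF.
have c0 : 0 <= level n ^- 2 * level n.+3 ^+ 3 by rewrite mulr_ge0// invr_ge0 sqr_ge0.
rewrite mulrA; apply: (le_trans (ler_wpM2l c0 hA)).
(* The powers of [level n] cancel, leaving 8^3 times 32, that is 128^2. *)
by rewrite !levelS le_eqVlt; apply/orP; left; apply/eqP; field; rewrite gt_eqF.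
Qed.

(** Pairing the bounded slice with [u - gu] calls for no slice above it, but costs the full
    variation of [u] instead of that of a slice: affordable for a bounded number of indices only. *)
Lemma slice_error_top n (g gu : 'rV[R]_d -> R) : trig_poly L g -> trig_poly L gu ->
  \I_x (u x * g x) = \I_x (usl n x * gu x) ->
  \I_x `|u x - gu x| <= 32 * (lam / level n) * (d%:R * T) ->
  level n ^- 2 * \I_x (u x * (usl n x - g x)) <= 224 * lam * (d%:R * T).
Proof.
move=> tg tgu adj hu; have l0 := level_gt0 n.
have iuv := integ_pairing n.
have -> : \I_x (u x * (usl n x - g x)) = \I_x ((u x - gu x) * usl n x).
  under eq_Rintegral do rewrite mulrBr.
  have iug := integ_trigM iu tg; have igu := integ_trigM (integ_usl n) tgu.
  rewrite intB// adj -intB//.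
  by apply: eq_Rintegral => x _; ring.
have iw : integ (fun x => u x - gu x) by apply: integB => //; exact: integ_trig.
have iwv : integ (fun x => (u x - gu x) * usl n x) by apply: integM => //; exact: usl_bmeas.
apply: (@le_trans _ _ (level n ^- 2 * (7 * level n ^+ 3 * \I_x `|u x - gu x|))).
  rewrite ler_wpM2l ?invr_ge0 ?sqr_ge0// -intZ; last exact: integ_abs.
  apply: le_int => // [|x _]; first exact/integZ/integ_abs.
  apply: (le_trans (ler_norm _)); rewrite normrM mulrC ler_wpM2r//.
  exact: usl_bound.
have c0 : 0 <= level n ^- 2 * (7 * level n ^+ 3).
  by rewrite mulr_ge0 ?invr_ge0 ?sqr_ge0// mulr_ge0// exprn_ge0// ltW.
rewrite [leLHS]mulrA; apply: (le_trans (ler_wpM2l c0 hu)).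
by rewrite le_eqVlt; apply/orP; left; apply/eqP; field; rewrite gt_eqF.
Qed.

End levels.
End main_estimate.

(** * Summation over the slices *)

Section slices_estimate.
Context {R : realType} {d : nat}.
Variable L : R.
Hypothesis L_gt0 : 0 < L.
Implicit Types (f u v : 'rV[R]_d -> R) (x y z : 'rV[R]_d).
Local Notation integ := (@cell_integrable R d L).
Local Notation "'\I_' x f" := (\int[@lebesgue_rV R d]_(x in cell L) f)
  (at level 36, x name, f at level 36).

Lemma sum_pairing_le u T lam eta N j : torus_periodic L u -> integ u ->
  (forall i, variation_le L i u T) -> 0 < lam -> 0 < eta ->
  flux L u j -> integ (fun x => dotv (j x) (j x)) ->
  \sum_(n < N.+2) pairing L u eta n <=
  \I_x (dotv (j x) (j x)) / lam ^+ 2 + 200 * 200 * d%:R * lam * T.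
Proof.
move=> pu iu uT lam0 eta0 fj iJ.
set J := \I_x (dotv _ _); pose lv := level eta; pose v := usl u eta.
have lv0 n : 0 < lv n by exact: level_gt0.
have lvn0 n : lv n != 0 by rewrite gt_eqF.
have iv n : integ (v n) by exact: integ_usl.
have pv n : torus_periodic L (v n) by exact: usl_periodic.
have vB n x : `|v n x| <= 7 * lv n ^+ 3 by exact: usl_bound.
have /choice[Mol hMol] := fun n => @mollifier_exists R d L L_gt0 _ (divr_gt0 lam0 (lv0 n)).
pose g n := Mol n (v n).
have tg n : trig_poly L (g n) by have [] := hMol n _ (iv n).
have gB n x : `|g n x| <= 7 * lv n ^+ 3.
  by have [_ /(_ _ (vB n))[h _] _ _ _] := hMol n _ (iv n); exact: h.
have dgB n i x : `|partial i (g n) x| <= 32 / (lam / lv n) * (7 * lv n ^+ 3).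
  by have [_ /(_ _ (vB n))[_ h] _ _ _] := hMol n _ (iv n); exact: h.
have T0 (i : 'I_d) : 0 <= T := variation_le_ge0 (uT i).
have dT0 : 0 <= d%:R * T.
  (* Seeing [0 <= T] takes a coordinate index; without one, [d = 0] and the product vanishes. *)
  have [d0|i0] := pickP 'I_d; last first.
    have := i0; case: (d) => [|k] h; first by rewrite mul0r.
    by have := h ord0.
  by rewrite mulr_ge0// (T0 d0).
have vlip x y : \sum_(n < N.+2) `|v n x - v n y| <= `|u x - u y|.
  exact: usl_lip.
have /choice[a ha] := fun i =>
  @variation_split R d L L_gt0 i u T N.+2 v pu iu (uT i) pv iv vlip.
have aT : \sum_(n < N.+2) \sum_i a i n <= d%:R * T.
  rewrite exchange_big/=; apply: (@le_trans _ _ (\sum_(i < d) T)).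
    by apply: ler_sum => i _; case: (ha i).
  by rewrite sumr_const card_ord mulr_natl.
have va n : (n < N.+2)%N -> forall i, variation_le L i (v n) (a i n).
  by move=> nN i; case: (ha i) => h _; exact: h.
have a0 n : (n < N.+2)%N -> 0 <= \sum_i a i n.
  by move=> nN; apply: sumr_ge0 => i _; exact: variation_le_ge0 (va n nN i).
pose phi x := \sum_(n < N.+2) lv n ^- 2 * g n x.
have tphi : trig_poly L phi.
  by apply: trig_sum => n; apply: trig_mul => //; exact: trig_cst.
have dphi i x : partial i phi x = \sum_(n < N.+2) lv n ^- 2 * partial i (g n) x.
  have dfg (n : 'I_N.+2) : differentiable (fun x => lv n ^- 2 * g n x) x.
    by apply: (@trig_differentiable _ _ L); apply: trig_mul => //; exact: trig_cst.
  rewrite partial_sum//; apply: eq_bigr => n _.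
  rewrite partialM ?partial_cst ?mulr0 ?addr0//.
  exact: (trig_differentiable x (tg n)).
have K0 k : 0 <= k%:R / lam := divr_ge0 (ler0n _ k) (ltW lam0).
have idg n i : integ (fun x => `|partial i (g n) x|).
  by apply: integ_abs; apply: integ_trig => //; exact: trig_partial.
(* The dyadic bound holds with 224 = 32 times 7, from [dgB]. Its weight [lv n ^+ 2] cancels the
   weight of [phi], leaving the unweighted sum whose integral the variations control. *)
have sq i x : partial i phi x ^+ 2 <= 448 / lam * \sum_(n < N.+2) `|partial i (g n) x|.
  rewrite dphi.
  have h := @sqr_dyadic_sum_le R lv (fun n => lv n ^- 2 * partial i (g n) x)
    (224 / lam) N.+2 (K0 _) (levelS eta).
  apply: (le_trans (h _)).
    move=> n; rewrite normrM ger0_norm ?invr_ge0 ?sqr_ge0//.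
    have l2 : 0 <= lv n ^- 2 by rewrite invr_ge0 sqr_ge0.
    apply: (le_trans (ler_wpM2l l2 (dgB n i x))).
    by rewrite le_eqVlt; apply/orP; left; apply/eqP; field; rewrite lvn0 gt_eqF.
  rewrite [2 * _](_ : _ = 448 / lam); last by field; rewrite gt_eqF.
  apply: (ler_wpM2l (K0 _)); apply: ler_sum => n _.
  rewrite normrM ger0_norm ?invr_ge0 ?sqr_ge0//.
  by rewrite mulVKf// expf_neq0.
have grad_le : \I_x (\sum_i partial i phi x ^+ 2) <= 448 / lam * (d%:R * T).
  have isq i : integ (fun x => partial i phi x ^+ 2).
    by apply: integ_trig => //; apply: trig_exp; exact: trig_partial.
  rewrite int_sum//.
  apply: (@le_trans _ _ (\sum_i 448 / lam * \sum_(n < N.+2) a i n)); last first.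
    by rewrite -mulr_sumr; apply: (ler_wpM2l (K0 _)); rewrite exchange_big.
  apply: ler_sum => i _.
  apply: (@le_trans _ _ (\I_x (448 / lam * \sum_(n < N.+2) `|partial i (g n) x|))).
    by apply: le_int => //; apply: integZ; exact: integ_sum.
  rewrite intZ; last exact: integ_sum.
  apply: (ler_wpM2l (K0 _)); rewrite int_sum//.
  apply: ler_sum => n _; have [_ _ h _ _] := hMol n _ (iv n).
  by apply: h; exact: va.
have lam20 : 0 < lam ^+ 2 by rewrite exprn_gt0.
(* The parameter [lam ^+ 2] turns the gradient bound, of order 1 / lam, into order lam, like the
   mollification errors. *)
have uphi := flux_pairing_le L_gt0 fj iJ tphi lam20; rewrite -/J in uphi.
have iug n : integ (fun x => u x * g n x) by exact: integ_trigM.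
have uphiE : \I_x (u x * phi x) = \sum_(n < N.+2) lv n ^- 2 * \I_x (u x * g n x).
  transitivity (\I_x (\sum_(n < N.+2) lv n ^- 2 * (u x * g n x))).
    by apply: eq_Rintegral => x _; rewrite mulr_sumr; apply: eq_bigr => n _; rewrite mulrCA.
  rewrite int_sum//; last by move=> n; exact: integZ.
  by apply: eq_bigr => n _; rewrite intZ.
pose err n := lv n ^- 2 * \I_x (u x * (v n x - g n x)).
have pE n : pairing L u eta n = lv n ^- 2 * \I_x (u x * g n x) + err n.
  rewrite /err; under [X in _ + _ * X]eq_Rintegral do rewrite mulrBr.
  rewrite intB//; last exact: integ_pairing.
  by rewrite -mulrDr addrC subrK.
have subg n : (n < N.+2)%N -> \I_x `|v n x - g n x| <= 32 * (lam / lv n) * \sum_i a i n.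
  by move=> nN; have [_ _ _ h _] := hMol n _ (iv n); apply: h => // i; exact: va.
have err_absorb n : (n < N.+2)%N ->
    err n <= 128 * 128 * lam * (\sum_i a i n) + 2^-1 * pairing L u eta n.+2.
  move=> nN; apply: slice_error_absorb => //; exact: subg.
have err_top n : err n <= 224 * lam * (d%:R * T).
  have [tgu _ _ h adj] := hMol n _ iu.
  apply: (slice_error_top L_gt0 iu eta0 (tg n) tgu).
    by have [_ _ _ _ adj'] := hMol n _ (iv n); rewrite adj'.
  apply: (le_trans (h (fun=> T) pu uT)).
  by rewrite sumr_const card_ord -[T *+ d]mulr_natl.
have P0 n : 0 <= pairing L u eta n by exact: pairing_ge0.
have sumE : \sum_(n < N.+2) pairing L u eta n =
    \I_x (u x * phi x) + \sum_(n < N.+2) err n.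
  by rewrite uphiE -big_split/=; apply: eq_bigr => n _.
have err_le : \sum_(n < N.+2) err n <= 128 * 128 * lam * (d%:R * T) +
    2^-1 * (\sum_(n < N.+2) pairing L u eta n) + 448 * lam * (d%:R * T).
  (* With the two top indices split off, the absorbing pairings of index [n + 2] all belong to the
     sum being bounded. *)
  rewrite 2!big_ord_recr/=.
  have h1 : \sum_(n < N) err n <= 128 * 128 * lam * (\sum_(n < N) \sum_i a i n) +
      2^-1 * \sum_(n < N) pairing L u eta n.+2.
    rewrite !mulr_sumr -big_split/=; apply: ler_sum => n _.
    by apply: err_absorb; rewrite (ltn_trans (ltn_ord n))// ltnS leqnSn.
  have h2 : \sum_(n < N) \sum_i a i n <= d%:R * T.
    apply: le_trans aT; rewrite 2!big_ord_recr/= -addrA lerDl addr_ge0//; exact: a0.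
  have h3 : \sum_(n < N) pairing L u eta n.+2 <= \sum_(n < N.+2) pairing L u eta n.
    by rewrite 2!big_ord_recl/= addrA lerDr addr_ge0.
  have h4 := ler_wpM2l (ltW lam0) h2.
  move: h1 h3 h4 (err_top N) (err_top N.+1); clear; lra.
have E : J / (2 * lam ^+ 2) = 2^-1 * (J / lam ^+ 2) by field; rewrite gt_eqF.
have F : lam ^+ 2 / 2 * (448 / lam * (d%:R * T)) = 224 * lam * (d%:R * T).
  by field; rewrite gt_eqF.
have := ler_wpM2l (_ : 0 <= lam ^+ 2 / 2) grad_le; rewrite divr_ge0 ?(ltW lam20)// => /(_ isT).
(* Half of the sum of pairings moves to the left; the constant 224 + 128^2 + 448 = 17056 then
   doubles and stays below 200^2. *)
rewrite F => G; move: uphi err_le sumE G (mulr_ge0 (ltW lam0) dT0); rewrite E; clear; lra.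
Qed.

End slices_estimate.

(** * The interpolation inequality *)

Lemma powR3K {R : realType} (s : R) : 0 <= s -> (s `^ 3^-1) ^+ 3 = s.
Proof. by move=> s0; rewrite -powR_mulrn ?powR_ge0// -powRrM mulVf// powRr1. Qed.

Section power_integral.
Context {R : realType} {d : nat}.
Variable L : R.
Hypothesis L_gt0 : 0 < L.
Implicit Types (f u v : 'rV[R]_d -> R) (x y z : 'rV[R]_d).
Local Notation integ := (@cell_integrable R d L).
Local Notation "'\I_' x f" := (\int[@lebesgue_rV R d]_(x in cell L) f)
  (at level 36, x name, f at level 36).

Lemma crossing (r : nat -> R) (s : R) a b : (a <= b)%N -> r a <= s < r b ->
  exists2 n, (a <= n < b)%N & r n <= s < r n.+1.
Proof.
elim: b => [|b ih].
  by rewrite leqn0 => /eqP -> /andP[/le_lt_trans h /h]; rewrite ltxx.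
rewrite leq_eqVlt => /predU1P[->/andP[/le_lt_trans h /h]|ab /andP[ra rb]].
  by rewrite ltxx.
have [h|h] := ltP s (r b).
  have rab : r a <= s < r b by rewrite ra.
  have [n /andP[an nb] hn] := ih ab rab.
  by exists n => //; rewrite an (ltn_trans nb).
by exists b; rewrite ?h ?rb// ltnSn andbT.
Qed.

Lemma powR43 (s : R) : 0 <= s -> s `^ (4 / 3) = s * s `^ 3^-1.
Proof.
move=> s0; rewrite -{2}(powRr1 s0) -powRD; last by apply/implyP; lra.
by congr (_ `^ _); lra.
Qed.

Lemma powR43_le_slices u (eta : R) M x : 0 < eta ->
  level eta 1 ^+ 3 <= `|u x| < level eta M.+1 ^+ 3 ->
  `|u x| `^ (4 / 3) <= \sum_(n < M) level eta n ^- 2 * (u x * usl u eta n x).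
Proof.
move=> eta0 h; have [|n /andP[n1 nM] /andP[h1 h2]] :=
  @crossing (fun n => level eta n ^+ 3) `|u x| 1 M.+1 _ h; first by [].
(* The slice just below |u| is full and contributes 7 [level eta n] |u|, whereas |u|^(1/3) is below
   4 [level eta n]. This is why the range starts at [level eta 1]. *)
case: n n1 nM h1 h2 => // n _ nM h1 h2.
rewrite (bigD1 (Ordinal (nM : (n < M)%N)))//=.
rewrite -[leLHS]addr0; apply: lerD; last first.
  apply: sumr_ge0 => m _; apply: mulr_ge0; first by rewrite invr_ge0 sqr_ge0.
  exact: mul_usl_ge0.
have l0 := level_gt0 eta0 n.
rewrite /usl (mul_slice (level3_le eta0 n) h1) !levelS in h2 *.
have -> : level eta n ^- 2 * (`|u x| * ((2 * level eta n) ^+ 3 - level eta n ^+ 3)) =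
    `|u x| * (7 * level eta n) by field; rewrite gt_eqF.
rewrite powR43// ler_wpM2l//.
have q4 : `|u x| `^ 3^-1 < 2 * (2 * level eta n).
  rewrite -(@ltr_pXn2r _ 3)// ?nnegrE ?powR_ge0 ?powR3K//.
  by rewrite !mulr_ge0// ltW.
by apply: (le_trans (ltW q4)); lra.
Qed.

(** The bound of [sum_pairing_le] does not see the ends of the ladder, so it can be extended in both
    directions at once, with monotone convergence for the truncations [G N]. *)
Lemma integral_powR43_le u T lam j : torus_periodic L u -> integ u ->
  (forall i, variation_le L i u T) -> 0 < lam ->
  flux L u j -> integ (fun x => dotv (j x) (j x)) ->
  (\int[lebesgue_rV]_(x in cell L) (`|u x| `^ (4 / 3))%:E <=
  (\I_x (dotv (j x) (j x)) / lam ^+ 2 + 200 * 200 * d%:R * lam * T)%:E)%E.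
Proof.
move=> pu iu uT lam0 fj iJ; set K := (X in (_ <= X%:E)%E).
pose eta N : R := 2^-1 ^+ N.
have eta0 N : 0 < eta N by rewrite exprn_gt0.
(* [N + N.+2] slices control |u|^(4/3) where 2 / 2^N <= |u|^(1/3) < 2^(N + 3), a range that
   increases with [N]. *)
pose lo N := level (eta N) 1; pose hi N := level (eta N) (N + N.+2)%N.+1.
have loE N : lo N = 2 / 2 ^+ N by rewrite /lo /level /eta expr1 exprVn mulrC.
have hiE N : hi N = 2 ^+ N.+3.
  rewrite /hi /level /eta exprVn -addnS exprD mulrA mulVf ?mul1r//.
have lo_le N : lo N.+1 <= lo N.
  rewrite !loE ler_pM2l// lef_pV2 ?posrE ?exprn_gt0//.
  by rewrite ler_weXn2l// ler1n.
have hi_le N : hi N <= hi N.+1 by rewrite !hiE ler_weXn2l// ler1n.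
have lo0 N : 0 <= lo N by rewrite loE divr_ge0// exprn_ge0.
have hi0 N : 0 <= hi N by rewrite hiE exprn_ge0.
pose G N x := if lo N ^+ 3 <= `|u x| < hi N ^+ 3 then `|u x| `^ (4 / 3) else 0.
have G0 N x : 0 <= G N x by rewrite /G; case: ifP => // _; exact: powR_ge0.
have mnu : measurable_fun setT (fun x => `|u x|).
  by apply: measurableT_comp => //; exact: (periodic_measurable L_gt0 pu iu).
have mG N : measurable_fun (cell L) (G N).
  apply: measurable_funTS; apply: measurable_fun_ifT => //.
    apply: measurable_and.
      by apply: measurable_fun_ler.
    by apply: measurable_fun_ltr.
  have mp : measurable_fun [set: measurableTypeR R] (fun s : R => s `^ (4 / 3)).
    exact: measurable_powR.
  exact: (measurableT_comp mp mnu).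
have nd x : {homo G^~ x : n m / (n <= m)%N >-> n <= m}.
  apply: homo_leq => // [? ? ?|N]; first exact: le_trans.
  rewrite {1}/G; case: ifP => // /andP[h1 h2]; rewrite /G ifT//.
  rewrite (le_trans _ h1) ?(lt_le_trans h2)// lerXn2r ?nnegrE//.
have GK N : (\int[lebesgue_rV]_(x in cell L) (G N x)%:E <= K%:E)%E.
  pose M := (N + N.+2)%N.
  have MS : M = (N + N).+2 by rewrite /M !addnS.
  pose F x := \sum_(n < M) level (eta N) n ^- 2 * (u x * usl u (eta N) n x).
  have iF : integ F.
    by apply: integ_sum => // n; apply: integZ; exact: integ_pairing.
  have F0 x : 0 <= F x.
    apply: sumr_ge0 => n _; apply: mulr_ge0; first by rewrite invr_ge0 sqr_ge0.
    exact: mul_usl_ge0.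
  apply: (@le_trans _ _ (\int[lebesgue_rV]_(x in cell L) (F x)%:E)%E).
    apply: ge0_le_integral => //.
    - by move=> x _; rewrite lee_fin.
    - exact/measurable_EFinP.
    - by apply/measurable_EFinP; exact: integ_measurable.
    - move=> x _; rewrite lee_fin /G; case: ifP => // h.
      exact: powR43_le_slices.
  rewrite int_EFin// lee_fin /F int_sum//; last first.
    by move=> n; apply: integZ; exact: integ_pairing.
  have := @sum_pairing_le R d L L_gt0 u T lam (eta N) (N + N)%N j pu iu uT lam0 (eta0 N) fj iJ.
  rewrite -MS; apply: le_trans; apply: ler_sum => n _.
  by rewrite intZ//; exact: integ_pairing.
have cvgG x : (fun N => (G N x)%:E) @ \oo --> (`|u x| `^ (4 / 3))%:E.
  apply: cvg_near_cst; have [u0|u0] := eqVneq (u x) 0.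
    near=> N; rewrite /G u0 normr0 powR0 ?mulf_neq0 ?invr_eq0//; by case: ifP.
  have un : 0 < `|u x| by rewrite normr_gt0.
  pose q := `|u x| `^ 3^-1.
  have q0 : 0 < q by exact: powR_gt0.
  have qE : q ^+ 3 = `|u x| by exact: powR3K.
  near=> N; rewrite /G ifT// -qE; apply/andP; split.
    rewrite lerXn2r ?nnegrE ?(ltW q0)// loE ler_pdivrMr ?exprn_gt0// mulrC -ler_pdivrMr//.
    apply: (@le_trans _ _ N%:R); first by near: N; exact: nbhs_infty_ger.
    by rewrite -natrX ler_nat ltnW// ltn_expl.
  rewrite ltrXn2r// ?nnegrE ?(ltW q0)// hiE.
  apply: (@le_lt_trans _ _ N%:R); first by near: N; exact: nbhs_infty_ger.
  rewrite -natrX ltr_nat; apply: (leq_trans (ltn_expl N (isT : (1 < 2)%N))).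
  by rewrite leq_pexp2l// -addn3 leq_addr.
have -> : (\int[lebesgue_rV]_(x in cell L) (`|u x| `^ (4 / 3))%:E =
    limn (fun N => \int[lebesgue_rV]_(x in cell L) (G N x)%:E))%E.
  rewrite -monotone_convergence//.
  - by apply: eq_integral => x _; apply/esym/cvg_lim => //; exact: cvgG.
  - by move=> N; exact/measurable_EFinP.
  - by move=> N x _; rewrite lee_fin.
  - by move=> x _ N M NM; rewrite lee_fin nd.
apply: lime_le; last exact/nearW.
apply: ereal_nondecreasing_is_cvgn => N M NM.
apply: ge0_le_integral => //.
- by move=> x _; rewrite lee_fin.
- exact/measurable_EFinP.
- exact/measurable_EFinP.
- by move=> x _; rewrite lee_fin nd.
Unshelve. all: by end_near. Qed.

End power_integral.

(** * Optimisation of the scale *)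

Section optimisation.
Context {R : realType}.

Lemma optimise_scale (y J T B : R) : 0 <= J -> 0 <= T -> 0 <= B ->
  (forall lam, 0 < lam -> y <= J / lam ^+ 2 + B * lam * T) ->
  y <= (1 + B) * (J `^ 3^-1 * T `^ (2 / 3)).
Proof.
move=> J0 T0 B0 H.
move: T0; rewrite le_eqVlt => /predU1P[T0|T0].
  subst T; rewrite powR0 ?mulr0 ?mulf_neq0 ?invr_eq0//.
  apply/ler_addgt0Pr => e e0; rewrite add0r.
  (* With [T = 0] the bound improves as [lam] grows: this value is at least 1 and makes J / lam^2 at
     most [e]. *)
  have l1 : 1 <= J / e + 1 by rewrite lerDr divr_ge0// ltW.
  have l0 : 0 < J / e + 1 by apply: lt_le_trans l1.
  apply: (le_trans (H _ l0)); rewrite mulr0 addr0 ler_pdivrMr ?exprn_gt0//.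
  apply: (@le_trans _ _ (e * (J / e + 1))).
    by rewrite mulrDr mulrC divfK ?gt_eqF// mulr1 lerDl ltW.
  by rewrite ler_wpM2l ?(ltW e0)// expr2 ler_peMr// ltW.
move: J0; rewrite le_eqVlt => /predU1P[J0|J0].
  subst J; rewrite powR0 ?invr_eq0// mul0r mulr0.
  apply/ler_addgt0Pr => e e0; rewrite add0r.
  (* With [J = 0] the bound improves as [lam] decreases; [e / (B * T + 1)] brings it below [e]. *)
  have BT : 0 <= B * T by rewrite mulr_ge0// ltW.
  have BT1 : 0 < B * T + 1 by rewrite ltr_wpDl.
  apply: (le_trans (H _ (divr_gt0 e0 BT1))); rewrite mul0r add0r.
  rewrite mulrAC mulrA ler_pdivrMr// mulrC ler_wpM2l ?(ltW e0)//.
  by rewrite lerDl.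
pose a := J `^ 3^-1; pose b := T `^ 3^-1.
have a0 : 0 < a by exact: powR_gt0.
have b0 : 0 < b by exact: powR_gt0.
have aE : a ^+ 3 = J by exact/powR3K/ltW.
have bE : b ^+ 3 = T by exact/powR3K/ltW.
have -> : T `^ (2 / 3) = b ^+ 2.
  by rewrite -powR_mulrn ?powR_ge0// -powRrM mulrC.
(* The choice [lam = a / b] balances the two terms: J / lam^2 and lam T both equal a b^2. *)
apply: (le_trans (H _ (divr_gt0 a0 b0))).
rewrite -/a -{1}aE -{1}bE le_eqVlt; apply/orP; left; apply/eqP.
by field; rewrite !gt_eqF.
Qed.

End optimisation.

(** * From fluxes and trigonometric tests to the norms of the theorem *)

Section interpolation.
Context {R : realType} {d : nat}.
Variable L : R.
Hypothesis L_gt0 : 0 < L.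
Implicit Types (f u v : 'rV[R]_d -> R) (x y z : 'rV[R]_d).
Local Notation integ := (@cell_integrable R d L).
Local Notation "'\I_' x f" := (\int[@lebesgue_rV R d]_(x in cell L) f)
  (at level 36, x name, f at level 36).

Lemma dotv_ge0 (v : 'rV[R]_d) : 0 <= dotv v v.
Proof. by apply: sumr_ge0 => i _; rewrite -expr2 sqr_ge0. Qed.

(** The field with [- f] in direction [i] and 0 elsewhere is an admissible competitor, its Euclidean
    norm being |f|. *)
Lemma distr_grad_le_variation u i f : integ u -> trig_unit L f ->
  ((\I_x (u x * partial i f x))%:E <= grad_variation L u)%E.
Proof.
move=> iu [tf f1]; apply: ereal_sup_ubound.
pose phi x : 'rV[R]_d := \row_j (if j == i then - f x else 0).
have phiE j : coordf phi j = if j == i then fun x => - f x else fun=> 0.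
  by apply/funext => x; rewrite /coordf mxE; case: ifP.
have tphi j : trig_poly L (coordf phi j).
  by rewrite phiE; case: ifP => _; [exact: trig_opp|exact: trig_cst].
exists phi; first split.
- split=> [j x|j]; last exact: (trig_smooth (tphi j)).
  by apply/rowP => k; have := trig_periodic L_gt0 (tphi k) j x.
- move=> x; rewrite /enorm /dotv (bigD1 i)//= big1 ?addr0; last first.
    by move=> j ji; rewrite mxE (negbTE ji) mul0r.
  by rewrite mxE eqxx -expr2 sqrtr_sqr normrN.
have dphi x : divergence phi x = - partial i f x.
  rewrite /divergence (bigD1 i)//= big1 ?addr0; last first.
    by move=> j ji; rewrite phiE (negbTE ji) partial_cst.
  rewrite phiE eqxx /partial deriveN//.
  exact/diff_derivable/(trig_differentiable x tf).
congr (_%:E); rewrite /distr_grad -mulN1r -intZ.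
  by apply: eq_Rintegral => x _; rewrite dphi mulN1r mulrN opprK.
under eq_fun do rewrite dphi mulrN -mulN1r.
by apply/integZ/integ_trigM => //; exact: trig_partial.
Qed.

Lemma grad_variation_ge0 u (i : 'I_d) : integ u -> (0 <= grad_variation L u)%E.
Proof.
move=> iu; apply: le_trans (distr_grad_le_variation i iu (@trig_unit0 R d L)).
under eq_Rintegral do rewrite partial_cst mulr0.
by rewrite Rintegral_cst// mul0r.
Qed.

Lemma variation_le_grad u i : integ u -> (grad_variation L u < +oo)%E ->
  variation_le L i u (fine (grad_variation L u)).
Proof.
move=> iu Tfin f tf; rewrite -lee_fin (@fineK _ (grad_variation L u)).
  exact: distr_grad_le_variation.
by rewrite ge0_fin_numE// (grad_variation_ge0 i).
Qed.

Lemma integral_powR43_le_flux u lam j : torus_periodic L u -> integ u ->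
  (grad_variation L u < +oo)%E -> 0 < lam -> flux L u j -> (\int[lebesgue_rV]_(x in cell L) (enorm (j x) ^+ 2)%:E < +oo)%E ->
  (\int[lebesgue_rV]_(x in cell L) (`|u x| `^ (4 / 3))%:E <=
  (\I_x (enorm (j x) ^+ 2) / lam ^+ 2
    + 200 * 200 * d%:R * lam * fine (grad_variation L u))%:E)%E.
Proof.
move=> pu iu Tfin lam0 fj Jfin.
have enormE x : enorm (j x) ^+ 2 = dotv (j x) (j x) by rewrite sqr_sqrtr ?dotv_ge0.
have iJ : integ (fun x => dotv (j x) (j x)).
  have [_ ij _] := fj.
  have J0 : (0 <= \int[lebesgue_rV]_(x in cell L) (dotv (j x) (j x))%:E)%E.
    by apply: integral_ge0 => x _; rewrite lee_fin dotv_ge0.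
  have mJ : measurable_fun (cell L) (fun x => dotv (j x) (j x)).
    apply: measurable_sum => i.
    by apply: measurable_funM; exact: (integ_measurable (ij i)).
  move: Jfin; under eq_integral do rewrite enormE.
  move=> Jfin.
  apply: (@integ_ge0P _ _ _ _ (fine (\int[lebesgue_rV]_(x in cell L) (dotv (j x) (j x))%:E)) mJ).
    by move=> x; exact: dotv_ge0.
  by rewrite fineK// ge0_fin_numE.
under eq_Rintegral do rewrite enormE.
apply: integral_powR43_le => // i; exact: variation_le_grad.
Qed.

(** The infimum inside [Hm1_norm], kept without its square root because [lam] is optimised against
    the energy itself. *)
Definition sqr_flux u : \bar R :=
  ereal_inf [set \int[lebesgue_rV]_(x in cell L) (enorm (j x) ^+ 2)%:E | j in flux L u]%E.

Lemma sqr_flux_ge0 u : (0 <= sqr_flux u)%E.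
Proof.
by apply: le_ereal_inf_tmp => _ [j _ <-]; apply: integral_ge0 => x _; rewrite lee_fin sqr_ge0.
Qed.

Lemma integral_powR43_lty u : torus_periodic L u -> integ u ->
  (grad_variation L u < +oo)%E -> (sqr_flux u < +oo)%E ->
  (\int[lebesgue_rV]_(x in cell L) (`|u x| `^ (4 / 3))%:E < +oo)%E.
Proof.
move=> pu iu Tfin /ereal_inf_lt[_ [j fj <-] Jfin].
by have /le_lt_trans := integral_powR43_le_flux pu iu Tfin ltr01 fj Jfin; apply; exact: ltry.
Qed.

Lemma integral_powR43_le_sqr_flux u lam : torus_periodic L u -> integ u ->
  (grad_variation L u < +oo)%E -> (sqr_flux u < +oo)%E -> 0 < lam ->
  \I_x (`|u x| `^ (4 / 3)) <= fine (sqr_flux u) / lam ^+ 2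
    + 200 * 200 * d%:R * lam * fine (grad_variation L u).
Proof.
move=> pu iu Tfin Jfin lam0.
have yfin := integral_powR43_lty pu iu Tfin Jfin.
have yE : (\int[lebesgue_rV]_(x in cell L) (`|u x| `^ (4 / 3))%:E =
    (\I_x (`|u x| `^ (4 / 3)))%:E)%E.
  rewrite [in RHS]/Rintegral fineK// ge0_fin_numE//.
  by apply: integral_ge0 => x _; rewrite lee_fin powR_ge0.
set y := Rintegral _ _ _ in yE *; set c := 200 * 200 * _ * _ * _.
have l2 : 0 < lam ^+ 2 by rewrite exprn_gt0.
(* Solving for the energy gives a lower bound free of [j], which passes to the infimum; fluxes of
   infinite energy satisfy it trivially. *)
rewrite -lerBlDr ler_pdivlMr// -lee_fin fineK; last first.
  by rewrite ge0_fin_numE// sqr_flux_ge0.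
apply: le_ereal_inf_tmp => _ [j fj <-].
have [Joo|/negP] := boolP (\int[lebesgue_rV]_(x in cell L) (enorm (j x) ^+ 2)%:E < +oo)%E; last first.
  by move/negP; rewrite -leNgt leye_eq => /eqP ->; rewrite leey.
have := integral_powR43_le_flux pu iu Tfin lam0 fj Joo.
rewrite yE lee_fin -/c -lerBlDr ler_pdivlMr// -lee_fin [in X in (_ <= X)%E -> _]/Rintegral fineK//.
by rewrite ge0_fin_numE//; apply: integral_ge0 => x _; rewrite lee_fin sqr_ge0.
Qed.

Lemma Lp_normE u (p : R) : p != 0 ->
  Lp_norm L p u = poweR (\int[lebesgue_rV]_(x in cell L) (`|u x| `^ p)%:E) p^-1.
Proof.
move=> p0; rewrite /Lp_norm unlock [in RHS]integral_mkcond.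
congr poweR; apply: eq_integral => x _; rewrite !patchE; case: ifPn => //= _.
by rewrite normr0 powR0.
Qed.

End interpolation.

Theorem proposition1p1 (R : realType) (d : nat) (hd : (1 <= d)%N) :
  exists C : R, 0 < C /\
    forall (L : R) (u : 'rV[R]_d -> R),
      0 < L ->
      torus_periodic L u ->
      cell_integrable L u ->
      \int[lebesgue_rV]_(x in cell L) u x = 0 ->
      (grad_variation L u < +oo)%E ->
      (Hm1_norm L u < +oo)%E ->
      (Lp_norm L (4 / 3) u <=
         C%:E * grad_variation L u `^ 2^-1 * Hm1_norm L u `^ 2^-1)%E.
Proof.
pose B : R := 200 * 200 * d%:R.
have B0 : 0 <= B by rewrite !mulr_ge0.
have B1 : 0 < 1 + B by rewrite ltr_wpDr.
(* [1 + B] is the constant for the integral of |u|^(4/3); the norm is the power 3/4 of that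
   integral. *)
exists ((1 + B) `^ (3 / 4)); split; first exact: powR_gt0.
move=> L u L0 pu iu _ Tfin Hfin.
have Jfin : (sqr_flux L u < +oo)%E by apply: lty_poweRy Hfin; rewrite invr_eq0.
pose T := fine (grad_variation L u); pose J := fine (sqr_flux L u).
have T0 : 0 <= T by exact/fine_ge0/(grad_variation_ge0 L0 (Ordinal hd)).
have J0 : 0 <= J by exact/fine_ge0/sqr_flux_ge0.
have TE : grad_variation L u = T%:E.
  by rewrite fineK// ge0_fin_numE// (grad_variation_ge0 L0 (Ordinal hd)).
have JE : sqr_flux L u = J%:E by rewrite fineK// ge0_fin_numE// sqr_flux_ge0.
pose y := \int[lebesgue_rV]_(x in cell L) (`|u x| `^ (4 / 3)).
have y0 : 0 <= y by apply: Rintegral_ge0 => x _; exact: powR_ge0.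
have yB : y <= (1 + B) * (J `^ 3^-1 * T `^ (2 / 3)).
  by apply: optimise_scale => // lam; exact: integral_powR43_le_sqr_flux.
rewrite Lp_normE ?mulf_neq0 ?invr_eq0// /Hm1_norm -/(sqr_flux L u) TE JE.
have -> : (\int[lebesgue_rV]_(x in cell L) (`|u x| `^ (4 / 3))%:E = y%:E)%E.
  rewrite /y /Rintegral fineK// ge0_fin_numE.
    exact: integral_powR43_lty.
  by apply: integral_ge0 => x _; rewrite lee_fin powR_ge0.
rewrite !poweR_EFin -!EFinM lee_fin.
have -> : (4 / 3)^-1 = 3 / 4 :> R by field.
apply: (@le_trans _ _ (((1 + B) * (J `^ 3^-1 * T `^ (2 / 3))) `^ (3 / 4))).
  by rewrite ge0_ler_powR ?nnegrE// mulr_ge0 ?(ltW B1)// mulr_ge0 ?powR_ge0.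
rewrite powRM ?(ltW B1) ?mulr_ge0 ?powR_ge0// powRM ?powR_ge0// -!powRrM.
(* The exponent 1/4 of [J] is written as half of a half because [Hm1_norm] is already the square
   root of [sqr_flux]. *)
have -> : 3^-1 * (3 / 4) = 2^-1 / 2 :> R by field.
have -> : 2 / 3 * (3 / 4) = 2^-1 :> R by field.
by rewrite -mulrA [X in _ * X]mulrC.
Qed.
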